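(* Let $n\geq 1$, let $V=\mathbb{C}^n$, let $T=T(V)\otimes T(V^* )$ be the mixed tensor algebra over $V$, and let $A\subseteq T$ be a subset. Then there is a subgroup $G$ of the unitary group $\mathcal{U}(n)$ with $A=T^G$ if and only if $A$ is a nondegenerate contraction-closed graded $*$-subalgebra of $T$.
   Context: $T(V)=\bigoplus_{k\ge 0}V^{\otimes k}$, $T(V^* )=\bigoplus_{k\ge 0}V^{*\otimes k}$, and $T=T(V)\otimes T(V^* )\cong\bigoplus_{k,l\ge 0}V^{\otimes k}\otimes V^{*\otimes l}$, with multiplication (also written $\otimes$) $(x\otimes y)\otimes(x'\otimes y')=(x\otimes x')\otimes(y\otimes y')$ for $x,x'\in T(V)$, $y,y'\in T(V^* )$. For $U\in \mathrm{GL}(n,\mathbb{C})$, $z\mapsto z^U$ is the unique algebra endomorphism of $T$ with $x^U=Ux$ for $x\in V$ and $y^U=(U^{\mathsf T})^{-1}y$ for $y\in V^*$ (coordinates with respect to the dual basis; i.e. $y^U=y\circ U^{-1}$). For $G\subseteq \mathrm{GL}(n,\mathbb{C})$, $T^G:=\{z\in T\mid z^U=z \text{ for all } U\in G\}$. Graded: for $A\subseteq T$ put $A_{k,l}:=A\cap(V^{\otimes k}\otimes V^{*\otimes l})$; a subalgebra $A$ of $T$ is graded if $A=\bigoplus_{k,l\ge0}A_{k,l}$. $*$-operation: let $e_1,\ldots,e_n$ be the standard basis of $V$ and $e_1^*,\ldots,e_n^*$ the dual basis of $V^*$. The map $e_i\mapsto e_i^*$ extends to a unique function $x\mapsto x^*$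 on $T$ with $(x^* )^*=x$, $(\lambda x)^*=\overline{\lambda}x^*$, $(x+y)^*=x^*+y^*$, $(x\otimes y)^*=y^*\otimes x^*$ for all $x,y\in T$, $\lambda\in\mathbb{C}$. A subalgebra $A$ of $T$ is a $*$-subalgebra if $A^*=A$, where $A^*=\{a^*\mid a\in A\}$. Nondegenerate: a subalgebra $A$ of $T$ is nondegenerate if there is no proper subspace $W$ of $V$ with $A\subseteq T(W)\otimes T(W^* )$, where $W^*$ is regarded as the subspace $\{w^*\mid w\in W\}$ of $V^*$. Contraction-closed: a graded subalgebra is contraction-closed if it is closed under all contraction operators $V^{\otimes k}\otimes V^{*\otimes l}\to V^{\otimes (k-1)}\otimes V^{*\otimes (l-1)}$ ($k,l\ge1$) that pair the $i$-th $V$-factor with the $j$-th $V^*$-factor, $1\le i\le k$, $1\le j\le l$. *)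

(* Defs.v *)
From HB Require Import structures.
From mathcomp Require Import all_boot all_order all_algebra.
From mathcomp Require Import finmap.
From mathcomp Require Import boolp classical_sets.
From mathcomp.multinomials Require Import monalg.
Set Implicit Arguments.
Unset Strict Implicit.
Unset Printing Implicit Defensive.

Import Order.TTheory GRing.Theory Num.Theory.
Local Open Scope classical_set_scope.
Local Open Scope ring_scope.

(* With V = C^n and V' its dual, the pair of words (i_1...i_k, j_1...j_l)
   stands for the basis tensor
   e_{i_1} (x) ... (x) e_{i_k} (x) e*_{j_1} (x) ... (x) e*_{j_l}
   of V^{(x)k} (x) V'^{(x)l}. *)
Record mword (n : nat) := MWord { vword : seq 'I_n; dword : seq 'I_n }.

(* Opaque, so that conversion tests between elements of the monoid algebra
   below do not unfold the choice structure of words. *)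
Fact mword_choice n : Choice (mword n).
Proof.
have wordsK : cancel (fun a : mword n => (vword a, dword a))
                     (fun p => MWord p.1 p.2) by case.
exact: Choice.class (can_type wordsK).
Qed.
HB.instance Definition _ n : Choice (mword n) := mword_choice n.

Section WordMonoid.
Variable n : nat.
Implicit Types a b : mword n.

Definition mword1 : mword n := MWord [::] [::].
Definition mwordM a b : mword n :=
  MWord (vword a ++ vword b) (dword a ++ dword b).

Fact mwordMA : associative mwordM.
Proof. by move=> a b c; rewrite /mwordM /= !catA. Qed.

Fact mword1M : left_id mword1 mwordM.
Proof. by case. Qed.

Fact mwordM1 : right_id mword1 mwordM.
Proof. by case=> u v; rewrite /mwordM /= !cats0. Qed.

Fact mwordM_eq1 a b : mwordM a b = mword1 -> a = mword1 /\ b = mword1.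
Proof. by case: a b => [[|? ?] [|? ?]] [[|? ?] [|? ?]]. Qed.

HB.instance Definition _ := Choice_isMonomialDef.Build (mword n)
  mwordMA mword1M mwordM1 mwordM_eq1.

End WordMonoid.

(* The mixed tensor algebra T(V) (x) T(V'): as a vector space it is free on the
   pairs of words, and its product is concatenation in both components. *)
Notation mtens C n := {malg C[mword n]}.

Section TensorOperations.
Variables (C : numClosedFieldType) (n : nat).
Local Notation T := (mtens C n).
Implicit Types (a : mword n) (z : T).

Definition ebasis (i : 'I_n) : T := << MWord [:: i] [::] >>.
Definition edual (j : 'I_n) : T := << MWord [::] [:: j] >>.

(* Vectors are columns of coordinates with respect to e_1, ..., e_n;
   covectors are columns of coordinates with respect to e*_1, ..., e*_n. *)
Definition vec (x : 'cV[C]_n) : T := \sum_i x i 0 *: ebasis i.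
Definition covec (y : 'cV[C]_n) : T := \sum_j y j 0 *: edual j.

(* e_{i_1}...e_{i_k} e*_{j_1}...e*_{j_l} |->
     (U e_{i_1})...(U e_{i_k}) (U^{-T} e*_{j_1})...(U^{-T} e*_{j_l}). *)
Definition act_word (U : 'M[C]_n) a : T :=
  (\prod_(i <- vword a) vec (col i U)) *
  (\prod_(j <- dword a) covec (col j (invmx U^T))).

(* The algebra endomorphism of T extending x |-> U x on V and
   y |-> y o U^{-1} on V'. *)
Definition mtact (U : 'M[C]_n) z : T :=
  \sum_(a <- msupp z) z@_a *: act_word U a.

(* e_{i_1}...e_{i_k} e*_{j_1}...e*_{j_l} |->
     e_{j_l}...e_{j_1} e*_{i_k}...e*_{i_1}. *)
Definition star_word a : mword n := MWord (rev (dword a)) (rev (vword a)).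

Definition mtstar z : T :=
  \sum_(a <- msupp z) (z@_a)^* *: << star_word a >>.

Definition del_nth (i : nat) (w : seq 'I_n) : seq 'I_n :=
  take i w ++ drop i.+1 w.

Definition contract_word (i j : nat) a : T :=
  match onth (vword a) i, onth (dword a) j with
  | Some p, Some q =>
      if p == q then << MWord (del_nth i (vword a)) (del_nth j (dword a)) >>
      else 0
  | _, _ => 0
  end.

(* On V^{(x)k} (x) V'^{(x)l}, for i < k and j < l, this pairs the i-th V-factor
   with the j-th V'-factor; positions are numbered from 0. *)
Definition mtcontract (i j : nat) z : T :=
  \sum_(a <- msupp z) z@_a *: contract_word i j a.

End TensorOperations.

Section TensorSubsets.
Variables (C : numClosedFieldType) (n : nat).
Local Notation T := (mtens C n).
Implicit Types (z : T) (A S : set T).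

Definition invariants (G : set 'M[C]_n) : set T :=
  [set z | forall U, G U -> mtact U z = z].

Definition unitary_subgroup (G : set 'M[C]_n) : Prop :=
  [/\ G `<=` [set U | U \is unitarymx],
      G 1%:M,
      forall U U', G U -> G U' -> G (U *m U') &
      forall U, G U -> G (invmx U)].

Definition subalgebra A : Prop :=
  [/\ A 1,
      forall x y, A x -> A y -> A (x + y),
      forall c x, A x -> A (c *: x) &
      forall x y, A x -> A y -> A (x * y)].

(* V^{(x)k} (x) V'^{(x)l} as a subset of T. *)
Definition bidegree (k l : nat) : set T :=
  [set z | forall a, a \in msupp z -> size (vword a) = k /\ size (dword a) = l].

(* A is the sum of the A `&` bidegree k l; the sum is direct since it is so
   in T. *)
Definition graded A : Prop :=
  A = [set z | exists N (x : nat -> nat -> T),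
         (forall k l, (A `&` bidegree k l) (x k l)) /\
         z = \sum_(k < N) \sum_(l < N) x k l].

Definition star_closed A : Prop := @mtstar C n @` A = A.

Definition contraction_closed A : Prop :=
  forall k l i j, (i < k)%N -> (j < l)%N ->
  forall z, (A `&` bidegree k l) z -> A (mtcontract i j z).

Definition lin_span S : set T :=
  [set z | exists m (c : 'I_m -> C) (x : 'I_m -> T),
     (forall i, S (x i)) /\ z = \sum_i c i *: x i].

(* The linear span of all finite products (the empty one included) of elements
   of S; for S a subspace of V, this is T(S). *)
Definition tensors_over S : set T :=
  lin_span [set z | exists2 s : seq T,
     (forall x, x \in s -> S x) & z = \prod_(x <- s) x].

(* T(W) (x) T(W'), with W' = {w^* | w in W} in the dual of V. *)
Definition mixed_tensors_over (W : {vspace 'cV[C]_n}) : set T :=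
  let WV : set T := @vec C n @` [set w | w \in W] in
  lin_span [set z | exists x y,
     [/\ tensors_over WV x, tensors_over (@mtstar C n @` WV) y & z = x * y]].

Definition nondegenerate_subset A : Prop :=
  ~ exists W : {vspace 'cV[C]_n}, W != fullv /\ A `<=` mixed_tensors_over W.

End TensorSubsets.

(* mtact U is an algebra endomorphism with the prescribed values on V and on its
   dual, and mtstar is a conjugate-linear anti-involution with
   e_i |-> e*_i. *)
Section Characterization.
Variables (C : numClosedFieldType) (n : nat).
Local Notation T := (mtens C n).
Implicit Types (x y z : T).

Lemma malgUZ (c : C) (a : mword n) : << c *g a >> = c *: << a >> :> T.
Proof. by apply/malgP => k; rewrite mcoeffU mcoeffZ mcoeffU mulr_natr. Qed.

Lemma malgUM (a b : mword n) : << a >> * << b >> = << mmul a b >> :> T.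
Proof. by rewrite malgM_def fgmulUU mulr1. Qed.

Lemma semilin_widen (s : {rmorphism C -> C}) (h : mword n -> T) (d : {fset mword n}) z :
  (msupp z `<=` d)%fset ->
  \sum_(a <- msupp z) s z@_a *: h a = \sum_(a <- d) s z@_a *: h a.
Proof.
move=> le; rewrite [RHS](big_fsetID _ (fun a => a \in msupp z)) /=.
rewrite [X in _ + X]big1_fset ?addr0; last first.
  move=> a; rewrite !inE /= => /andP[_ na] _.
  by rewrite mcoeff_outdom // rmorph0 scale0r.
congr bigop; congr enum_fset; apply/fsetP=> a; rewrite !inE /=.
by case: (boolP (a \in msupp z)) => [/(fsubsetP le)->|]; rewrite ?andbF ?andbT.
Qed.

Lemma semilinD (s : {rmorphism C -> C}) h x y :
  \sum_(a <- msupp (x + y)) s (x + y)@_a *: h a =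
  \sum_(a <- msupp x) s x@_a *: h a + \sum_(a <- msupp y) s y@_a *: h a :> T.
Proof.
rewrite (semilin_widen _ _ (msuppD_le x y)).
rewrite (semilin_widen _ _ (fsubsetUl (msupp x) (msupp y))).
rewrite (semilin_widen s h (fsubsetUr (msupp x) (msupp y))).
by rewrite -big_split; apply: eq_bigr => a _; rewrite mcoeffD rmorphD scalerDl.
Qed.

Lemma semilinZ (s : {rmorphism C -> C}) h c x :
  \sum_(a <- msupp (c *: x)) s (c *: x)@_a *: h a =
  s c *: \sum_(a <- msupp x) s x@_a *: h a :> T.
Proof.
rewrite (semilin_widen _ _ (msuppZ_le c x)) scaler_sumr.
by apply: eq_bigr => a _; rewrite mcoeffZ rmorphM scalerA.
Qed.

Lemma semilinU (s : {rmorphism C -> C}) h a :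
  \sum_(b <- msupp (<<a>> : T)) s (<<a>> : T)@_b *: h b = h a :> T.
Proof. by rewrite msuppU1 big_seq_fset1 mcoeffUU rmorph1 scale1r. Qed.

Lemma mtens_ind (P : T -> Prop) : (forall x y, P x -> P y -> P (x + y)) ->
  (forall c x, P x -> P (c *: x)) -> (forall a, P <<a>>) -> P 0 -> forall x, P x.
Proof.
move=> PD PZ PU P0 x; rewrite [x]monalgE; apply: big_ind => // a _.
rewrite malgUZ; exact: PZ.
Qed.

Lemma mtstarD : {morph (@mtstar C n) : x y / x + y}.
Proof. by move=> x y; exact: (@semilinD Num.conj). Qed.

Lemma mtstarZ c x : mtstar (c *: x) = c^* *: mtstar x.
Proof. exact: (@semilinZ Num.conj). Qed.

Lemma mtstarU a : mtstar (<<a>> : T) = << star_word a >>.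
Proof. exact: (@semilinU Num.conj). Qed.

Lemma mtstar0 : mtstar (0 : T) = 0.
Proof. by rewrite /mtstar msupp0 big_seq_fset0. Qed.

Lemma mtstarK : involutive (@mtstar C n).
Proof.
apply: mtens_ind => [x y hx hy|c x hx|[a b]|].
- by rewrite !mtstarD hx hy.
- by rewrite !mtstarZ hx conjCK.
- by rewrite !mtstarU /star_word /= !revK.
- by rewrite !mtstar0.
Qed.

Lemma mtens_mulZr c x y : x * (c *: y) = c *: (x * y).
Proof.
elim/mtens_ind: x => [x x' hx hx'|d x hx|a|].
- by rewrite !mulrDl {}hx {}hx' scalerDr.
- rewrite -(scalerAl d x (c *: y)) -(scalerAl d x y) hx 2!scalerA {hx}.
  by rewrite (mulrC d c).
- elim/mtens_ind: y c => [x x' hx hx'|d x hx|b|] c.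
  + by rewrite scalerDr !mulrDr hx hx' scalerDr.
  + by rewrite scalerA (hx (c * d)) (hx d) scalerA {hx}.
  + by rewrite -malgUZ malgM_def fgmulUU malgUM -malgUZ mul1r.
  + by rewrite scaler0 mulr0 scaler0.
- by rewrite !mul0r scaler0.
Qed.

Lemma mtstarM x y : mtstar (x * y) = mtstar y * mtstar x.
Proof.
elim/mtens_ind: x => [x x'|c x|a|].
- by rewrite mulrDl !mtstarD mulrDr => -> ->.
- by rewrite -(scalerAl c x y) !mtstarZ => ->; rewrite mtens_mulZr.
- elim/mtens_ind: y => [x x'|c x|b|].
  + by rewrite mulrDr !mtstarD mulrDl => -> ->.
  + by rewrite mtens_mulZr !mtstarZ => ->; rewrite -(scalerAl _ (mtstar x)).
  + rewrite malgUM !mtstarU malgUM; congr mkmalgU.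
    by rewrite /star_word /= !rev_cat.
  + by rewrite mulr0 !mtstar0 mul0r.
- by rewrite mul0r !mtstar0 mulr0.
Qed.

Lemma mtstar_ebasis (i : 'I_n) : mtstar (ebasis C i) = edual C i.
Proof. by rewrite mtstarU. Qed.

Lemma mtactD U : {morph (@mtact C n U) : x y / x + y}.
Proof. by move=> x y; exact: (@semilinD idfun). Qed.

Lemma mtactZ U c x : mtact U (c *: x) = c *: mtact U x.
Proof. exact: (@semilinZ idfun). Qed.

Lemma mtactU U a : mtact U (<<a>> : T) = act_word U a.
Proof. exact: (@semilinU idfun). Qed.

Lemma mtact0 U : mtact U (0 : T) = 0.
Proof. by rewrite /mtact msupp0 big_seq_fset0. Qed.

Lemma mtact1 U : mtact U (1 : T) = 1.
Proof. by rewrite mtactU /act_word !big_nil mulr1. Qed.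

Lemma vec_covec (x y : 'cV[C]_n) : vec x * covec y = covec y * vec x.
Proof.
rewrite /vec /covec mulr_suml mulr_sumr; apply: eq_bigr => i _.
rewrite mulr_sumr mulr_suml; apply: eq_bigr => j _.
rewrite -(scalerAl (x i 0)) -(scalerAl (y j 0)) !mtens_mulZr 2!scalerA.
rewrite (mulrC (x i 0)) !malgUM.
by congr (_ *: mkmalgU _ _).
Qed.

Lemma mulrACA_comm (R : pzRingType) (p p' q q' : R) : p' * q = q * p' ->
  p * p' * (q * q') = p * q * (p' * q').
Proof. by move=> pqC; rewrite -!mulrA (mulrA p') pqC !mulrA. Qed.

Lemma prod_comm (R : pzRingType) (I J : Type) (s : seq I) (t : seq J)
    (f : I -> R) (g : J -> R) :
  (forall i j, f i * g j = g j * f i) ->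
  (\prod_(i <- s) f i) * (\prod_(j <- t) g j) =
  (\prod_(j <- t) g j) * (\prod_(i <- s) f i).
Proof.
move=> fgC; apply/esym/commr_prod => i _.
by apply/commr_sym/commr_prod => j _; exact/esym.
Qed.

Lemma mtactM U x y : mtact U (x * y) = mtact U x * mtact U y.
Proof.
elim/mtens_ind: x => [x x'|c x|a|].
- by rewrite mulrDl !mtactD mulrDl => -> ->.
- by rewrite -(scalerAl c x y) !mtactZ => ->; rewrite -(scalerAl c (mtact U x)).
- elim/mtens_ind: y => [x x'|c x|b|].
  + by rewrite mulrDr !mtactD mulrDr => -> ->.
  + by rewrite mtens_mulZr !mtactZ => ->; rewrite mtens_mulZr.
  + rewrite malgUM !mtactU /act_word /= big_cat big_cat /=.
    by apply: mulrACA_comm; apply: prod_comm => ? ?; exact: vec_covec.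
  + by rewrite mulr0 !mtact0 mulr0.
- by rewrite mul0r !mtact0 mul0r.
Qed.

Lemma mtact_vec U (x : 'cV[C]_n) : mtact U (vec x) = vec (U *m x).
Proof.
rewrite /vec (big_morph _ (mtactD U) (mtact0 U)).
under eq_bigr => i _.
  rewrite mtactZ mtactU /act_word /= big_nil big_seq1 mulr1 /vec scaler_sumr.
  over.
rewrite exchange_big; apply: eq_bigr => j _; rewrite mxE scaler_suml.
by apply: eq_bigr => i _; rewrite mxE scalerA (mulrC (x i 0)).
Qed.

Lemma mtact_covec U (x : 'cV[C]_n) : mtact U (covec x) = covec (invmx U^T *m x).
Proof.
rewrite /covec (big_morph _ (mtactD U) (mtact0 U)).
under eq_bigr => i _.
  rewrite mtactZ mtactU /act_word /= big_nil big_seq1 mul1r /covec scaler_sumr.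
  over.
rewrite exchange_big; apply: eq_bigr => j _; rewrite mxE scaler_suml.
by apply: eq_bigr => i _; rewrite mxE scalerA (mulrC (x i 0)).
Qed.

End Characterization.

(* Main.v *)
From HB Require Import structures.
Require Import Defs.
From mathcomp Require Import all_boot all_order all_algebra finmap.
From mathcomp Require Import boolp classical_sets reals.
From mathcomp.multinomials Require Import monalg.
From mathcomp Require Import complex.
From mathcomp Require Import ring lra zify.

(** Easy direction: invariance under a unitary group is preserved by products,
    contractions and the star operation, and the identity tensor
    [\sum_i e_i e*_i] is invariant and lies in no [T(W) (x) T(W')] with [W]
    proper.

    Conversely let [A] be a nondegenerate contraction-closed graded
    star-subalgebra, and let [G] be the group of the unitary matrices that fix
    every tensor of [A]. It must be shown that a tensor [b] fixed by [G] is in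
    [A]. This is Tannaka-Krein duality; the proof given here constructs the
    elements of [G] as characters of a commutative ring, with neither a Haar
    measure nor invariant theory.

    - Matrices [M] with [\sum M_ij e_i e*_j] in [A] form a star-algebra; let
      [P] be its orthogonal projection of the identity matrix. Every leg of a
      tensor [a] of [A] is fixed by [P], because the Gram matrix of that leg is a
      contraction of [a a*] and [P M = M] for [M] in the star-algebra. So [A] is
      contained in the mixed tensors over the range of [P], and [P = 1] by
      nondegeneracy ([delta_mem]). Contracting against the identity tensor then
      permutes factors ([memA_rot], [memA_swap2]).

    - Let [E] be the orthogonal projection of tensors on [A]. On the ring [O] of
      polynomials in the entries [u_ij] of a matrix and their formal conjugates,
      put [h (x^u, y) = (E x, y)], where [(x^u, y)] stands for the matrix
      coefficient of the tensors [x] and [y] ([state]). It is well defined since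
      [A], hence [E], is stable under permutations of factors. It is a positive
      functional ([state_ge0]): contraction-closedness makes [A] a star-algebra
      of matrices, and the orthogonal projection on a star-algebra of matrices
      is completely positive ([kernel_cp], from [twirl_ge0]).

    - If [a] is in [A] then [(a^u, y) - (a, y)] is in the null ideal of [h], for
      [h |(a^u, y)|^2 = (E (a* a), y* y) = |(a, y)|^2] ([coef_null]); with [a]
      the identity tensor, this says that the rows of [u] are orthonormal modulo
      null elements, whence all elements of [O] are bounded.

    - If [g] is not null, then some star-morphism [O -> C] that kills the null
      ideal does not vanish at [g] ([state_character]). Sums of squares modulo
      null elements form an archimedean preordering. Adjoining
      [|g|^2 - h |g|^2 / 2] leaves it proper, and a maximal proper archimedean
      preordering is the set of elements that are nonnegative at a real point.

    - By the third point such a morphism maps [u] to an element of [G]. So if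
      [b] is fixed by [G], all the elements [(b^u, y) - (b, y)] are null;
      applying [h] yields [(E b, y) = (b, y)] for all [y], that is, [b = E b]
      ([fixed_mem]). *)

Import Order.TTheory GRing.Theory Num.Theory.
Set Implicit Arguments.
Unset Strict Implicit.
Unset Printing Implicit Defensive.
Local Open Scope ring_scope.

(** * Preorderings of commutative star-rings and their real points *)

Section Preorderings.
Local Open Scope complex_scope.
Variables (R : realType) (O : comNzRingType).
Variables (iota : {rmorphism R[i] -> O}) (sg : {rmorphism O -> O}).
Hypothesis sgK : involutive sg.
Hypothesis sg_iota : forall c, sg (iota c) = iota (c^* )%C.

Definition hermitian (x : O) := sg x = x.
Definition real_scalar (r : R) : O := iota (r%:C).
Local Notation rho := real_scalar.

Lemma rhoD r s : rho (r + s) = rho r + rho s.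
Proof. by rewrite /rho !rmorphD. Qed.
Lemma rhoN r : rho (- r) = - rho r.
Proof. by rewrite /rho !rmorphN. Qed.
Lemma rhoM r s : rho (r * s) = rho r * rho s.
Proof. by rewrite /rho !rmorphM. Qed.
Lemma rho1 : rho 1 = 1.
Proof. by rewrite /rho !rmorph1. Qed.
Lemma rho0 : rho 0 = 0.
Proof. by rewrite /rho !rmorph0. Qed.
Lemma rho_herm r : hermitian (rho r).
Proof. by rewrite /hermitian sg_iota conjc_real. Qed.

Lemma hermD x y : hermitian x -> hermitian y -> hermitian (x + y).
Proof. by rewrite /hermitian rmorphD => -> ->. Qed.
Lemma hermN x : hermitian x -> hermitian (- x).
Proof. by rewrite /hermitian rmorphN => ->. Qed.
Lemma hermB x y : hermitian x -> hermitian y -> hermitian (x - y).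
Proof. by move=> hx /hermN; exact: hermD. Qed.
Lemma hermM x y : hermitian x -> hermitian y -> hermitian (x * y).
Proof. by rewrite /hermitian rmorphM => -> ->. Qed.
Lemma herm_sq x : hermitian (sg x * x).
Proof. by rewrite /hermitian rmorphM sgK mulrC. Qed.

Record preordering (T : set O) : Prop := Preordering {
  po_herm : forall x, T x -> hermitian x;
  po_add : forall x y, T x -> T y -> T (x + y);
  po_mul : forall x y, T x -> T y -> T (x * y);
  po_sq : forall x, T (sg x * x) }.

Definition archimedean (T : set O) :=
  forall x, hermitian x -> exists r, T (rho r - x).

Section OnePreordering.
Variable T : set O.
Hypothesis T_po : preordering T.

Lemma po_rho r : 0 <= r -> T (rho r).
Proof.
move=> r0; have := po_sq T_po (rho (Num.sqrt r)).
by rewrite rho_herm -rhoM -expr2 sqr_sqrtr.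
Qed.

Lemma po0 : T 0. Proof. by rewrite -rho0; apply: po_rho. Qed.
Lemma po1 : T 1. Proof. by rewrite -rho1; apply: po_rho. Qed.

Definition po_adjoin x : set O := [set p | exists s t, [/\ T s, T t & p = s + x * t]]%classic.

Lemma po_adjoinP x : hermitian x -> preordering (po_adjoin x).
Proof.
move=> hx; split.
- move=> _ [s [t [/(po_herm T_po) hs /(po_herm T_po) ht ->]]].
  exact/hermD/hermM.
- move=> _ _ [s [t [Ts Tt ->]]] [s' [t' [Ts' Tt' ->]]].
  exists (s + s'), (t + t'); split; [exact: (po_add T_po)|exact: (po_add T_po)|ring].
- move=> _ _ [s [t [Ts Tt ->]]] [s' [t' [Ts' Tt' ->]]].
  exists (s * s' + sg x * x * (t * t')), (s * t' + s' * t); split.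
  + apply: (po_add T_po); first exact: (po_mul T_po).
    apply: (po_mul T_po); [exact: (po_sq T_po)|exact: (po_mul T_po)].
  + by apply: (po_add T_po); apply: (po_mul T_po).
  + by rewrite hx; ring.
- move=> y; exists (sg y * y), 0; split; [exact: po_sq|exact: po0|ring].
Qed.

Lemma sub_po_adjoin x : (T `<=` po_adjoin x)%classic.
Proof. by move=> s Ts; exists s, 0; split=> //; [exact: po0|ring]. Qed.

Lemma mem_po_adjoin x : po_adjoin x x.
Proof. by exists 0, 1; split; [exact: po0|exact: po1|ring]. Qed.

(** Once [y * t - 1] and [C - t] are in [T], a bound [- r] below [y] improves to
    [- (r - 1 / C)]: the identity
    [C (y + r) - 1 = (C - t) (y + r) + (y t - 1) + r t] exhibits the difference
    as an element of [T]. *)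
Lemma po_inverse_pos y t : archimedean T -> hermitian y ->
  T t -> T (y * t - 1) -> T y.
Proof.
move=> archT hy Tt Tyt.
have [C0 TC0] := archT _ (po_herm T_po Tt).
pose C := Num.max C0 1.
have Cgt0 : 0 < C by rewrite lt_max ltr01 orbT.
have TC : T (rho C - t).
  have -> : rho C - t = (rho C0 - t) + rho (C - C0) by rewrite rhoD rhoN; ring.
  by apply: (po_add T_po) => //; apply: po_rho; rewrite subr_ge0 le_max lexx.
have step r : 0 <= r -> T (y + rho r) -> T (y + rho (r - C^-1)).
  move=> r0 Ty.
  have -> : y + rho (r - C^-1) =
     rho (C^-1) * ((rho C - t) * (y + rho r) + (y * t - 1) + rho r * t).
    transitivity (rho (C^-1) * (rho C * (y + rho r) - 1)); last by congr (_ * _); ring.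
    rewrite mulrBr mulrA -rhoM mulVf ?gt_eqF // rho1 rhoD rhoN; ring.
  apply: (po_mul T_po); first by apply: po_rho; rewrite invr_ge0 ltW.
  apply: (po_add T_po); last by apply: (po_mul T_po) => //; exact: po_rho.
  by apply: (po_add T_po) => //; exact: (po_mul T_po).
have [r0 Tr0] := archT _ (hermN hy).
suff [r rle0 Tr] : exists2 r, r <= 0 & T (y + rho r).
  have -> : y = y + rho r + rho (- r) by rewrite rhoN; ring.
  by apply: (po_add T_po) => //; apply: po_rho; rewrite oppr_ge0.
have Tr0' : T (y + rho r0) by move: Tr0; rewrite opprK addrC.
have [] := (pselect (exists2 r, r <= 0 & T (y + rho r))) => // nex.
have all k : T (y + rho (r0 - k%:R * C^-1)).
  elim: k => [|k IH]; first by rewrite mul0r subr0.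
  have -> : r0 - k.+1%:R * C^-1 = r0 - k%:R * C^-1 - C^-1 by rewrite -natr1; ring.
  apply: step => //; rewrite leNgt; apply/negP => /ltW rk.
  by apply: nex; exists (r0 - k%:R * C^-1).
case: nex; exists (r0 - (Num.bound `|r0 * C|)%:R * C^-1) => //.
rewrite subr_le0 ler_pdivlMr //.
apply: le_trans (ler_norm _) _; apply/ltW/archi_boundP/normr_ge0.
Qed.

End OnePreordering.

Definition po_proper (T : set O) := preordering T /\ ~ T (-1).

Lemma po_bigcup (F : set (set O)) : (F !=set0)%classic ->
  (forall X, F X -> po_proper X) -> total_on F subset ->
  po_proper (\bigcup_(X in F) X)%classic.
Proof.
move=> [X0 FX0] FP tot; split; last by move=> [X FX]; case: (FP X FX).
have dir x y X Y : F X -> F Y -> X x -> Y y -> exists Z, [/\ F Z, Z x & Z y].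
  move=> FX FY Xx Yy; have [XY|YX] := tot _ _ FX FY.
    by exists Y; split=> //; exact: XY.
  by exists X; split=> //; exact: YX.
split.
- by move=> x [X FX Xx]; apply: (po_herm (FP _ FX).1).
- move=> x y [X FX Xx] [Y FY Yy]; have [Z [FZ Zx Zy]] := dir _ _ _ _ FX FY Xx Yy.
  by exists Z => //; apply: (po_add (FP _ FZ).1).
- move=> x y [X FX Xx] [Y FY Yy]; have [Z [FZ Zx Zy]] := dir _ _ _ _ FX FY Xx Yy.
  by exists Z => //; apply: (po_mul (FP _ FZ).1).
- by move=> x; exists X0 => //; apply: (po_sq (FP _ FX0).1).
Qed.

Lemma po_maximal (T1 : set O) : po_proper T1 ->
  exists T, [/\ po_proper T, (T1 `<=` T)%classic &
     forall T', po_proper T' -> (T `<=` T')%classic -> (T' `<=` T)%classic].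
Proof.
move=> T1P.
(* the empty set is admitted for the sake of the empty chain *)
pose P X := X = set0 \/ (po_proper X /\ (T1 `<=` X)%classic).
have [F FP tot|T [TP Tmax]] := @Zorn_bigcup O P.
  have [[X [FX XP]]|nX] := pselect (exists X, F X /\ X <> set0); last first.
    left; apply/seteqP; split=> // x [X FX Xx].
    by case: nX; exists X; split=> // X0; rewrite X0 in Xx.
  right; pose F' : set (set O) := fun X => F X /\ X <> set0.
  have -> : (\bigcup_(X in F) X = \bigcup_(X in F') X)%classic.
    apply/seteqP; split=> x [Y FY Yx]; exists Y => //; last by case: FY.
    by split=> // Y0; rewrite Y0 in Yx.
  have F'P Y : F' Y -> po_proper Y /\ (T1 `<=` Y)%classic by move=> [/FP []].
  split; last by move=> x T1x; exists X => //; apply: (F'P X _).2.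
  apply: po_bigcup => //; first by exists X.
    by move=> Y /F'P[].
  by move=> Y Z [FY _] [FZ _]; exact: tot.
have T1x : T1 1 by exact: po1 T1P.1.
have TP' : po_proper T /\ (T1 `<=` T)%classic.
  case: TP => // T0; exfalso; apply: (Tmax T1); last by right; split.
  by rewrite T0; split=> [x []|s0]; exact: (s0 1 T1x).
exists T; split; [exact: TP'.1|exact: TP'.2|].
move=> T' T'P TT'; have [//|nT'] := pselect (T' `<=` T)%classic.
by exfalso; apply: (Tmax T') => //; right; split=> // x /(TP'.2 x); exact: TT'.
Qed.

(** If both [T + x T] and [T - x T] were improper, multiplying the two
    expressions of [-1] would express [-1] in [T]. *)
Lemma po_total (T : set O) : po_proper T ->
  (forall T', po_proper T' -> (T `<=` T')%classic -> (T' `<=` T)%classic) ->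
  forall x, hermitian x -> T x \/ T (- x).
Proof.
move=> [TP TN] Tmax.
have adj x : hermitian x -> T x \/ po_adjoin T x (-1).
  move=> hx; have [|nx] := pselect (po_adjoin T x (-1)); [by right|left].
  apply: (Tmax (po_adjoin T x)); [|exact: sub_po_adjoin|exact: mem_po_adjoin].
  by split=> //; exact: po_adjoinP.
move=> x hx; have [|[s [t [Ts Tt e]]]] := adj x hx; first by left.
have [|[s' [t' [Ts' Tt' e']]]] := adj _ (hermN hx); first by right.
exfalso; apply: TN.
have -> : -1 = s + s' + s * s' + sg x * x * (t * t').
  have e1 : x * t = -1 - s by rewrite e; ring.
  have e2 : - x * t' = -1 - s' by rewrite e'; ring.
  have : (x * t) * (- x * t') = (-1 - s) * (-1 - s') by rewrite e1 e2.
  rewrite hx => e3; apply/esym/eqP; rewrite -subr_eq0; apply/eqP.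
  transitivity ((-1 - s) * (-1 - s') - (x * t) * (- x * t')); first by ring.
  by rewrite e3; ring.
apply: (po_add TP); last by apply: (po_mul TP); [exact: (po_sq TP)|exact: (po_mul TP)].
by apply: (po_add TP); [exact: (po_add TP)|exact: (po_mul TP)].
Qed.

Section Character.
Variable T : set O.
Hypothesis T_po : po_proper T.
Hypothesis T_arch : archimedean T.
Hypothesis T_total : forall x, hermitian x -> T x \/ T (- x).

Let TP := T_po.1.

(** The cut defined by [x] in the total order with positive cone [T]. *)
Definition po_val (x : O) : R := sup [set r | T (x - rho r)]%classic.

Lemma po_real r : T (rho r) -> 0 <= r.
Proof.
move=> Tr; rewrite leNgt; apply/negP => r0; apply: T_po.2.
have -> : -1 = rho (- r^-1) * rho r by rewrite -rhoM mulNr mulVf ?lt_eqF // rhoN rho1.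
by apply: (po_mul TP) => //; apply: (po_rho TP); rewrite oppr_ge0 invr_le0 ltW.
Qed.

Lemma po_val_has_sup x : hermitian x -> has_sup [set r | T (x - rho r)]%classic.
Proof.
move=> hx; split.
  by have [r Tr] := T_arch (hermN hx); exists (- r); rewrite /= rhoN addrC opprK -[x]opprK.
have [r Tr] := T_arch hx; exists r => s /= Ts.
rewrite -subr_ge0; apply: po_real; rewrite rhoD rhoN.
have -> : rho r - rho s = (rho r - x) + (x - rho s) by ring.
exact: (po_add TP).
Qed.

Lemma po_val_ge x r : hermitian x -> T (x - rho r) -> r <= po_val x.
Proof. by move=> /po_val_has_sup/sup_upper_bound/ubP; apply. Qed.

Lemma po_val_lt x r : hermitian x -> r < po_val x -> T (x - rho r).
Proof.
move=> hx rx; have [s Ts rs] := sup_gt (po_val_has_sup hx).1 rx.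
have -> : x - rho r = (x - rho s) + rho (s - r) by rewrite rhoD rhoN; ring.
by apply: (po_add TP) => //; apply: (po_rho TP); rewrite subr_ge0 ltW.
Qed.

Lemma po_val_gt x r : hermitian x -> po_val x < r -> T (rho r - x).
Proof.
move=> hx rx; have [/(po_val_ge hx)|] := T_total (hermB hx (rho_herm r)).
  by rewrite leNgt rx.
by rewrite opprB.
Qed.

Lemma po_val_le x r : hermitian x -> T (rho r - x) -> po_val x <= r.
Proof.
move=> hx Tr; rewrite leNgt; apply/negP => rx.
pose s := (r + po_val x) / 2.
have := po_add TP (po_val_lt (r := s) hx _) Tr.
have -> : x - rho s + (rho r - x) = rho (r - s) by rewrite rhoD rhoN; ring.
move=> H; have /po_real : T (rho (r - s)) by apply: H; rewrite /s; lra.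
by rewrite /s; lra.
Qed.

Lemma po_val_ge0 x : T x -> 0 <= po_val x.
Proof.
by move=> Tx; apply: po_val_ge; [exact: (po_herm TP)|rewrite rho0 subr0].
Qed.

Lemma po_val_rho r : po_val (rho r) = r.
Proof.
apply/eqP; rewrite eq_le po_val_le ?po_val_ge ?subrr //; try exact: rho_herm; exact: po0.
Qed.

Lemma po_valD x y : hermitian x -> hermitian y ->
  po_val (x + y) = po_val x + po_val y.
Proof.
move=> hx hy; have hxy := hermD hx hy; apply/eqP; rewrite eq_le; apply/andP; split.
  apply/ler_addgt0Pl => e e0; apply: po_val_le => //.
  have -> : rho (e + (po_val x + po_val y)) - (x + y) =
     (rho (po_val x + e / 2) - x) + (rho (po_val y + e / 2) - y).
    by rewrite [in LHS](splitr e) !rhoD; ring.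
  by apply: (po_add TP); apply: po_val_gt => //; lra.
apply/ler_addgt0Pl => e e0; rewrite -lerBlDl; apply: po_val_ge => //.
have -> : x + y - rho (po_val x + po_val y - e) =
   (x - rho (po_val x - e / 2)) + (y - rho (po_val y - e / 2)).
  by rewrite [in LHS](splitr e) !(rhoD, rhoN); ring.
by apply: (po_add TP); apply: po_val_lt => //; lra.
Qed.

(** An infinitesimal has an infinitesimal square: [e - x * x] is the product of
    [sqrt e - x] and [sqrt e + x]. *)
Lemma po_val_sq0 x : hermitian x -> po_val x = 0 -> po_val (x * x) = 0.
Proof.
move=> hx x0; have hxx := hermM hx hx; apply/eqP; rewrite eq_le; apply/andP; split; last first.
  by apply: po_val_ge0; rewrite -{1}hx; exact: (po_sq TP).
apply/ler_addgt0Pl => e e0; rewrite addr0; apply: po_val_le => //.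
have se : 0 < Num.sqrt e by rewrite sqrtr_gt0.
have -> : rho e - x * x = (rho (Num.sqrt e) - x) * (x - rho (- Num.sqrt e)).
  by rewrite rhoN -[in LHS](sqr_sqrtr (ltW e0)) expr2 rhoM; ring.
apply: (po_mul TP); [apply: po_val_gt|apply: po_val_lt] => //; rewrite x0 //.
by rewrite oppr_lt0.
Qed.

Lemma po_valN x : hermitian x -> po_val (- x) = - po_val x.
Proof.
move=> hx; apply/eqP; rewrite -subr_eq0 opprK -po_valD //; last exact: hermN.
by rewrite addNr -rho0 po_val_rho.
Qed.

Lemma po_valZ d x : hermitian x -> po_val (rho d * x) = d * po_val x.
Proof.
move=> hx.
have le c y : 0 < c -> hermitian y -> po_val (rho c * y) <= c * po_val y.
  move=> c0 hy; apply/ler_addgt0Pl => e e0.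
  apply: po_val_le; first exact: (hermM (rho_herm c) hy).
  have -> : rho (e + c * po_val y) - rho c * y = rho c * (rho (po_val y + e / c) - y).
    rewrite mulrBr -rhoM; congr (rho _ - _).
    by rewrite mulrDr mulrCA mulfV ?gt_eqF // mulr1 addrC.
  apply: (po_mul TP); first exact: (po_rho TP (ltW c0)).
  by apply: po_val_gt => //; rewrite ltrDl divr_gt0.
have pos c : 0 < c -> po_val (rho c * x) = c * po_val x.
  move=> c0; apply/eqP; rewrite eq_le le //=.
  have := le c _ c0 (hermN hx).
  by rewrite mulrN !po_valN ?mulrN ?lerN2 //; exact: (hermM (rho_herm c) hx).
have [d0|d0|->] := ltgtP d 0; [|exact: pos|by rewrite mul0r rho0 mul0r -rho0 po_val_rho].
have := pos (- d); rewrite oppr_gt0 => /(_ d0).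
rewrite rhoN !mulNr po_valN; first by move/oppr_inj.
exact: (hermM (rho_herm d) hx).
Qed.

Lemma po_val_sq x : hermitian x -> po_val (x * x) = po_val x ^+ 2.
Proof.
move=> hx; set c := po_val x.
have hc := rho_herm (- c); have hy := hermD hx hc.
have y0 : po_val ((x + rho (- c)) * (x + rho (- c))) = 0.
  by apply: po_val_sq0 => //; rewrite po_valD // po_val_rho subrr.
have hz := hermD (hermM (rho_herm (c + c)) hx) (rho_herm (- c ^+ 2)).
have -> : x * x = (x + rho (- c)) * (x + rho (- c)) + (rho (c + c) * x + rho (- c ^+ 2)).
  by rewrite !(rhoN, rhoD, rhoM, expr2); ring.
rewrite po_valD ?y0 ?add0r //; last exact: hermM.
rewrite po_valD ?po_valZ ?po_val_rho //; first by rewrite /c; ring.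
- exact: (hermM (rho_herm _) hx).
- exact: rho_herm.
Qed.

Lemma po_valM x y : hermitian x -> hermitian y ->
  po_val (x * y) = po_val x * po_val y.
Proof.
move=> hx hy.
have hxx := hermM hx hx; have hyy := hermM hy hy; have hxy := hermM hx hy.
have := po_val_sq (hermD hx hy).
have -> : (x + y) * (x + y) = x * x + (x * y + x * y) + y * y by ring.
rewrite !po_valD ?po_val_sq //; try by [exact: hermD|apply: hermD => //; exact: hermD].
nra.
Qed.

End Character.

Section States.
Variable h : O -> R[i].
Hypothesis hD : forall x y, h (x + y) = h x + h y.
Hypothesis hZ : forall c x, h (iota c * x) = c * h x.
Hypothesis h1 : h 1 = 1.
Hypothesis h_ge0 : forall x, 0 <= h (sg x * x).

Definition null x := h (sg x * x) = 0.

Lemma state0 : h 0 = 0.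
Proof. by rewrite -(mul0r 1) -(rmorph0 iota) hZ mul0r. Qed.

Lemma stateN x : h (- x) = - h x.
Proof. by apply/eqP; rewrite -subr_eq0 opprK -hD addNr state0. Qed.

Lemma state_iota c : h (iota c) = c.
Proof. by rewrite -[iota c]mulr1 hZ h1 mulr1. Qed.

Lemma ImD (a b : R[i]) : complex.Im (a + b) = complex.Im a + complex.Im b.
Proof. by case: a b => a1 a2 [b1 b2]. Qed.

(** Cauchy-Schwarz for a null vector: [h (sg (y + c x) * (y + c x))] is
    nonnegative for all scalars [c] and has no term in [|c|^2], so its linear
    term vanishes. *)
Lemma null_mul x y : null x -> h (sg y * x) = 0.
Proof.
move=> x0.
pose w := h (sg y * x); pose v := h (sg x * y).
have ineq c : 0 <= h (sg y * y) + c * w + c^* %C * v.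
  have := h_ge0 (y + iota c * x).
  have -> : sg (y + iota c * x) * (y + iota c * x) =
      sg y * y + iota c * (sg y * x) + iota (c^* )%C * (sg x * y)
      + iota (c^* %C * c) * (sg x * x).
    by rewrite rmorphD rmorphM sg_iota rmorphM; ring.
  by rewrite !hD !hZ x0 mulr0 addr0.
have real c : complex.Im (c * w + c^* %C * v) = 0.
  by have := ger0_Im (ineq c); rewrite -addrA ImD (ger0_Im (h_ge0 y)) add0r.
have vw : v = w^* %C.
  have := real 1; have := real 'i%C.
  case: (w) => a b; case: (v) => c d.
  rewrite rmorph1 !mul1r /= => e1 e2.
  by apply/eqP; rewrite eq_complex /=; apply/andP; split; apply/eqP; move: e1 e2; rewrite /=; lra.
have ineq2 t : 0 <= complex.Re (h (sg y * y)) - (t + t) * (complex.Re w ^+ 2 + complex.Im w ^+ 2).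
  have := ineq (- t%:C * w^* %C); rewrite lecE => /andP[_].
  rewrite vw; case: (w) => a b; case: (h _) => c d /=.
  rewrite !expr2; lra.
have w0 : complex.Re w ^+ 2 + complex.Im w ^+ 2 = 0.
  apply/eqP; rewrite eq_le addr_ge0 ?sqr_ge0 // andbT leNgt; apply/negP => wgt.
  have := ineq2 ((complex.Re (h (sg y * y)) + 1) / (complex.Re w ^+ 2 + complex.Im w ^+ 2) / 2).
  by rewrite -splitr divfK ?gt_eqF // opprD addrA subrr add0r oppr_ge0 ler10.
move: w0; rewrite -/w; case: (w) => a b /= /eqP.
by rewrite paddr_eq0 ?sqr_ge0 // !sqrf_eq0 => /andP[/eqP -> /eqP ->].
Qed.

Lemma state_sg x : h (sg x) = (h x)^* %C.
Proof.
have real c : complex.Im (c * h x + c^* %C * h (sg x)) = 0.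
  have := ger0_Im (h_ge0 (1 + iota c * x)).
  have -> : sg (1 + iota c * x) * (1 + iota c * x) =
      1 + iota c * x + iota (c^* )%C * sg x + sg (iota c * x) * (iota c * x).
    by rewrite rmorphD rmorph1 !rmorphM sg_iota; ring.
  rewrite !hD !hZ h1 ImD (ger0_Im (h_ge0 _)) addr0 -addrA ImD.
  by rewrite [complex.Im 1]/= add0r => ->.
have := real 1; have := real 'i%C.
case: (h x) => a b; case: (h (sg x)) => c d.
rewrite rmorph1 !mul1r /= => e1 e2.
by apply/eqP; rewrite eq_complex /=; apply/andP; split; apply/eqP; move: e1 e2; rewrite /=; lra.
Qed.

Lemma null_state x : null x -> h x = 0.
Proof. by move/(null_mul 1); rewrite rmorph1 mul1r. Qed.

Lemma nullM x y : null x -> null (x * y).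
Proof.
move=> x0; rewrite /null rmorphM.
have -> : sg x * sg y * (x * y) = sg (x * sg y * y) * x.
  by rewrite !rmorphM sgK; ring.
exact: null_mul.
Qed.

Lemma nullD x y : null x -> null y -> null (x + y).
Proof.
move=> x0 y0; rewrite /null rmorphD.
have -> : (sg x + sg y) * (x + y) =
   sg x * x + sg y * x + (sg x * y + sg y * y) by ring.
by rewrite !hD !null_mul // !addr0.
Qed.

Lemma nullN x : null x -> null (- x).
Proof. by move=> /(@nullM x (-1)); rewrite mulrN1. Qed.

Lemma null_sg x : null x -> null (sg x).
Proof. by rewrite /null sgK mulrC. Qed.

Lemma null0 : null 0.
Proof. by rewrite /null mulr0 state0. Qed.

(** An element whose variance in the state [h] is zero is a constant modulo the
    null ideal. *)
Lemma null_scalar x c : h x = c -> h (sg x * x) = c^* %C * c -> null (x - iota c).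
Proof.
move=> hx hxx; rewrite /null rmorphB sg_iota.
have -> : (sg x - iota c^* %C) * (x - iota c) =
   sg x * x + iota (- c) * sg x + (iota (- c^* %C) * x + iota (c^* %C * c)).
  by rewrite !rmorphN rmorphM; ring.
rewrite !hD !hZ state_sg hx hxx state_iota; ring.
Qed.

Definition sum_of_squares (s : O) := exists r : seq O, s = \sum_(y <- r) sg y * y.

Definition positive_mod_null : set O :=
  [set p | hermitian p /\ exists2 s, sum_of_squares s & null (p - s)]%classic.
Local Notation T0 := positive_mod_null.

Lemma sosD s t : sum_of_squares s -> sum_of_squares t -> sum_of_squares (s + t).
Proof. by move=> [r ->] [r' ->]; exists (r ++ r'); rewrite big_cat. Qed.

Lemma sosM s t : sum_of_squares s -> sum_of_squares t -> sum_of_squares (s * t).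
Proof.
move=> [r ->] [r' ->]; exists [seq x * y | x <- r, y <- r'].
rewrite big_allpairs_dep mulr_suml; apply: eq_bigr => x _.
by rewrite mulr_sumr; apply: eq_bigr => y _; rewrite rmorphM; ring.
Qed.

Lemma positive_mod_null_po : preordering T0.
Proof.
split.
- by move=> x [].
- move=> x y [hx [s Ss xs]] [hy [t St yt]]; split; first exact: hermD.
  exists (s + t); first exact: sosD.
  by have -> : x + y - (s + t) = (x - s) + (y - t) by [ring]; apply: nullD.
- move=> x y [hx [s Ss xs]] [hy [t St yt]]; split; first exact: hermM.
  exists (s * t); first exact: sosM.
  have -> : x * y - s * t = (x - s) * y + (y - t) * s by ring.
  by apply: nullD; apply: nullM.
- move=> x; split; first exact: herm_sq.
  by exists (sg x * x); [exists [:: x]; rewrite big_seq1|rewrite subrr; exact: null0].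
Qed.

Lemma positive_mod_null_ge0 p : T0 p -> 0 <= h p.
Proof.
move=> [_ [s [r ->] /null_state]]; rewrite hD stateN => /eqP; rewrite subr_eq0 => /eqP ->.
by rewrite (big_morph h hD state0); apply: sumr_ge0 => i _; exact: h_ge0.
Qed.

Lemma null_positive z : hermitian z -> null z -> T0 z.
Proof. by move=> hz z0; split=> //; exists 0; [exists [::]; rewrite big_nil|rewrite subr0]. Qed.

Definition bounded_elt x := exists r : R, T0 (rho r - sg x * x).

Let PP := positive_mod_null_po.

Lemma bounded_iota c : bounded_elt (iota c).
Proof.
exists (complex.Re (c^* %C * c)); rewrite sg_iota /rho -rmorphM -rmorphB.
suff -> : (complex.Re (c^* * c))%:C - c^* * c = 0 by rewrite rmorph0; exact: po0 PP.
by case: c => a b; apply/eqP; rewrite eq_complex /= ; apply/andP; split; apply/eqP; ring.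
Qed.

Lemma bounded_mul x y : bounded_elt x -> bounded_elt y -> bounded_elt (x * y).
Proof.
move=> [r Tr] [s Ts]; exists (Num.max r 0 * Num.max s 0).
have -> : rho (Num.max r 0 * Num.max s 0) - sg (x * y) * (x * y) =
  (rho (Num.max r 0 - r) + (rho r - sg x * x)) * rho (Num.max s 0) +
  sg x * x * (rho (Num.max s 0 - s) + (rho s - sg y * y)).
  by rewrite !(rhoD, rhoN, rhoM, rmorphM); ring.
have T1 (a : R) : 0 <= Num.max a 0 - a by rewrite subr_ge0 le_max lexx.
apply: (po_add PP); apply: (po_mul PP).
- by apply: (po_add PP) => //; exact: (po_rho PP).
- by apply: (po_rho PP); rewrite le_max lexx orbT.
- exact: (po_sq PP).
- by apply: (po_add PP) => //; exact: (po_rho PP).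
Qed.

Lemma bounded_add x y : bounded_elt x -> bounded_elt y -> bounded_elt (x + y).
Proof.
move=> [r Tr] [s Ts]; exists (r + r + (s + s)).
have -> : rho (r + r + (s + s)) - sg (x + y) * (x + y) =
  (rho r - sg x * x) + (rho r - sg x * x) + (rho s - sg y * y) + (rho s - sg y * y)
  + sg (x - y) * (x - y).
  by rewrite !(rhoD, rmorphD, rmorphN); ring.
apply: (po_add PP); last exact: (po_sq PP).
by do 3![apply: (po_add PP) => //].
Qed.

Lemma bounded_sg x : bounded_elt x -> bounded_elt (sg x).
Proof. by move=> [r Tr]; exists r; rewrite sgK mulrC. Qed.

(** The squared modulus of a coordinate of a unit vector is at most [1]. *)
Lemma bounded_summand (J : finType) (y : J -> O) (j : J) :
  null (\sum_i sg (y i) * y i - 1) -> bounded_elt (y j).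
Proof.
move=> ny; exists 1; rewrite rho1; split.
  by apply: hermB; [exact: rmorph1|exact: herm_sq].
exists (\sum_(i | i != j) sg (y i) * y i).
  exists [seq y i | i <- index_enum J & i != j].
  by rewrite big_map big_filter.
have -> : 1 - sg (y j) * y j - \sum_(i | i != j) sg (y i) * y i =
    - (\sum_i sg (y i) * y i - 1) by rewrite [in RHS](bigD1 j) //=; ring.
exact: nullN.
Qed.

Hypothesis all_bounded : forall x, bounded_elt x.

(** A bound [r] of [x * x] yields the bound [r + 1] of [x], as
    [r + 1 - x = (r - x * x) + (x - 1/2)^2 + 3/4]. *)
Lemma positive_mod_null_arch : archimedean T0.
Proof.
move=> x hx; have [r Tr] := all_bounded x; exists (r + 1).
have -> : rho (r + 1) - x =
  (rho r - sg x * x) + sg (x - rho (1/2)) * (x - rho (1/2)) + rho (3/4).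
  have e : rho (3/4) = 1 - rho (1/2) * rho (1/2).
    by rewrite -rhoM -rho1 -rhoN -rhoD; congr rho; lra.
  have e2 : rho (1/2) + rho (1/2) = 1 by rewrite -rhoD -rho1; congr rho; lra.
  rewrite rhoD rho1 e rmorphB hx (rho_herm (1/2)).
  have -> : rho r + 1 - x = rho r + 1 - (rho (1/2) + rho (1/2)) * x by rewrite e2 mul1r.
  by ring.
apply: (po_add PP); last by apply: (po_rho PP); lra.
by apply: (po_add PP) => //; exact: (po_sq PP).
Qed.

(** With [k = sg g * g], the preordering generated by [k - h k / 2] over the
    squares modulo null elements is proper: a relation
    [- 1 = s + (k - h k / 2) t] would put [h k / 2 - k] in the preordering by
    [po_inverse_pos], although [h] is negative there. The cuts of a maximal
    preordering above it define a character with value at least [h k / 2] at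
    [k]. *)
Theorem state_character g : h (sg g * g) != 0 ->
  exists phi : O -> R[i],
    [/\ (forall x y, phi (x + y) = phi x + phi y),
        (forall x y, phi (x * y) = phi x * phi y),
        (forall c, phi (iota c) = c),
        (forall x, phi (sg x) = (phi x)^* %C)
      & (forall x, null x -> phi x = 0) /\ phi g != 0].
Proof.
move=> hg; pose k := sg g * g; have hk := herm_sq g : hermitian k.
pose kap := complex.Re (h k).
have hkE : h k = kap%:C by rewrite RRe_real // ger0_real // h_ge0.
have kap0 : 0 < kap by rewrite -ltcR -hkE lt_def hg h_ge0.
have T1P : po_proper (po_adjoin T0 (k - rho (kap / 2))).
  split; first by apply: po_adjoinP => //; apply: hermB => //; exact: rho_herm.
  move=> [s [t [Ts Tt e]]].
  have : T0 (rho (kap / 2) - k).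
    apply: (@po_inverse_pos T0 _ _ t) => //; first exact: positive_mod_null_arch.
      by apply: hermB => //; exact: rho_herm.
    by have -> : (rho (kap / 2) - k) * t - 1 = s by rewrite e; ring.
  move/positive_mod_null_ge0; rewrite hD stateN state_iota hkE -rmorphB ler0c; lra.
have [T [TP T1T Tmax]] := po_maximal T1P.
have T0T : (T0 `<=` T)%classic by move=> x T0x; apply: T1T; exact: sub_po_adjoin.
have Tarch : archimedean T.
  by move=> x hx; have [r Tr] := positive_mod_null_arch hx; exists r; exact: T0T.
have Ttot := po_total TP Tmax.
pose val := po_val T.
have valD := po_valD TP Tarch Ttot; have valM := po_valM TP Tarch Ttot.
have valr := po_val_rho TP Tarch; have valN := po_valN TP Tarch Ttot.
pose half : O := rho (1 / 2).
pose re x := half * (x + sg x).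
pose im x := half * (iota (- 'i%C) * (x - sg x)).
have hhalf : half + half = 1 by rewrite /half -rhoD -rho1; congr rho; lra.
have shalf : sg half = half by exact: rho_herm.
have hre x : hermitian (re x).
  by rewrite /hermitian /re rmorphM rmorphD shalf sgK addrC.
have Ni : ((- 'i)^* = 'i :> R[i])%C by apply/eqP; rewrite eq_complex /= !oppr0 opprK !eqxx.
have him x : hermitian (im x).
  rewrite /hermitian /im !rmorphM rmorphB shalf sgK sg_iota Ni rmorphN; ring.
have ii : iota 'i%C * iota 'i%C = -1 by rewrite -rmorphM -expr2 sqr_i rmorphN1.
have reim x : x = re x + iota 'i%C * im x.
  transitivity (half * (x + sg x) - half * (iota 'i%C * iota 'i%C) * (x - sg x)).
    by rewrite ii -{1}[x]mul1r -{1}hhalf; ring.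
  by rewrite /re /im rmorphN; ring.
have hpart a b : hermitian a -> hermitian b ->
    re (a + iota 'i%C * b) = a /\ im (a + iota 'i%C * b) = b.
  move=> ha hb.
  have Ni' : (('i)^* = - 'i :> R[i])%C by apply/eqP; rewrite eq_complex /= oppr0 !eqxx.
  have e : sg (a + iota 'i%C * b) = a - iota 'i%C * b.
    by rewrite rmorphD rmorphM ha hb sg_iota Ni' rmorphN mulNr.
  rewrite /re /im e; split; first by rewrite -[RHS]mul1r -hhalf; ring.
  transitivity (- (half + half) * (iota 'i%C * iota 'i%C) * b); last by rewrite ii hhalf; ring.
  by rewrite rmorphN; ring.
pose phi x := (val (re x))%:C + 'i%C * (val (im x))%:C.
have phi_herm a b : hermitian a -> hermitian b ->
    phi (a + iota 'i%C * b) = (val a)%:C + 'i%C * (val b)%:C.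
  by move=> ha hb; rewrite /phi; have [-> ->] := hpart a b ha hb.
have h0 : hermitian 0 by rewrite /hermitian rmorph0.
have val0 : val 0 = 0 by rewrite -rho0 /val valr.
have phiD x y : phi (x + y) = phi x + phi y.
  rewrite {1}(reim x) {1}(reim y).
  have -> : re x + iota 'i%C * im x + (re y + iota 'i%C * im y) =
     (re x + re y) + iota 'i%C * (im x + im y) by ring.
  rewrite phi_herm; [|exact: hermD|exact: hermD].
  by rewrite /phi /val !valD // !rmorphD; ring.
have phiM x y : phi (x * y) = phi x * phi y.
  rewrite {1}(reim x) {1}(reim y).
  have -> : (re x + iota 'i%C * im x) * (re y + iota 'i%C * im y) =
     (re x * re y - im x * im y) + iota 'i%C * (re x * im y + im x * re y).
    transitivity (re x * re y + (iota 'i%C * iota 'i%C) * (im x * im y)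
        + iota 'i%C * (re x * im y + im x * re y)); first by ring.
    by rewrite ii; ring.
  have hM a b : hermitian (re a * re b) /\ hermitian (im a * im b) by split; exact: hermM.
  have hM' a b : hermitian (re a * im b) by exact: hermM.
  rewrite phi_herm; [|exact: (hermB (hM x y).1 (hM x y).2)|].
    rewrite /phi /val (valD _ _ (hM x y).1 (hermN (hM x y).2)) (valN _ (hM x y).2).
    rewrite (valD _ _ (hM' x y) (hermM (him x) (hre y))) (valM _ _ (hre x) (hre y)).
    rewrite (valM _ _ (him x) (him y)) (valM _ _ (hre x) (him y)) (valM _ _ (him x) (hre y)).
    set a := po_val _ _; set b := po_val _ _; set c := po_val _ _; set d := po_val _ _.
    rewrite !(rmorphD, rmorphN, rmorphM) /=.
    have i2 : 'i%C * 'i%C = -1 :> R[i] by rewrite -expr2 sqr_i.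
    transitivity (a%:C * b%:C + ('i%C * 'i%C) * (c%:C * d%:C) +
       'i%C * (a%:C * d%:C + c%:C * b%:C)); last by ring.
    by rewrite i2; ring.
  by apply: hermD; [exact: hM'|exact: hermM].
have phi_iota c : phi (iota c) = c.
  have -> : iota c = rho (complex.Re c) + iota 'i%C * rho (complex.Im c).
    by rewrite {1}[c]complexE rmorphD rmorphM.
  rewrite phi_herm; try exact: rho_herm.
  by rewrite /val !valr -complexE.
have phi_sg x : phi (sg x) = (phi x)^* %C.
  have -> : sg x = re x + iota 'i%C * (- im x).
    rewrite {1}(reim x) rmorphD rmorphM hre him sg_iota.
    have -> : (('i)^* = - 'i :> R[i])%C by apply/eqP; rewrite eq_complex /= oppr0 !eqxx.
    by rewrite rmorphN; ring.
  rewrite phi_herm //; last exact: hermN.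
  rewrite /phi /val valN //.
  by apply/eqP; rewrite eq_complex /=; apply/andP; split; apply/eqP; ring.
exists phi; split=> //; split.
  have nullv z : hermitian z -> null z -> val z = 0.
    move=> hz nz; apply/eqP; rewrite eq_le -oppr_ge0 -valN // !(po_val_ge0 TP Tarch) //.
      exact/T0T/null_positive.
    by apply/T0T/null_positive; [exact: hermN|exact: nullN].
  move=> x nx; rewrite /phi !nullv ?rmorph0 ?mulr0 ?addr0 //.
    rewrite /im mulrC; apply: nullM; rewrite mulrC; apply: nullM.
    by apply: nullD => //; exact/nullN/null_sg.
  by rewrite /re mulrC; apply: nullM; apply: nullD => //; exact: null_sg.
apply: contraTneq kap0 => phig0; rewrite -leNgt.
have vk : kap / 2 <= val k.
  by apply: (po_val_ge TP Tarch) => //; apply: T1T; apply: mem_po_adjoin.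
have : phi k = (val k)%:C.
  have {1}-> : k = k + iota 'i%C * 0 by rewrite mulr0 addr0.
  by rewrite phi_herm // val0 mulr0 addr0.
by rewrite /k phiM phig0 mulr0 => -[]; rewrite -/k; lra.
Qed.

End States.
End Preorderings.

(** * Orthogonal projections and star-algebras of matrices *)

Section Kernels.
Variables (C : numClosedFieldType) (I : finType).
Implicit Types (f g : I -> C) (P : set (I -> C)) (K : I -> I -> C).

Definition dot f g := \sum_i f i * (g i)^*.

Record subspace P : Prop := Subspace {
  subspace0 : P (fun=> 0);
  subspace_lin : forall c f g, P f -> P g -> P (fun i => c * f i + g i) }.

(** The matrix of the orthogonal projection on [P]. These properties determine
    it, so it inherits the symmetries of [P]. *)
Record proj_kernel P K : Prop := ProjKernel {
  kernel_row : forall i, P (K i);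
  kernel_rep : forall f, P f -> forall j, \sum_i f i * K i j = f j;
  kernel_herm : forall i j, K j i = (K i j)^* }.

Lemma kernel_uniq P K K' : proj_kernel P K -> proj_kernel P K' ->
  forall i j, K i j = K' i j.
Proof.
move=> hK hK' i j; rewrite -(kernel_rep hK' (kernel_row hK i)).
rewrite [RHS](kernel_herm hK' j i) -(kernel_rep hK (kernel_row hK' j) i) rmorph_sum.
apply: eq_bigr => k _; rewrite rmorphM /= -(kernel_herm hK k i) -(kernel_herm hK' j k).
exact: mulrC.
Qed.

Record orthobasis P m (b : 'I_m -> I -> C) : Prop := Orthobasis {
  basis_mem : forall k, P (b k);
  basis_dot : forall k l, dot (b k) (b l) = (k == l)%:R;
  basis_rep : forall f, P f -> forall j, f j = \sum_k dot f (b k) * b k j }.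

Lemma subspace_sum P (J : Type) (r : seq J) (c : J -> C) (F : J -> I -> C) :
  subspace P -> (forall k, P (F k)) -> P (fun i => \sum_(k <- r) c k * F k i).
Proof.
move=> sP PF; elim: r => [|k r IH].
  by have := subspace0 sP; congr P; apply/funext => i; rewrite big_nil.
have := subspace_lin sP (c k) (PF k) IH; congr P.
by apply/funext => i; rewrite big_cons.
Qed.

Lemma orthonormal_size m (b : 'I_m -> I -> C) :
  (forall k l, dot (b k) (b l) = (k == l)%:R) -> (m <= #|I|)%N.
Proof.
move=> ob; pose M := \matrix_(k < m, j < #|I|) b k (enum_val j).
apply: (@mulmx1_min C m #|I| M (\matrix_(j, l) (M l j)^*)).
apply/matrixP => k l; rewrite !mxE -ob /dot (reindex (@enum_val I I)) /=; last first.
  by apply: onW_bij; exact: enum_val_bij.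
by apply: eq_bigr => j _; rewrite !mxE.
Qed.

(** An orthonormal family of maximal size spans [P]: the normalized residue of a
    vector outside its span would extend it. *)
Lemma orthobasis_exists P : subspace P -> exists m (b : 'I_m -> I -> C), orthobasis P b.
Proof.
move=> sP.
pose ortho m := `[< exists b : 'I_m -> I -> C, (forall k, P (b k)) /\
   (forall k l, dot (b k) (b l) = (k == l)%:R) >].
have ex0 : exists m, ortho m.
  exists 0%N; apply/asboolP; exists (fun _ _ => 0).
  by split; case.
have ub m : ortho m -> (m <= #|I|)%N.
  by move=> /asboolP[b [_]]; exact: orthonormal_size.
case: (ex_maxnP ex0 ub) => m /asboolP[b [Pb ob]] mmax.
exists m, b; split=> // f Pf j.
pose r i := f i - \sum_k dot f (b k) * b k i.
suff r0 : dot r r = 0.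
  have /allP/(_ j (mem_index_enum _)) : all (fun i => (predT i) ==> (r i * (r i)^* == 0)) (index_enum I).
    rewrite -psumr_eq0 //; first exact/eqP.
    by move=> i _; exact: mul_conjC_ge0.
  by rewrite /= mul_conjC_eq0 subr_eq0 => /eqP.
have rb k : dot r (b k) = 0.
  rewrite /dot /r; under eq_bigr do rewrite mulrBl.
  rewrite sumrB.
  under [X in _ - X]eq_bigr do rewrite mulr_suml.
  rewrite exchange_big /= (bigD1 k) //= [X in _ - (_ + X)]big1 ?addr0 => [|l lk].
    under [X in _ - X]eq_bigr => i _ do rewrite -mulrA.
    by rewrite -mulr_sumr -/(dot (b k) (b k)) ob eqxx mulr1 subrr.
  under eq_bigr do rewrite -mulrA.
  by rewrite -mulr_sumr -/(dot (b l) (b k)) ob (negbTE lk) mulr0.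
apply/eqP; apply: contraT => rn0.
have rpos : 0 < dot r r.
  by rewrite lt_def rn0 sumr_ge0 // => i _; exact: mul_conjC_ge0.
pose s := sqrtC (dot r r).
have sreal : s^* = s by apply/CrealP/ger0_real; rewrite sqrtC_ge0 ltW.
have sn0 : s != 0 by rewrite sqrtC_eq0.
pose b' (k : 'I_m.+1) i := if unlift ord0 k is Some l then b l i else s^-1 * r i.
have Pr : P r.
  have := subspace_lin sP (-1) (subspace_sum (index_enum _) (fun k => dot f (b k)) sP Pb) Pf.
  by congr P; apply/funext => i; rewrite mulN1r addrC.
suff : ortho m.+1 by move/mmax; rewrite ltnn.
apply/asboolP; exists b'; split.
  move=> k; rewrite /b'; case: unlift => [l|]; first exact: Pb.
  have := subspace_lin sP s^-1 Pr (subspace0 sP).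
  by congr P; apply/funext => i; rewrite addr0.
have dotZr c f1 g : dot f1 (fun i => c * g i) = c^* * dot f1 g.
  by rewrite /dot mulr_sumr; apply: eq_bigr => i _; rewrite rmorphM mulrCA.
have dotC f1 g : dot f1 g = (dot g f1)^*.
  by rewrite /dot rmorph_sum; apply: eq_bigr => i _; rewrite rmorphM /= conjCK mulrC.
have dotZl c f1 g : dot (fun i => c * f1 i) g = c * dot f1 g.
  by rewrite dotC dotZr rmorphM /= conjCK -dotC.
move=> k l; rewrite /b'; case: (unliftP ord0 k) => [k'|] ->; case: (unliftP ord0 l) => [l'|] ->.
- by rewrite -[LHS]/(dot (b k') (b l')) ob (inj_eq lift_inj).
- by rewrite -[LHS]/(dot (b k') (fun i => s^-1 * r i)) dotZr dotC rb conjC0 mulr0 -val_eqE.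
- by rewrite -[LHS]/(dot (fun i => s^-1 * r i) (b l')) dotZl rb mulr0 -val_eqE.
- rewrite -[LHS]/(dot (fun i => s^-1 * r i) (fun i => s^-1 * r i)) dotZl dotZr eqxx.
  by rewrite fmorphV /= sreal mulrA -invfM -expr2 sqrtCK mulVf.
Qed.

Lemma orthobasis_kernel P m (b : 'I_m -> I -> C) : subspace P -> orthobasis P b ->
  proj_kernel P (fun i j => \sum_k (b k i)^* * b k j).
Proof.
move=> sP ob; split.
- by move=> i; apply: subspace_sum => //; exact: (basis_mem ob).
- move=> f Pf j; rewrite [RHS](basis_rep ob Pf).
  under eq_bigr do rewrite mulr_sumr.
  rewrite exchange_big; apply: eq_bigr => k _; rewrite /dot mulr_suml.
  by apply: eq_bigr => i _; rewrite mulrA.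
- move=> i j; rewrite rmorph_sum; apply: eq_bigr => k _.
  by rewrite rmorphM /= conjCK mulrC.
Qed.

Lemma kernel_exists P : subspace P -> exists K, proj_kernel P K.
Proof.
move=> sP; have [m [b ob]] := orthobasis_exists sP.
by eexists; exact: orthobasis_kernel ob.
Qed.

End Kernels.

Section StarAlgebra.
Variables (C : numClosedFieldType) (N : nat) (B : set 'M[C]_N).
Import spectral.
Local Open Scope sesquilinear_scope.
Local Notation M := 'M[C]_N.
Implicit Types X Y : M.

Hypothesis B_lin : forall c X Y, B X -> B Y -> B (c *: X + Y).
Hypothesis B_0 : B 0.
Hypothesis B_mul : forall X Y, B X -> B Y -> B (X *m Y).
Hypothesis B_adj : forall X, B X -> B (X ^t*).

Lemma adjM X Y : (X *m Y)^t* = Y^t* *m X^t*.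
Proof. by rewrite trmx_mul map_mxM. Qed.

Lemma mxtrace_adj X : \tr (X^t*) = (\tr X)^*.
Proof. by rewrite /mxtrace rmorph_sum; apply: eq_bigr => i _; rewrite !mxE. Qed.

Definition hs X Y : C := \tr (X *m Y^t*).

Lemma hsE X Y : hs X Y = \sum_i \sum_j X i j * (Y i j)^*.
Proof.
rewrite /hs /mxtrace; apply: eq_bigr => i _; rewrite mxE.
by apply: eq_bigr => j _; rewrite !mxE.
Qed.

Lemma hsC X Y : hs Y X = (hs X Y)^*.
Proof. by rewrite /hs -mxtrace_adj adjM trmxCK. Qed.

Lemma hsDl X Y Z : hs (X + Y) Z = hs X Z + hs Y Z.
Proof. by rewrite /hs mulmxDl mxtraceD. Qed.

Lemma hsZl c X Y : hs (c *: X) Y = c * hs X Y.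
Proof. by rewrite /hs -scalemxAl mxtraceZ. Qed.

Lemma hsNl X Y : hs (- X) Y = - hs X Y.
Proof. by rewrite -scaleN1r hsZl mulN1r. Qed.

Lemma hsZr c X Y : hs X (c *: Y) = c^* * hs X Y.
Proof. by rewrite hsC hsZl rmorphM /= -hsC. Qed.

Lemma hs_suml (J : Type) (r : seq J) (F : J -> M) X :
  hs (\sum_(k <- r) F k) X = \sum_(k <- r) hs (F k) X.
Proof. by rewrite /hs mulmx_suml raddf_sum. Qed.

Lemma hs_sumr (J : Type) (r : seq J) (F : J -> M) X :
  hs X (\sum_(k <- r) F k) = \sum_(k <- r) hs X (F k).
Proof. by rewrite hsC hs_suml rmorph_sum; apply: eq_bigr => k _; rewrite /= -hsC. Qed.

Lemma hs_ge0 X : 0 <= hs X X.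
Proof.
by rewrite hsE sumr_ge0 // => i _; rewrite sumr_ge0 // => j _; exact: mul_conjC_ge0.
Qed.

Lemma hs_eq0 X : hs X X = 0 -> X = 0.
Proof.
rewrite hsE => /eqP.
rewrite psumr_eq0 => [/allP X0|i _]; last first.
  by rewrite sumr_ge0 // => j _; exact: mul_conjC_ge0.
apply/matrixP => i j; have /= := X0 i (mem_index_enum _).
rewrite psumr_eq0 => [/allP Xi0|k _]; last exact: mul_conjC_ge0.
have /= := Xi0 j (mem_index_enum _).
by rewrite mul_conjC_eq0 mxE => /eqP.
Qed.

Record mxbasis (P : set M) m (b : 'I_m -> M) : Prop := MxBasis {
  mxbasis_mem : forall k, P (b k);
  mxbasis_rep : forall X, P X -> X = \sum_k hs X (b k) *: b k;
  mxbasis_dot : forall k l, hs (b k) (b l) = (k == l)%:R }.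

Definition mx_fun X : 'I_N * 'I_N -> C := fun p => X p.1 p.2.
Definition fun_mx (f : 'I_N * 'I_N -> C) : M := \matrix_(i, j) f (i, j).

Lemma mx_funK X : fun_mx (mx_fun X) = X.
Proof. by apply/matrixP => i j; rewrite mxE. Qed.

Lemma dot_hs f g : dot f g = hs (fun_mx f) (fun_mx g).
Proof.
rewrite hsE pair_big; apply: eq_bigr => -[i j] _; by rewrite !mxE.
Qed.

Lemma mx_subspace (P : set M) : P 0 -> (forall c X Y, P X -> P Y -> P (c *: X + Y)) ->
  subspace [set f | P (fun_mx f)]%classic.
Proof.
move=> P0 Plin; split=> /= [|c f g Pf Pg].
  by have -> : fun_mx (fun=> 0) = 0 by apply/matrixP => i j; rewrite !mxE.
have -> : fun_mx (fun i => c * f i + g i) = c *: fun_mx f + fun_mx g.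
  by apply/matrixP => i j; rewrite !mxE.
exact: Plin.
Qed.

Lemma orthobasis_mxbasis (P : set M) m (b : 'I_m -> 'I_N * 'I_N -> C) :
  orthobasis [set f | P (fun_mx f)]%classic b -> mxbasis P (fun k => fun_mx (b k)).
Proof.
case=> bP bo br; split.
- exact: bP.
- move=> X PX; apply/matrixP => i j.
  have := br (mx_fun X) _ (i, j); rewrite /= mx_funK => /(_ PX).
  rewrite {1}/mx_fun /= => ->; rewrite summxE; apply: eq_bigr => k _.
  by rewrite dot_hs mx_funK !mxE.
- by move=> k l; rewrite -dot_hs bo.
Qed.

Section Twirl.
Variables (m : nat) (b : 'I_m -> M).
Hypothesis bB : mxbasis B b.

(** The map [X |-> \sum_k (b k)^* X (b k)], with [b] an orthonormal basis of the
    star-algebra [B]. *)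
Definition twirl X := \sum_k (b k)^t* *m X *m b k.

(** Multiplying the elements of [b] by [Y] on the right and their adjoints by [Y]
    on the left have transposed matrices in the basis [b]. *)
Lemma twirl_comm Y X : B Y -> Y *m twirl X = twirl X *m Y.
Proof.
move=> BY; pose t l k := hs (b l *m Y) (b k).
have e1 l : b l *m Y = \sum_k t l k *: b k.
  by apply: (mxbasis_rep bB); apply: B_mul => //; exact: (mxbasis_mem bB).
have e2 k : Y *m (b k)^t* = \sum_l t l k *: (b l)^t*.
  rewrite -[Y *m _]trmxCK adjM trmxCK.
  rewrite [X in X ^t*](mxbasis_rep bB (X := b k *m Y^t*)); last first.
    by apply: B_mul; [exact: (mxbasis_mem bB)|exact: B_adj].
  rewrite raddf_sum /= map_mx_sum; apply: eq_bigr => l _.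
  rewrite linearZ /= map_mxZ; congr (_ *: _).
  by rewrite /= -hsC /t /hs adjM trmxCK mulmxA.
rewrite /twirl mulmx_sumr mulmx_suml.
under eq_bigr => k _ do rewrite !mulmxA e2 !mulmx_suml.
rewrite exchange_big; apply: eq_bigr => l _.
rewrite -[in RHS]mulmxA e1 mulmx_sumr; apply: eq_bigr => k _.
by rewrite -!scalemxAl -scalemxAr.
Qed.

End Twirl.

Lemma mxbasis_adj m (b : 'I_m -> M) : mxbasis B b -> mxbasis B (fun k => (b k)^t*).
Proof.
have hsa X Y : hs (X^t*) (Y^t*) = (hs X Y)^*.
  by rewrite -hsC /hs trmxCK mxtrace_mulC.
case=> bP br bo; split.
- by move=> k; exact: B_adj.
- move=> X BX; rewrite -[LHS]trmxCK [X in X^t*](br _ (B_adj BX)).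
  rewrite raddf_sum /= map_mx_sum; apply: eq_bigr => k _.
  by rewrite linearZ /= map_mxZ -{2}(trmxCK X) hsa.
- by move=> k l; rewrite hsa bo conjC_nat.
Qed.

Let comm : set M := fun X => forall Y, B Y -> Y *m X = X *m Y.

(** The twirl is selfadjoint up to replacing [b] by its adjoint basis, its values
    lie in the commutant of [B], and on the commutant it is multiplication by
    [\sum_k (b k)^* b k]; hence its trace form only sees the commutant component,
    on which it is nonnegative. *)
Lemma twirl_ge0 m (b : 'I_m -> M) X : mxbasis B b -> 0 <= hs (twirl b X) X.
Proof.
move=> bB.
have c0 : comm 0 by move=> Y _; rewrite mulmx0 mul0mx.
have clin c Y Z : comm Y -> comm Z -> comm (c *: Y + Z).
  move=> cY cZ W BW; rewrite mulmxDr mulmxDl -scalemxAr -scalemxAl.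
  by rewrite cY ?cZ.
have [m' [b' /orthobasis_mxbasis cb]] := orthobasis_exists (mx_subspace c0 clin).
set e' := fun k => _ in cb.
pose D := \sum_k hs X (e' k) *: e' k; pose E := X - D.
have cD : comm D.
  rewrite /D; elim/big_ind: _ => //.
    by move=> Y Z cY cZ; rewrite -[Y]scale1r; exact: clin.
  move=> k _; rewrite -[_ *: _]addr0; apply: clin => //; exact: (mxbasis_mem cb).
have Eperp Y : comm Y -> hs E Y = 0.
  move=> cY; rewrite (mxbasis_rep cb cY) hs_sumr big1 // => k _.
  rewrite hsZr /E hsDl hsNl hs_suml (bigD1 k) //= big1 => [|l lk].
    by rewrite hsZl (mxbasis_dot cb) eqxx mulr1 addr0 subrr mulr0.
  by rewrite hsZl (mxbasis_dot cb) (negbTE lk) mulr0.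
have twD Y Z : twirl b (Y + Z) = twirl b Y + twirl b Z.
  by rewrite /twirl -big_split; apply: eq_bigr => k _; rewrite mulmxDr mulmxDl.
have cyc Y Z : hs (twirl b Y) Z = hs Y (twirl (fun k => (b k)^t*) Z).
  rewrite hs_sumr hs_suml; apply: eq_bigr => k _.
  by rewrite /hs !adjM !trmxCK -!mulmxA mxtrace_mulC -!mulmxA.
have ctw' Y : comm Y -> comm (twirl (fun k => (b k)^t*) Y).
  move=> cY; have -> : twirl (fun k => (b k)^t*) Y = Y *m twirl (fun k => (b k)^t*) 1%:M.
    rewrite /twirl mulmx_sumr; apply: eq_bigr => k _.
    by rewrite trmxCK mulmx1 cY ?mulmxA //; exact: (mxbasis_mem bB).
  move=> Z BZ; rewrite mulmxA cY // -!mulmxA; congr (_ *m _).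
  exact: (twirl_comm (mxbasis_adj bB)).
have ctw Y : comm (twirl b Y) by move=> Z BZ; exact: (twirl_comm bB).
have twE : twirl b E = 0.
  by apply: hs_eq0; rewrite cyc; apply/Eperp/ctw'.
have XDE : X = D + E by rewrite /E addrC subrK.
rewrite {1}XDE twD twE addr0 XDE hsC hsDl (Eperp _ (ctw _)) addr0 -hsC.
rewrite /twirl hs_suml sumr_ge0 // => k _.
have -> : hs ((b k)^t* *m D *m b k) D = hs (b k *m D) (b k *m D).
  rewrite -[_ *m D *m _]mulmxA -(cD _ (mxbasis_mem bB k)).
  by rewrite /hs adjM -!mulmxA mxtrace_mulC !mulmxA.
exact: hs_ge0.
Qed.

(** Complete positivity of the orthogonal projection on a star-algebra of
    matrices. Written in an orthonormal basis [b] of [B], the sum is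
    [\sum_k \tr (c (b k) c^* (b k)^* )]. *)
Lemma kernel_cp Q (c : M) : proj_kernel [set f | B (fun_mx f)]%classic Q ->
  0 <= \sum_a \sum_b \sum_a' \sum_b' (c a b)^* * c a' b' * Q (a', a) (b', b).
Proof.
move=> hQ; have sP := mx_subspace B_0 B_lin.
have [m [b ob]] := orthobasis_exists sP.
have bB := orthobasis_mxbasis ob.
have QE := kernel_uniq hQ (orthobasis_kernel sP ob).
set e := fun k => _ in bB.
suff -> : \sum_a \sum_b \sum_a' \sum_b' (c a b)^* * c a' b' * Q (a', a) (b', b) =
   hs (twirl e c) c by exact: twirl_ge0.
rewrite /hs /twirl mulmx_suml raddf_sum /=.
transitivity (\sum_k \sum_a \sum_b0 \sum_a' \sum_b' (c a b0)^* * c a' b' *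
   ((b k (a', a))^* * b k (b', b0))).
  rewrite [RHS]exchange_big; apply: eq_bigr => a _.
  rewrite [RHS]exchange_big; apply: eq_bigr => b0 _.
  rewrite [RHS]exchange_big; apply: eq_bigr => a' _.
  rewrite [RHS]exchange_big; apply: eq_bigr => b' _.
  by rewrite QE mulr_sumr.
apply: eq_bigr => k _.
rewrite /mxtrace; apply: eq_bigr => a _.
rewrite mxE; apply: eq_bigr => b0 _.
rewrite !mxE mulr_suml exchange_big; apply: eq_bigr => b' _ /=.
rewrite !mxE !mulr_suml; apply: eq_bigr => a' _.
by rewrite !mxE; ring.
Qed.

End StarAlgebra.

(** * Sums over words and coordinates of tensors *)

Section WordSums.
Variable n : nat.
Local Notation word := (seq 'I_n).

(** Recursion on the length makes the splitting of words in sums a matter of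
    computation. *)
Fixpoint wsum (M : nmodType) k (F : word -> M) : M :=
  if k is k'.+1 then \sum_x wsum k' (fun v => F (x :: v)) else F [::].

Definition ins i x (v : word) : word := take i v ++ x :: drop i v.

Section OneModule.
Variable M : nmodType.
Implicit Types F G : word -> M.

Lemma eq_wsum k F G : (forall v, size v = k -> F v = G v) -> wsum k F = wsum k G.
Proof.
elim: k F G => [|k IH] F G FG /=; first exact: FG.
by apply: eq_bigr => x _; apply: IH => v sv; apply: FG; rewrite /= sv.
Qed.

Lemma wsum_zero k : wsum k (fun=> 0) = 0 :> M.
Proof. by elim: k => //= k IH; rewrite big1. Qed.

Lemma wsumD k F G : wsum k (fun v => F v + G v) = wsum k F + wsum k G.
Proof.
elim: k F G => //= k IH F G; rewrite -big_split /=.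
by apply: eq_bigr => x _; exact: IH.
Qed.

Lemma wsum_sum k (J : Type) (r : seq J) (P : pred J) (F : J -> word -> M) :
  wsum k (fun v => \sum_(j <- r | P j) F j v) = \sum_(j <- r | P j) wsum k (F j).
Proof.
elim: k F => //= k IH F; rewrite exchange_big; apply: eq_bigr => x _.
exact: IH.
Qed.

Lemma wsum_exchange k l (F : word -> word -> M) :
  wsum k (fun v => wsum l (F v)) = wsum l (fun d => wsum k (F^~ d)).
Proof.
elim: k F => //= k IH F; rewrite wsum_sum; apply: eq_bigr => x _; exact: IH.
Qed.

Lemma wsum_cat k l F : wsum (k + l) F = wsum k (fun u => wsum l (fun v => F (u ++ v))).
Proof. by elim: k F => //= k IH F; apply: eq_bigr => x _; exact: IH. Qed.

Lemma wsum_rev k F : wsum k F = wsum k (fun v => F (rev v)).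
Proof.
elim: k F => // k IH F.
have -> : wsum k.+1 (fun v => F (rev v)) = wsum (k + 1) (fun v => F (rev v)).
  by rewrite addn1.
rewrite wsum_cat /= -wsum_sum IH; apply: eq_wsum => v _.
by apply: eq_bigr => x _; rewrite rev_cat.
Qed.

Lemma wsum_ins k i F : (i <= k)%N ->
  wsum k.+1 F = \sum_x wsum k (fun v => F (ins i x v)).
Proof.
move=> ik; have -> : k.+1 = (i + (1 + (k - i)))%N by lia.
rewrite wsum_cat /= wsum_sum; apply: eq_bigr => x _.
rewrite -[in RHS](subnKC ik) [RHS]wsum_cat.
apply: eq_wsum => u su; apply: eq_wsum => v _.
by rewrite /ins take_size_cat // drop_size_cat.
Qed.

Lemma wsum_pick k w F : wsum k (fun v => if v == w then F v else 0) =
  if size w == k then F w else 0.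
Proof.
elim: k w F => [|k IH] [|y w] F //=.
  by rewrite big1 // => x _; rewrite wsum_zero.
rewrite (bigD1 y) //= big1 ?addr0 => [|x xy].
  by rewrite eqSS -[RHS](IH w (fun v => F (y :: v))); apply: eq_wsum => v _; rewrite eqseq_cons eqxx.
rewrite -[RHS](wsum_zero k); apply: eq_wsum => v _.
by rewrite eqseq_cons (negbTE xy).
Qed.

Lemma wsum_tuple k F : wsum k F = \sum_(t : k.-tuple 'I_n) F t.
Proof.
elim: k F => [|k IH] F /=.
  rewrite (bigD1 [tuple]) //= big1 ?addr0 // => t.
  by move=> /eqP[]; exact: tuple0.
under eq_bigr do rewrite IH.
rewrite pair_big /= (reindex (fun t : k.+1.-tuple 'I_n => (thead t, [tuple of behead t]))) /=.
  by apply: eq_bigr => t _; rewrite [in RHS](tuple_eta t).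
exists (fun p : 'I_n * k.-tuple 'I_n => [tuple of p.1 :: p.2]) => [t _|[x t] _] /=.
  by rewrite -tuple_eta.
by congr pair; apply/val_inj.
Qed.

End OneModule.

Lemma wsum_morph (M M' : nmodType) (f : M -> M') k F :
  {morph f : x y / x + y} -> f 0 = 0 -> f (wsum k F) = wsum k (fun v => f (F v)).
Proof.
move=> fD f0; elim: k F => //= k IH F; rewrite (big_morph f fD f0).
by apply: eq_bigr => x _; exact: IH.
Qed.

Lemma wsum_mull (S : pzSemiRingType) k (a : S) F :
  a * wsum k F = wsum k (fun v => a * F v).
Proof. by apply: (wsum_morph (f := fun x => a * x)) => [x y|]; rewrite ?mulrDr ?mulr0. Qed.

Lemma wsum_mulr (S : pzSemiRingType) k (a : S) F :
  wsum k F * a = wsum k (fun v => F v * a).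
Proof. by apply: (wsum_morph (f := fun x => x * a)) => [x y|]; rewrite ?mulrDl ?mul0r. Qed.

Lemma size_ins i x (v : word) : (i <= size v)%N -> size (ins i x v) = (size v).+1.
Proof. by move=> iv; rewrite /ins size_cat /= addnS -size_cat cat_take_drop. Qed.

Lemma onth_ins i x (v : word) : (i <= size v)%N -> onth (ins i x v) i = Some x.
Proof.
by move=> iv; rewrite /ins onth_cat size_takel // ltnn subnn.
Qed.

Lemma del_ins i x (v : word) : (i <= size v)%N -> del_nth i (ins i x v) = v.
Proof.
move=> iv; rewrite /del_nth /ins take_size_cat ?size_takel //.
by rewrite drop_cat size_takel // ltnNge leqnSn /= subSnn /= drop0 cat_take_drop.
Qed.

End WordSums.

Section Coordinates.
Variables (C : numClosedFieldType) (n : nat).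
Local Notation T := (mtens C n).
Local Notation word := (seq 'I_n).
Implicit Types (F G : word -> word -> C) (z : T) (A : set T).

Definition tens k l F : T := wsum k (fun v => wsum l (fun d => F v d *: << MWord v d >>)).

Definition coords z : word -> word -> C := fun v d => z@_(MWord v d).

Lemma mword_eqE (v d v' d' : word) : (MWord v d == MWord v' d') = (v == v') && (d == d').
Proof. by apply/eqP/andP => [[-> ->]|[/eqP -> /eqP ->]]. Qed.

Lemma mcoeff_wsum k (F : word -> T) a : (wsum k F)@_a = wsum k (fun v => (F v)@_a).
Proof. by apply: (wsum_morph (f := mcoeff a)) => [x y|]; rewrite ?mcoeffD ?mcoeff0. Qed.

Lemma tensE k l F v d : (tens k l F)@_(MWord v d) =
  if (size v == k) && (size d == l) then F v d else 0.
Proof.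
rewrite /tens mcoeff_wsum.
transitivity (wsum k (fun u => if u == v then (if size d == l then F u d else 0) else 0)).
  apply: eq_wsum => u _; rewrite mcoeff_wsum.
  transitivity (wsum l (fun e => if e == d then (if u == v then F u e else 0) else 0)).
    apply: eq_wsum => e _; rewrite mcoeffZ mcoeffU1 mword_eqE.
    by case: eqP => //= _; case: eqP => //= _; rewrite ?mulr1 ?mulr0.
  by rewrite wsum_pick; case: eqP; case: eqP.
by rewrite wsum_pick; case: eqP.
Qed.

Lemma eq_tens k l F G :
  (forall v d, size v = k -> size d = l -> F v d = G v d) -> tens k l F = tens k l G.
Proof.
by move=> FG; apply: eq_wsum => v sv; apply: eq_wsum => d sd; rewrite FG.
Qed.

Lemma tens_bidegree k l F : bidegree k l (tens k l F).
Proof.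
move=> [v d]; rewrite -mcoeff_neq0 tensE /=.
by case: andP => [[/eqP -> /eqP ->]|]; rewrite ?eqxx.
Qed.

Lemma bidegree_tens k l z : bidegree k l z -> z = tens k l (coords z).
Proof.
move=> zb; apply/malgP => -[v d]; rewrite tensE /coords.
case: ifP => // /negbT; have [/zb[/= -> ->]|] := boolP (MWord v d \in msupp z).
  by rewrite !eqxx.
by move=> /mcoeff_outdom ->.
Qed.

Lemma tens_lin k l c F G :
  tens k l (fun v d => c * F v d + G v d) = c *: tens k l F + tens k l G.
Proof.
apply/malgP => -[v d]; rewrite mcoeffD mcoeffZ !tensE.
by case: ifP => // _; rewrite mulr0 addr0.
Qed.

Lemma tens0 k l : tens k l (fun _ _ => 0) = 0.
Proof. by apply/malgP => -[v d]; rewrite tensE mcoeff0; case: ifP. Qed.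

Lemma tensM k l k' l' F G : tens k l F * tens k' l' G =
  tens (k + k') (l + l')
    (fun v d => F (take k v) (take l d) * G (drop k v) (drop l d)).
Proof.
rewrite /tens wsum_mulr wsum_cat; apply: eq_wsum => v sv.
rewrite wsum_mull; apply: eq_wsum => v' sv'.
rewrite wsum_mulr wsum_cat; apply: eq_wsum => d sd.
rewrite wsum_mull; apply: eq_wsum => d' sd'.
rewrite !take_size_cat // !drop_size_cat //.
by rewrite mtens_mulZr -(scalerAl (F v d)) malgUM scalerA mulrC.
Qed.

Lemma mtstar_tens k l F : mtstar (tens k l F) =
  tens l k (fun v d => (F (rev d) (rev v))^*).
Proof.
rewrite /tens (wsum_morph (f := @mtstar C n)) ?mtstar0 //; last exact: mtstarD.
under [LHS]eq_wsum => v _.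
  rewrite (wsum_morph (f := @mtstar C n)) ?mtstar0 //; last exact: mtstarD.
  under eq_wsum => d _ do rewrite mtstarZ mtstarU /star_word /=.
  rewrite wsum_rev; over.
rewrite wsum_rev wsum_exchange; apply: eq_wsum => d sd; apply: eq_wsum => v sv.
by rewrite !revK.
Qed.

Lemma mtcontractD i j : {morph (@mtcontract C n i j) : x y / x + y}.
Proof. by move=> x y; exact: (@semilinD C n idfun). Qed.

Lemma mtcontractZ i j c z : mtcontract i j (c *: z) = c *: mtcontract i j z.
Proof. exact: (@semilinZ C n idfun). Qed.

Lemma mtcontractU i j a : mtcontract i j (<<a>> : T) = contract_word C i j a.
Proof. exact: (@semilinU C n idfun). Qed.

Lemma mtcontract0 i j : mtcontract i j (0 : T) = 0.
Proof. by rewrite /mtcontract msupp0 big_seq_fset0. Qed.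

Lemma mtcontract_tens k l i j F : (i <= k)%N -> (j <= l)%N ->
  mtcontract i j (tens k.+1 l.+1 F) =
  tens k l (fun v d => \sum_p F (ins i p v) (ins j p d)).
Proof.
move=> ik jl; rewrite /tens (wsum_morph (f := @mtcontract C n i j)) ?mtcontract0 //; last exact: mtcontractD.
rewrite (wsum_ins _ ik) -wsum_sum; apply: eq_wsum => v sv.
transitivity (\sum_p wsum l (fun d => F (ins i p v) (ins j p d) *: (<<MWord v d>> : T))).
  apply: eq_bigr => p _.
  rewrite (wsum_morph (f := @mtcontract C n i j)) ?mtcontract0 //; last exact: mtcontractD.
  rewrite (wsum_ins _ jl) -wsum_sum; apply: eq_wsum => d sd.
  rewrite (bigD1 p) //= big1 ?addr0 => [|q qp].
    rewrite mtcontractZ mtcontractU /contract_word /= !onth_ins ?sv ?sd // eqxx.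
    by rewrite !del_ins ?sv ?sd.
  rewrite mtcontractZ mtcontractU /contract_word /= !onth_ins ?sv ?sd //.
  by rewrite eq_sym (negbTE qp) scaler0.
rewrite -wsum_sum; apply: eq_wsum => d sd.
by rewrite scaler_suml.
Qed.

End Coordinates.

(** * Contraction-closed algebras in coordinates *)

Section Homogeneous.
Variables (C : numClosedFieldType) (n : nat).
Local Notation T := (mtens C n).
Implicit Types (z : T).

Definition word_bound z := \max_(a <- msupp z) maxn (size (vword a)) (size (dword a)).

Lemma word_boundP z a : a \in msupp z ->
  (size (vword a) <= word_bound z)%N /\ (size (dword a) <= word_bound z)%N.
Proof.
move=> az; have : (maxn (size (vword a)) (size (dword a)) <= word_bound z)%N.
  exact: (leq_bigmax_seq (F := fun a : mword n => maxn (size (vword a)) (size (dword a)))).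
by rewrite geq_max => /andP.
Qed.

Lemma sum_components z N : (word_bound z < N)%N ->
  z = \sum_(k < N) \sum_(l < N) tens k l (coords z).
Proof.
move=> zN; apply/malgP => -[v d]; rewrite raddf_sum /=.
have [az|] := boolP (MWord v d \in msupp z); last first.
  move=> nz; rewrite mcoeff_outdom // big1 // => k _.
  rewrite raddf_sum big1 //= => l _; rewrite tensE; case: ifP => // _.
  exact: mcoeff_outdom.
have [/= vN dN] := word_boundP az.
have vN' := leq_ltn_trans vN zN; have dN' := leq_ltn_trans dN zN.
rewrite (bigD1 (Ordinal vN')) //= [X in _ + X]big1 ?addr0 => [|k kv]; last first.
  rewrite raddf_sum big1 // => l _; rewrite /= tensE.
  by have -> : (size v == k) = false by apply: contra_neqF kv => /eqP e; apply/val_inj.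
rewrite raddf_sum (bigD1 (Ordinal dN')) //= [X in _ + X]big1 ?addr0 => [|l ld].
  by rewrite tensE !eqxx.
rewrite tensE.
have -> : (size d == l) = false by apply: contra_neqF ld => /eqP e; apply/val_inj.
by rewrite andbF.
Qed.

End Homogeneous.

Section Closure.
Variables (C : numClosedFieldType) (n : nat) (A : set (mtens C n)).
Local Notation T := (mtens C n).
Local Notation word := (seq 'I_n).
Implicit Types (F G : word -> word -> C).
Hypotheses (A_alg : subalgebra A) (A_gr : graded A).
Hypotheses (A_star : star_closed A) (A_con : contraction_closed A).

Definition memA k l F := A (tens k l F).

Lemma A_add x y : A x -> A y -> A (x + y).
Proof. by case: A_alg => _ H _ _; exact: H. Qed.
Lemma A_scale c x : A x -> A (c *: x).
Proof. by case: A_alg => _ _ H _; exact: H. Qed.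
Lemma A_mul x y : A x -> A y -> A (x * y).
Proof. by case: A_alg => _ _ _; apply. Qed.
Lemma A_one : A 1.
Proof. by case: A_alg. Qed.
Lemma A_zero : A 0.
Proof. by rewrite -(scale0r 1); apply/A_scale/A_one. Qed.
Lemma A_sum (J : Type) (r : seq J) (P : pred J) (x : J -> T) :
  (forall j, A (x j)) -> A (\sum_(j <- r | P j) x j).
Proof. by move=> Ax; elim/big_ind: _ => //; [exact: A_zero|exact: A_add]. Qed.

Lemma A_mtstar x : A x -> A (mtstar x).
Proof. by move=> Ax; rewrite -A_star; exists x. Qed.

Lemma memA_eq k l F G : (forall v d, size v = k -> size d = l -> F v d = G v d) ->
  memA k l F -> memA k l G.
Proof. by move=> FG; rewrite /memA (eq_tens FG). Qed.

Lemma memA_lin k l c F G : memA k l F -> memA k l G ->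
  memA k l (fun v d => c * F v d + G v d).
Proof. by move=> AF AG; rewrite /memA tens_lin; apply: A_add => //; exact: A_scale. Qed.

Lemma memA0 k l : memA k l (fun _ _ => 0).
Proof. by rewrite /memA tens0; exact: A_zero. Qed.

Lemma memA_sum k l (J : Type) (r : seq J) (P : pred J) (F : J -> word -> word -> C) :
  (forall j, P j -> memA k l (F j)) -> memA k l (fun v d => \sum_(j <- r | P j) F j v d).
Proof.
move=> AF; elim: r => [|j r IH].
  by apply: memA_eq (memA0 k l) => v d _ _; rewrite big_nil.
have [Pj|nPj] := boolP (P j); last first.
  by apply: memA_eq IH => v d _ _; rewrite big_cons (negbTE nPj).
apply: memA_eq (memA_lin 1 (AF j Pj) IH) => v d _ _.
by rewrite big_cons Pj mul1r.
Qed.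

Lemma memA_mul k l k' l' F G : memA k l F -> memA k' l' G ->
  memA (k + k') (l + l') (fun v d => F (take k v) (take l d) * G (drop k v) (drop l d)).
Proof. by move=> AF AG; rewrite /memA -tensM; exact: A_mul. Qed.

Lemma memA_star k l F : memA k l F -> memA l k (fun v d => (F (rev d) (rev v))^*).
Proof. by move=> AF; rewrite /memA -mtstar_tens; exact: A_mtstar. Qed.

Lemma memA_contract k l i j F : (i <= k)%N -> (j <= l)%N -> memA k.+1 l.+1 F ->
  memA k l (fun v d => \sum_p F (ins i p v) (ins j p d)).
Proof.
move=> ik jl AF; rewrite /memA -mtcontract_tens //.
by apply: (A_con (k := k.+1) (l := l.+1)) => //; split=> //; exact: tens_bidegree.
Qed.

Lemma memA_coords a k l : A a -> memA k l (coords a).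
Proof.
rewrite {1}A_gr => -[N [x [Ax ->]]].
apply: (@memA_eq _ _ (fun v d => \sum_(k' < N) \sum_(l' < N) coords (x k' l') v d)).
  by move=> v d _ _; rewrite /coords raddf_sum; apply: eq_bigr => k' _; rewrite raddf_sum.
apply: memA_sum => k' _; apply: memA_sum => l' _.
have [Ax' xb] := Ax k' l'.
have e := bidegree_tens xb.
have [/andP[/eqP <- /eqP <-]|ne] := boolP (((k' : nat) == k) && ((l' : nat) == l)).
  by rewrite /memA -e.
apply: memA_eq (memA0 k l) => v d sv sd.
rewrite /coords e tensE sv sd eq_sym [l == l']eq_sym.
by rewrite (negbTE ne).
Qed.

Lemma coords_memA b : (forall k l, memA k l (coords b)) -> A b.
Proof.
move=> bA; rewrite (sum_components (ltnSn (word_bound b))).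
by do 2!apply: A_sum => ?; exact: bA.
Qed.

(** Contracting a block of [m] consecutive factors of [V] against a block of [m]
    consecutive factors of the dual, in nested order. *)
Lemma memA_block k1 k2 l1 l2 m F : memA (k1 + m + k2) (l1 + m + l2) F ->
  memA (k1 + k2) (l1 + l2) (fun v d => wsum m (fun t =>
    F (take k1 v ++ t ++ drop k1 v) (take l1 d ++ rev t ++ drop l1 d))).
Proof.
elim: m F => [|m IH] F.
  rewrite !addn0; apply: memA_eq => v d _ _ /=.
  by rewrite !cat_take_drop.
have -> : (k1 + m.+1 + k2 = (k1 + m + k2).+1)%N by lia.
have -> : (l1 + m.+1 + l2 = (l1 + m + l2).+1)%N by lia.
move/(@memA_contract _ _ (k1 + m) l1); rewrite leq_addr -addnA leq_addr => /(_ isT isT).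
rewrite addnA => /IH; apply: memA_eq => v d sv sd.
rewrite -[in RHS]addn1 wsum_cat; apply: eq_wsum => t st /=.
apply: eq_bigr => p _.
have s1 : size (take k1 v) = k1 by rewrite size_takel // sv leq_addr.
have s2 : size (take l1 d) = l1 by rewrite size_takel // sd leq_addr.
have s3 : size (take k1 v ++ t) = (k1 + m)%N by rewrite size_cat s1 st.
rewrite /ins (catA (take k1 v)) (take_size_cat _ s3) (drop_size_cat _ s3).
rewrite (take_size_cat _ s2) (drop_size_cat _ s2) rev_cat /=.
by rewrite -!catA.
Qed.

Definition delta (v d : word) : C := (v == d)%:R.

Section WithDelta.
Hypothesis A_delta : memA 1 1 delta.

(** Contracting [delta (x) F] moves the first factor of [V] to position [i]. *)
Lemma memA_move k l i F : (i <= k)%N -> memA k.+1 l F ->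
  memA k.+1 l (fun v d => if v is x :: v' then F (ins i x v') d else 0).
Proof.
move=> ik AF; have := memA_mul A_delta AF.
rewrite !add1n => /(@memA_contract _ _ i.+1 0); rewrite ltnS ik => /(_ isT isT).
apply: memA_eq => -[|x v] d // [sv] sd.
rewrite (bigD1 x) //= big1 ?addr0 => [|p px].
  by rewrite /delta /ins /= !take0 !drop0 /= ?take0 ?drop0 eqxx mul1r.
by rewrite /delta /ins /= !take0 /= ?take0 eqseq_cons eq_sym (negbTE px) mul0r.
Qed.

Lemma memA_rot1 k l F : memA k l F -> memA k l (fun v d => F (rot 1 v) d).
Proof.
case: k => [|k]; first by apply: memA_eq => -[].
move/(memA_move (leqnn k)); apply: memA_eq => -[|x v] d // [sv] _.
by rewrite /ins -sv take_size drop_size /rot /= drop0 take0.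
Qed.

Lemma memA_rot k l m F : (m <= k)%N -> memA k l F -> memA k l (fun v d => F (rot m v) d).
Proof.
elim: m => [|m IH] mk AF.
  by apply: memA_eq AF => v d _ _; rewrite rot0.
apply: memA_eq (memA_rot1 (IH (ltnW mk) AF)) => v d sv _.
by rewrite -rotD ?addn1 // sv.
Qed.

Definition swap2 (v : word) : word := if v is x :: y :: v' then y :: x :: v' else v.

Lemma size_swap2 v : size (swap2 v) = size v.
Proof. by case: v => [|x [|y v]]. Qed.

Lemma swap2K : involutive swap2.
Proof. by case=> [|x [|y v]]. Qed.

Lemma memA_swap2 k l F : memA k l F -> memA k l (fun v d => F (swap2 v) d).
Proof.
case: k => [|[|k]]; try by apply: memA_eq => -[|x []].
move/(@memA_move _ _ 1) => /(_ isT); apply: memA_eq => -[|x [|y v]] d //= _ _.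
by rewrite /ins /= take0 drop0.
Qed.

End WithDelta.
End Closure.

(** * The projection kernel and its symmetries *)

Lemma wsum_bij n (M : nmodType) k (r s : seq 'I_n -> seq 'I_n) (F : seq 'I_n -> M) :
  (forall v, size v = k -> size (r v) = k) -> (forall v, size v = k -> size (s v) = k) ->
  (forall v, size v = k -> s (r v) = v) -> (forall v, size v = k -> r (s v) = v) ->
  wsum k F = wsum k (fun v => F (r v)).
Proof.
move=> zr zs rK sK; rewrite !wsum_tuple.
have zr' (t : k.-tuple 'I_n) : size (r t) == k by rewrite zr ?size_tuple.
have zs' (t : k.-tuple 'I_n) : size (s t) == k by rewrite zs ?size_tuple.
rewrite (reindex (fun t : k.-tuple 'I_n => Tuple (zr' t))) //=.
exists (fun t : k.-tuple 'I_n => Tuple (zs' t)) => t _; apply: val_inj => /=.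
  by rewrite rK ?size_tuple.
by rewrite sK ?size_tuple.
Qed.

Lemma wsum_rev2 n (M : nmodType) k l (F : seq 'I_n -> seq 'I_n -> M) :
  wsum l (fun u => wsum k (F u)) = wsum k (fun u => wsum l (fun e => F (rev e) (rev u))).
Proof.
rewrite wsum_exchange wsum_rev; apply: eq_wsum => u _; exact: wsum_rev.
Qed.

Section SeqPerm.
Variables (X : eqType) (S : Type).
Implicit Types (s t : seq X).

(** Rotations and the transposition of the first two entries generate all
    permutations of a sequence. *)
Lemma perm_invariant (f : seq X -> S) :
  (forall s, f (rot 1 s) = f s) -> (forall x y s, f (x :: y :: s) = f (y :: x :: s)) ->
  forall s t, perm_eq s t -> f s = f t.
Proof.
move=> frot fswap.
have fcat s t : f (s ++ t) = f (t ++ s).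
  elim: s t => [|x s IH] t; first by rewrite cats0.
  rewrite -frot /= rot1_cons -cats1 -catA IH -catA; exact: erefl.
have fadj s x y t : f (s ++ x :: y :: t) = f (s ++ y :: x :: t).
  by rewrite fcat /= fswap fcat.
clear frot fswap fcat; suff gen m : forall (f : seq X -> S),
    (forall s x y t, f (s ++ x :: y :: t) = f (s ++ y :: x :: t)) ->
    forall s t, size s = m -> perm_eq s t -> f s = f t by move=> s t; exact: gen.
clear; elim: m => [|m IH] f fadj s t.
  by move=> /size0nil ->; rewrite perm_sym => /perm_nilP ->.
case: s => // x s [sm] st.
have xt : x \in t by rewrite -(perm_mem st) mem_head.
have front t1 t2 : f (t1 ++ x :: t2) = f (x :: t1 ++ t2).
  elim/last_ind: t1 t2 => // t1 y IHt t2.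
  by rewrite cat_rcons fadj IHt cat_rcons.
case/splitPr: xt st => t1 t2; rewrite perm_sym perm_catC /= perm_cons => st.
rewrite front; apply: (IH (fun u => f (x :: u))) => //.
  by move=> u a b w; exact: (fadj (x :: u)).
by rewrite perm_sym perm_catC.
Qed.
End SeqPerm.

Section WordKernel.
Variables (C : numClosedFieldType) (n : nat) (A : set (mtens C n)).
Local Notation T := (mtens C n).
Local Notation word := (seq 'I_n).
Local Notation memA := (memA A).
Implicit Types (F G : word -> word -> C) (K : word -> word -> word -> word -> C).
Hypotheses (A_alg : subalgebra A) (A_gr : graded A).
Hypotheses (A_star : star_closed A) (A_con : contraction_closed A).

(** [proj_kernel] for the tensors of bidegree [(k, l)] in [A], with pairs of words
    instead of pairs of tuples as indices. *)
Record word_kernel k l K : Prop := WordKernel {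
  wkernel_row : forall v d, size v = k -> size d = l -> memA k l (K v d);
  wkernel_rep : forall F, memA k l F -> forall v d, size v = k -> size d = l ->
    wsum k (fun u => wsum l (fun e => F u e * K u e v d)) = F v d;
  wkernel_herm : forall u e v d, size u = k -> size e = l -> size v = k -> size d = l ->
    K v d u e = (K u e v d)^* }.

Lemma wsum_conj k (F : word -> C) : (wsum k F)^* = wsum k (fun v => (F v)^*).
Proof. by apply: wsum_morph => [x y|]; rewrite ?rmorphD ?rmorph0. Qed.

Lemma word_kernel_uniq k l K K' : word_kernel k l K -> word_kernel k l K' ->
  forall u e v d, size u = k -> size e = l -> size v = k -> size d = l ->
  K u e v d = K' u e v d.
Proof.
move=> hK hK' u e v d su se sv sd.
rewrite -(wkernel_rep hK' (wkernel_row hK su se) sv sd).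
rewrite [RHS](wkernel_herm hK') // -(wkernel_rep hK (wkernel_row hK' sv sd) su se).
rewrite wsum_conj; apply: eq_wsum => u' su'.
rewrite wsum_conj; apply: eq_wsum => e' se'.
by rewrite rmorphM /= -(wkernel_herm hK) // -(wkernel_herm hK') // mulrC.
Qed.

Lemma word_kernel_exists k l : exists K, word_kernel k l K.
Proof.
pose I : finType := (k.-tuple 'I_n * l.-tuple 'I_n)%type.
pose ext (f : I -> C) : word -> word -> C := fun v d =>
  if insub v is Some t then if insub d is Some s then f (t, s) else 0 else 0.
have extE f (t : k.-tuple 'I_n) (s : l.-tuple 'I_n) : ext f t s = f (t, s).
  by rewrite /ext !valK.
have tup m (v : word) : size v = m -> exists t : m.-tuple 'I_n, v = t.
  by move=> sv; exists (Tuple (introT eqP sv)).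
have sP : subspace [set f : I -> C | memA k l (ext f)]%classic.
  split=> /= [|c f g].
    apply: memA_eq (memA0 A_alg k l) => v d _ _.
    by rewrite /ext; case: insub => // ?; case: insub.
  move=> Pf Pg; apply: memA_eq (memA_lin A_alg c Pf Pg) => v d sv sd.
  have [t ->] := tup k v sv; have [s ->] := tup l d sd.
  by rewrite !extE.
have [K hK] := kernel_exists sP.
pose K' u e v d := ext (fun i => ext (K i) v d) u e.
have K'E (t t' : k.-tuple 'I_n) (s s' : l.-tuple 'I_n) : K' t s t' s' = K (t, s) (t', s').
  by rewrite /K' !extE.
exists K'; split.
- move=> v d sv sd; have [t ->] := tup k v sv; have [s ->] := tup l d sd.
  apply: memA_eq (kernel_row hK (t, s)) => v' d' sv' sd'.
  have [t' ->] := tup k v' sv'; have [s' ->] := tup l d' sd'.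
  by rewrite extE K'E.
- move=> F AF v d sv sd; have [t ->] := tup k v sv; have [s ->] := tup l d sd.
  have := kernel_rep hK (f := fun p => F p.1 p.2) _ (t, s).
  move=> <- /=; last first.
    apply: memA_eq AF => v' d' sv' sd'.
    by have [t' ->] := tup k v' sv'; have [s' ->] := tup l d' sd'; rewrite extE.
  rewrite wsum_tuple; under [LHS]eq_bigr => t' _ do rewrite wsum_tuple.
  rewrite pair_big; apply: eq_bigr => -[t' s'] _ /=.
  by rewrite -K'E.
- move=> u e v d su se sv sd.
  have [t ->] := tup k v sv; have [s ->] := tup l d sd.
  have [t' ->] := tup k u su; have [s' ->] := tup l e se.
  by rewrite !K'E (kernel_herm hK).
Qed.

Definition ker_words : word -> word -> word -> word -> C :=
  fun v d => sval (cid (word_kernel_exists (size v) (size d))) v d.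
Local Notation K := ker_words.

Lemma ker_wordsP k l : word_kernel k l K.
Proof.
rewrite /K; have hK := svalP (cid (word_kernel_exists k l)).
split.
- by move=> v d sv sd; rewrite sv sd; exact: (wkernel_row hK).
- move=> F AF v d sv sd; rewrite -[RHS](wkernel_rep hK AF sv sd).
  by apply: eq_wsum => u su; apply: eq_wsum => e se; rewrite su se.
- by move=> u e v d su se sv sd; rewrite su se sv sd; exact: (wkernel_herm hK).
Qed.

(** The kernel transported by a symmetry of [A] is again a kernel for [A]. *)
Lemma ker_words_bij k l (r s : word -> word) :
  (forall v, size v = k -> size (r v) = k) -> (forall v, size v = k -> size (s v) = k) ->
  (forall v, size v = k -> s (r v) = v) -> (forall v, size v = k -> r (s v) = v) ->
  (forall F, memA k l F -> memA k l (fun v d => F (r v) d)) ->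
  (forall F, memA k l F -> memA k l (fun v d => F (s v) d)) ->
  forall u e v d, size u = k -> size e = l -> size v = k -> size d = l ->
  K (r u) e (r v) d = K u e v d.
Proof.
move=> zr zs rK sK Ar As.
have hK := ker_wordsP k l.
apply: (@word_kernel_uniq k l (fun u e v d => K (r u) e (r v) d)) => //; split.
- by move=> v d sv sd; apply: Ar; apply: (wkernel_row hK) => //; exact: zr.
- move=> F AF v d sv sd.
  rewrite -[in RHS](rK v sv) -(wkernel_rep hK (As _ AF) (zr v sv) sd).
  rewrite [RHS](wsum_bij _ zr zs rK sK); apply: eq_wsum => u su.
  by apply: eq_wsum => e se; rewrite rK.
- by move=> u e v d su se sv sd; apply: (wkernel_herm hK); rewrite ?zr.
Qed.

Lemma ker_words_star u e v d : size u = size v -> size e = size d ->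
  K u e v d = (K (rev e) (rev u) (rev d) (rev v))^*.
Proof.
move=> uv ed; pose k := size u; pose l := size e.
have hK := ker_wordsP l k.
apply: (word_kernel_uniq (ker_wordsP k l)
  (K' := fun u e v d => (K (rev e) (rev u) (rev d) (rev v))^* )) => //; split.
- move=> v' d' sv sd; have := wkernel_row hK (v := rev d') (d := rev v').
  rewrite !size_rev => /(_ sd sv) /(memA_star A_star); exact.
- move=> F AF v' d' sv sd.
  have := wkernel_rep hK (memA_star A_star AF) (v := rev d') (d := rev v').
  rewrite !size_rev !revK => /(_ sd sv) /(congr1 Num.conj); rewrite conjCK => <-.
  rewrite wsum_rev2 wsum_conj; apply: eq_wsum => x sx.
  rewrite wsum_conj; apply: eq_wsum => y sy.
  by rewrite rmorphM /= conjCK !revK.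
- by move=> u' e' v' d' *; rewrite (wkernel_herm hK) ?size_rev.
Qed.

Section Perm.
Hypothesis A_delta : memA 1 1 (delta C (n := n)).
Local Notation pword := (seq ('I_n * 'I_n)).

(** A pair of letters consists of corresponding letters of the target word and of
    the source word, in this order. *)
Definition ker_pairs (p q : pword) : C :=
  K (unzip2 p) (unzip2 q) (unzip1 p) (unzip1 q).

Lemma ker_pairs_perml p p' q : perm_eq p p' -> ker_pairs p q = ker_pairs p' q.
Proof.
move: p p'; apply: perm_invariant => [s|x y s].
  rewrite /ker_pairs /unzip1 /unzip2 !map_rot.
  have zrot (v : word) m : size (rot m v) = size v by exact: size_rot.
  apply: (@ker_words_bij (size s) (size q) (rot 1) (rotr 1)); rewrite ?size_map //.
  - by move=> v; rewrite size_rot.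
  - by move=> v; rewrite size_rotr.
  - by move=> v _; exact: rotK.
  - by move=> v _; exact: rotrK.
  - by move=> F; exact: memA_rot1.
  - move=> F AF; apply: memA_eq (memA_rot A_alg A_con A_delta (leq_subr 1 (size s)) AF) => v d sv _.
    by rewrite -sv.
rewrite /ker_pairs /=.
apply: (@ker_words_bij (size s).+2 (size q) (@swap2 n) (@swap2 n) _ _ _ _ _ _
   (y.2 :: x.2 :: unzip2 s) _ (y.1 :: x.1 :: unzip1 s)); rewrite /= ?size_map //.
- by move=> v; rewrite size_swap2.
- by move=> v; rewrite size_swap2.
- by move=> v _; exact: swap2K.
- by move=> v _; exact: swap2K.
- by move=> F; exact: memA_swap2.
- by move=> F; exact: memA_swap2.
Qed.

Lemma ker_pairs_star p q : ker_pairs p q = (ker_pairs (rev q) (rev p))^*.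
Proof. by rewrite /ker_pairs ker_words_star ?size_map // /unzip1 /unzip2 !map_rev. Qed.

(** Permutations of the dual factors reduce to permutations of the factors of [V]
    by the star operation. *)
Lemma ker_pairs_perm p p' q q' : perm_eq p p' -> perm_eq q q' ->
  ker_pairs p q = ker_pairs p' q'.
Proof.
move=> pp' qq'; rewrite (ker_pairs_perml _ pp') !(ker_pairs_star p').
congr (_^* ); apply: ker_pairs_perml.
by rewrite perm_rev perm_sym perm_rev perm_sym.
Qed.

End Perm.
End WordKernel.

(** * Complete positivity of the projection *)

Lemma insub_bseqK D (X : Type) (v : seq X) : (size v <= D)%N -> insub_bseq D v = v :> seq X.
Proof. by move=> vD; rewrite /insub_bseq insubdK. Qed.

Lemma bseq_insubK D (X : Type) (b : D.-bseq X) : insub_bseq D b = b.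
Proof. by apply: val_inj; rewrite /= insub_bseqK // size_bseq. Qed.

Lemma sum_bseq n (M : nmodType) D (f : D.-bseq 'I_n -> M) :
  \sum_b f b = \sum_(k < D.+1) wsum k (fun v => f (insub_bseq D v)).
Proof.
have sD (b : D.-bseq 'I_n) : (size b < D.+1)%N by rewrite ltnS size_bseq.
rewrite (partition_big (fun b : D.-bseq 'I_n => Ordinal (sD b)) predT) //=.
apply: eq_bigr => k _; rewrite wsum_tuple.
have kD (t : k.-tuple 'I_n) : (size t <= D)%N by rewrite size_tuple -ltnS.
rewrite -(big_map (fun t : k.-tuple 'I_n => insub_bseq D t) predT f) -big_filter.
apply: perm_big; apply: uniq_perm.
- by rewrite filter_uniq // index_enum_uniq.
- rewrite map_inj_uniq ?index_enum_uniq // => t t' /(congr1 val) /=.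
  by rewrite !insub_bseqK // => e; apply: val_inj.
move=> b; rewrite mem_filter mem_index_enum andbT; apply/eqP/mapP => [|[t _ ->]].
  move=> /(congr1 val) /= /eqP sb; exists (Tuple sb); first exact: mem_index_enum.
  by apply: val_inj; rewrite /= insub_bseqK // size_bseq.
by apply: val_inj; rewrite /= insub_bseqK // size_tuple.
Qed.

Section MatrixAlgebra.
Variables (C : numClosedFieldType) (n : nat) (A : set (mtens C n)).
Local Notation T := (mtens C n).
Local Notation word := (seq 'I_n).
Local Notation memA := (memA A).
Implicit Types (F G : word -> word -> C).
Hypotheses (A_alg : subalgebra A) (A_gr : graded A).
Hypotheses (A_star : star_closed A) (A_con : contraction_closed A).
Local Notation K := (ker_words A_alg).
Variable D : nat.
Import spectral.
Local Open Scope sesquilinear_scope.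

Definition bword : finType := (D.-bseq 'I_n * D.-bseq 'I_n)%type.
Local Notation N := #|bword|.
Definition rk (v d : word) : 'I_N := enum_rank ((insub_bseq D v, insub_bseq D d) : bword).
Definition vwd (i : 'I_N) : word := (enum_val i).1.
Definition dwd (i : 'I_N) : word := (enum_val i).2.

Lemma rkK i : rk (vwd i) (dwd i) = i.
Proof. by rewrite /rk /vwd /dwd !bseq_insubK -surjective_pairing enum_valK. Qed.

Lemma vwd_rk v d : (size v <= D)%N -> vwd (rk v d) = v.
Proof. by move=> vD; rewrite /vwd enum_rankK /= insub_bseqK. Qed.

Lemma dwd_rk v d : (size d <= D)%N -> dwd (rk v d) = d.
Proof. by move=> vD; rewrite /dwd enum_rankK /= insub_bseqK. Qed.

Lemma size_vwd i : (size (vwd i) <= D)%N.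
Proof. exact: size_bseq. Qed.
Lemma size_dwd i : (size (dwd i) <= D)%N.
Proof. exact: size_bseq. Qed.

Lemma sum_rk (f : 'I_N -> C) :
  \sum_i f i = \sum_(k < D.+1) \sum_(l < D.+1) wsum k (fun v => wsum l (fun d => f (rk v d))).
Proof.
rewrite (reindex (@enum_rank bword)); last by apply: onW_bij; exact: enum_rank_bij.
transitivity (\sum_(p : bword) f (enum_rank ((p.1, p.2) : bword))).
  by apply: eq_bigr => -[].
rewrite -(pair_bigA _ (fun (a b : D.-bseq 'I_n) => f (enum_rank ((a, b) : bword)))) /=.
rewrite sum_bseq; apply: eq_bigr => k _.
rewrite -wsum_sum; apply: eq_wsum => v _.
by rewrite sum_bseq.
Qed.

Lemma sum_rk_pick k l (f : 'I_N -> C) : (k <= D)%N -> (l <= D)%N ->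
  (forall i, (size (vwd i) == k) && (size (dwd i) == l) = false -> f i = 0) ->
  \sum_i f i = wsum k (fun v => wsum l (fun d => f (rk v d))).
Proof.
move=> kD lD f0; rewrite sum_rk.
have zero k' l' : (k' <= D)%N -> (l' <= D)%N -> (k' == k) && (l' == l) = false ->
    wsum k' (fun v => wsum l' (fun d => f (rk v d))) = 0.
  move=> k'D l'D ne; rewrite -[RHS](wsum_zero n C k'); apply: eq_wsum => v sv.
  rewrite -[RHS](wsum_zero n C l'); apply: eq_wsum => d sd.
  by apply: f0; rewrite vwd_rk ?dwd_rk ?sv ?sd.
have kD' : (k < D.+1)%N by []. have lD' : (l < D.+1)%N by [].
rewrite (bigD1 (Ordinal kD')) //= [X in _ + X]big1 ?addr0; last first.
  move=> k' nk; apply: big1 => l' _; apply: zero; rewrite -1?ltnS //.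
  by apply/negbTE; rewrite negb_and; apply/orP; left.
rewrite (bigD1 (Ordinal lD')) //= [X in _ + X]big1 ?addr0 // => l' nl.
apply: zero; rewrite -1?ltnS //.
by apply/negbTE; rewrite negb_and; apply/orP; right.
Qed.

(** The matrix unit indexed by words [a] and [b] stands for the basis tensor
    [a b^* ], so that composition of matrices is contraction. *)
Definition block (M : 'M[C]_N) k l (x y : word) : C :=
  M (rk (take k x) (take l y)) (rk (rev (drop l y)) (rev (drop k x))).

Lemma block_cat M k l u e v d : size u = k -> size e = l ->
  block M k l (u ++ v) (e ++ d) = M (rk u e) (rk (rev d) (rev v)).
Proof. by move=> su se; rewrite /block !take_size_cat // !drop_size_cat. Qed.

Definition word_matrices : set 'M[C]_N := fun M =>
  forall k l k' l', (k <= D)%N -> (l <= D)%N -> (k' <= D)%N -> (l' <= D)%N ->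
  memA (k + l') (l + k') (block M k l).
Local Notation B := word_matrices.

Lemma word_matrices_lin c X Y : B X -> B Y -> B (c *: X + Y).
Proof.
move=> BX BY k l k' l' kD lD k'D l'D.
apply: memA_eq (memA_lin A_alg c (BX k l k' l' kD lD k'D l'D) (BY _ _ _ _ kD lD k'D l'D)).
by move=> v d _ _; rewrite /block !mxE.
Qed.

Lemma word_matrices0 : B 0.
Proof.
by move=> k l k' l' *; apply: memA_eq (memA0 A_alg _ _) => v d _ _; rewrite /block mxE.
Qed.

Lemma word_matrices_adj X : B X -> B (X^t*).
Proof.
move=> BX k l k' l' kD lD k'D l'D.
have := memA_star A_star (BX k' l' k l k'D l'D kD lD).
rewrite (addnC l') (addnC k'); apply: memA_eq => x y sx sy.
rewrite /block !mxE; congr (_^* ); congr (X (rk _ _) (rk _ _)).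
- by rewrite take_rev sy addnK.
- by rewrite take_rev sx addnK.
- by rewrite drop_rev revK sx addnK.
- by rewrite drop_rev revK sy addnK.
Qed.

(** The product of two tensors [a b^* ] and [b' c^* ] has to be contracted along
    [b] and [b'], one block for the factors of [V] and one for those of the
    dual. *)
Lemma word_matrices_mul X Y : B X -> B Y -> B (X *m Y).
Proof.
move=> BX BY k l k'' l'' kD lD k''D l''D.
pose F k' l' x y := block X k l (take (k + l') x) (take (l + k') y) *
   block Y k' l' (drop (k + l') x) (drop (l + k') y).
apply: (memA_eq (F := fun x y => \sum_(k' < D.+1) \sum_(l' < D.+1)
   wsum l' (fun s => wsum k' (fun t => F k' l' (take k x ++ s ++ t ++ drop k x)
     (take l y ++ rev t ++ rev s ++ drop l y))))).
  move=> x y sx sy; rewrite /block mxE sum_rk; apply: eq_bigr => k' _.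
  apply: eq_bigr => l' _; rewrite [RHS]wsum_exchange [RHS]wsum_rev.
  apply: eq_wsum => s ss; apply: eq_wsum => t st.
  have s1 : size (take k x) = k by rewrite size_takel // sx leq_addr.
  have s2 : size (take l y) = l by rewrite size_takel // sy leq_addr.
  have s3 : size (take k x ++ s) = (k + l')%N by rewrite size_cat s1 ss.
  have s4 : size (take l y ++ rev t) = (l + k')%N by rewrite size_cat s2 size_rev st.
  rewrite /F (catA (take k x)) (catA (take l y)) (take_size_cat _ s3) (drop_size_cat _ s3).
  rewrite (take_size_cat _ s4) (drop_size_cat _ s4).
  by rewrite !block_cat ?size_rev // revK.
apply: memA_sum => // k' _; apply: memA_sum => // l' _.
have k'D : (k' <= D)%N by rewrite -ltnS. have l'D : (l' <= D)%N by rewrite -ltnS.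
have := memA_mul A_alg (BX k l k' l' kD lD k'D l'D) (BY k' l' k'' l'' k'D l'D k''D l''D).
rewrite (addnA (k + l')%N) -/(F k' l').
move/(memA_block A_con); rewrite addnA => /(memA_block A_con).
apply: memA_eq => x y sx sy; apply: eq_wsum => s ss; apply: eq_wsum => t st.
have s1 : size (take k x) = k by rewrite size_takel // sx leq_addr.
have s2 : size (take l y) = l by rewrite size_takel // sy leq_addr.
have s3 : size (take k x ++ s) = (k + l')%N by rewrite size_cat s1 ss.
rewrite (catA (take k x)) (take_size_cat _ s3) (drop_size_cat _ s3) -catA.
by rewrite (take_size_cat _ s2) (drop_size_cat _ s2).
Qed.

(** Distinct pairs of bidegrees may give tensors of the same bidegree, but the
    corresponding blocks of matrices are orthogonal. *)
Definition word_matrices_kernel (i j : 'I_N * 'I_N) : C :=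
  if [&& size (vwd i.1) == size (vwd j.1), size (dwd i.1) == size (dwd j.1),
         size (vwd i.2) == size (vwd j.2) & size (dwd i.2) == size (dwd j.2)]
  then K (vwd i.1 ++ rev (dwd i.2)) (dwd i.1 ++ rev (vwd i.2))
         (vwd j.1 ++ rev (dwd j.2)) (dwd j.1 ++ rev (vwd j.2))
  else 0.
Local Notation Q := word_matrices_kernel.

Lemma word_matrices_kernelP : proj_kernel [set f | B (fun_mx f)]%classic Q.
Proof.
split.
- move=> i k l k' l' kD lD k'D l'D.
  have [/and4P[/eqP e1 /eqP e2 /eqP e3 /eqP e4]|ne] := boolP [&& size (vwd i.1) == k, size (dwd i.1) == l,
         size (vwd i.2) == k' & size (dwd i.2) == l'].
    have := wkernel_row (ker_wordsP A_alg (k + l') (l + k'))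
      (v := vwd i.1 ++ rev (dwd i.2)) (d := dwd i.1 ++ rev (vwd i.2)).
    rewrite !size_cat !size_rev e1 e2 e3 e4 => /(_ erefl erefl).
    apply: memA_eq => x y sx sy.
    have s1 : size (take k x) = k by rewrite size_takel // sx leq_addr.
    have s2 : size (take l y) = l by rewrite size_takel // sy leq_addr.
    have s3 : size (drop k x) = l' by rewrite size_drop sx addKn.
    have s4 : size (drop l y) = k' by rewrite size_drop sy addKn.
    rewrite /block mxE /Q /= !vwd_rk ?size_rev ?s1 ?s4 // !dwd_rk ?size_rev ?s2 ?s3 //.
    by rewrite ?size_rev ?s1 ?s2 ?s3 ?s4 e1 e2 e3 e4 !eqxx /= !revK !cat_take_drop.
  apply: memA_eq (memA0 A_alg _ _) => x y sx sy.
  have s1 : size (take k x) = k by rewrite size_takel // sx leq_addr.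
  have s2 : size (take l y) = l by rewrite size_takel // sy leq_addr.
  have s3 : size (drop k x) = l' by rewrite size_drop sx addKn.
  have s4 : size (drop l y) = k' by rewrite size_drop sy addKn.
  rewrite /block mxE /Q /= !vwd_rk ?size_rev ?s1 ?s4 // !dwd_rk ?size_rev ?s2 ?s3 //.
  by rewrite ?size_rev ?s1 ?s2 ?s3 ?s4 (negbTE ne).
- move=> f /= Bf [s' t'].
  pose k := size (vwd s'); pose l := size (dwd s').
  pose k' := size (vwd t'); pose l' := size (dwd t').
  have kD : (k <= D)%N := size_vwd s'. have lD : (l <= D)%N := size_dwd s'.
  have k'D : (k' <= D)%N := size_vwd t'. have l'D : (l' <= D)%N := size_dwd t'.
  have := wkernel_rep (ker_wordsP A_alg (k + l') (l + k')) (Bf k l k' l' kD lD k'D l'D)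
    (v := vwd s' ++ rev (dwd t')) (d := dwd s' ++ rev (vwd t')).
  rewrite !size_cat !size_rev => /(_ erefl erefl).
  rewrite block_cat // !revK !rkK mxE => <-.
  transitivity (\sum_s \sum_t f (s, t) * Q (s, t) (s', t')).
    by rewrite pair_big; apply: eq_bigr => -[].
  rewrite (sum_rk_pick kD lD); last first.
    move=> i ne; apply: big1 => t _; rewrite /Q /=.
    by rewrite (andbA (size (vwd i) == _)) ne mulr0.
  rewrite wsum_cat; apply: eq_wsum => v sv.
  rewrite [RHS]wsum_exchange wsum_cat; apply: eq_wsum => d sd.
  rewrite (sum_rk_pick k'D l'D); last first.
    by move=> i ne; rewrite /Q /= ne !andbF mulr0.
  rewrite [RHS]wsum_rev; apply: eq_wsum => v' sv'.
  rewrite [RHS]wsum_rev; apply: eq_wsum => d' sd'.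
  rewrite block_cat // !revK mxE /Q /=.
  rewrite !vwd_rk ?sv ?sv' // !dwd_rk ?sd ?sd' //.
  by rewrite !eqxx.
- move=> i j; rewrite /Q; case: ifP => [/and4P[/eqP e1 /eqP e2 /eqP e3 /eqP e4]|ne].
    rewrite e1 e2 e3 e4 !eqxx /=.
    by apply: (wkernel_herm (ker_wordsP A_alg _ _) (erefl _) (erefl _)); rewrite !size_cat !size_rev ?e1 ?e2 ?e3 ?e4.
  case: ifP => [/and4P[/eqP e1 /eqP e2 /eqP e3 /eqP e4]|]; last by rewrite rmorph0.
  by move: ne; rewrite e1 e2 e3 e4 !eqxx.
Qed.

(** With [a j] and [b j] the words [(va j, da j)] and [(vb j, db j)], this is the
    complete positivity of the projection on the star-algebra [word_matrices],
    for the matrix [\sum_j c j e_(a j, b j)]. *)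
Lemma ker_words_positive (J : Type) (r : seq J) (c : J -> C) (va da vb db : J -> word) :
  (forall j, size (va j) = size (vb j)) -> (forall j, size (da j) = size (db j)) ->
  (forall j, size (va j) <= D)%N -> (forall j, size (da j) <= D)%N ->
  0 <= \sum_(j <- r) \sum_(j' <- r) (c j)^* * c j' *
    K (va j' ++ rev (da j)) (da j' ++ rev (va j)) (vb j' ++ rev (db j)) (db j' ++ rev (vb j)).
Proof.
move=> sv sd vD dD.
have vD' j : (size (vb j) <= D)%N by rewrite -sv.
have dD' j : (size (db j) <= D)%N by rewrite -sd.
pose a j := rk (va j) (da j); pose b j := rk (vb j) (db j).
pose X : 'M[C]_N := \sum_(j <- r) c j *: delta_mx (a j) (b j).
have pick (Y : 'I_N -> 'I_N -> C) p q : \sum_i \sum_j delta_mx p q i j * Y i j = Y p q.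
  rewrite (bigD1 p) //= (bigD1 q) //= mxE !eqxx mul1r !big1 ?addr0 // => i ni.
    by apply: big1 => j _; rewrite mxE (negbTE ni) mul0r.
  by rewrite mxE (negbTE ni) andbF mul0r.
have XE i j : X i j = \sum_(k <- r) c k * delta_mx (a k) (b k) i j.
  by rewrite summxE; apply: eq_bigr => k _; rewrite mxE.
have sumX (Y : 'I_N -> 'I_N -> C) :
    \sum_i \sum_j X i j * Y i j = \sum_(k <- r) c k * Y (a k) (b k).
  transitivity (\sum_i \sum_j \sum_(k <- r) c k * (delta_mx (a k) (b k) i j * Y i j)).
    apply: eq_bigr => i _; apply: eq_bigr => j _.
    by rewrite XE mulr_suml; apply: eq_bigr => k _; rewrite mulrA.
  under eq_bigr do rewrite exchange_big /=.
  rewrite exchange_big; apply: eq_bigr => k _ /=.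
  under eq_bigr do rewrite -mulr_sumr.
  by rewrite -mulr_sumr pick.
have sumXc (Y : 'I_N -> 'I_N -> C) :
    \sum_i \sum_j (X i j)^* * Y i j = \sum_(k <- r) (c k)^* * Y (a k) (b k).
  rewrite -[LHS]conjCK rmorph_sum.
  under eq_bigr => i _.
    rewrite rmorph_sum; under eq_bigr => j _ do rewrite rmorphM /= conjCK; over.
  rewrite (sumX (fun i j => (Y i j)^* )) rmorph_sum; apply: eq_bigr => k _.
  by rewrite rmorphM /= conjCK.
have := kernel_cp word_matrices_lin word_matrices0 word_matrices_mul word_matrices_adj
  X word_matrices_kernelP.
congr (0 <= _).
transitivity (\sum_a \sum_b (X a b)^* * \sum_a' \sum_b' X a' b' * Q (a', a) (b', b)).
  apply: eq_bigr => i _; apply: eq_bigr => j _.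
  rewrite mulr_sumr; apply: eq_bigr => i' _.
  by rewrite mulr_sumr; apply: eq_bigr => j' _; rewrite mulrA.
rewrite sumXc; apply: eq_bigr => j _.
rewrite sumX mulr_sumr; apply: eq_bigr => j' _.
rewrite mulrA; congr (_ * _).
rewrite /Q /= !vwd_rk // !dwd_rk //.
by rewrite !sv !sd !eqxx.
Qed.

End MatrixAlgebra.

(** * The identity tensor *)

Section ActionCoordinates.
Variables (C : numClosedFieldType) (n : nat).
Local Notation T := (mtens C n).
Local Notation word := (seq 'I_n).
Implicit Types (F G : word -> word -> C) (z : T) (U : 'M[C]_n).

Definition wcoef U (v w : word) : C := \prod_(p <- zip v w) U p.1 p.2.

Lemma wcoef_cons U x v y w : wcoef U (x :: v) (y :: w) = U x y * wcoef U v w.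
Proof. by rewrite /wcoef /= big_cons. Qed.

Lemma prod_vec U w : \prod_(i <- w) vec (col i U) =
  wsum (size w) (fun v => wcoef U v w *: (<< MWord v [::] >> : T)).
Proof.
elim: w => [|y w IH] /=; first by rewrite !big_nil /wcoef /= big_nil scale1r.
rewrite big_cons IH /vec mulr_suml; apply: eq_bigr => x _.
rewrite wsum_mull; apply: eq_wsum => v sv.
rewrite mtens_mulZr -(scalerAl (col y U x 0)) malgUM scalerA wcoef_cons mxE mulrC.
by congr (_ *: _).
Qed.

Lemma prod_covec U w : \prod_(i <- w) covec (col i U) =
  wsum (size w) (fun v => wcoef U v w *: (<< MWord [::] v >> : T)).
Proof.
elim: w => [|y w IH] /=; first by rewrite !big_nil /wcoef /= big_nil scale1r.
rewrite big_cons IH /covec mulr_suml; apply: eq_bigr => x _.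
rewrite wsum_mull; apply: eq_wsum => v sv.
rewrite mtens_mulZr -(scalerAl (col y U x 0)) malgUM scalerA wcoef_cons mxE mulrC.
by congr (_ *: _).
Qed.

Lemma prod_vec_covec U U' w e :
  (\prod_(i <- w) vec (col i U)) * (\prod_(j <- e) covec (col j U')) =
  tens (size w) (size e) (fun v d => wcoef U v w * wcoef U' d e).
Proof.
rewrite prod_vec prod_covec wsum_mulr; apply: eq_wsum => v _.
rewrite wsum_mull; apply: eq_wsum => d _.
rewrite mtens_mulZr -(scalerAl (wcoef U v w)) malgUM scalerA mulrC.
by congr (_ *: << _ >>); rewrite /= /mmul /= /mwordM /= cats0.
Qed.

Lemma mtact_coords U z v d : coords (mtact U z) v d =
  wsum (size v) (fun w => wsum (size d) (fun e =>
    coords z w e * (wcoef U v w * wcoef (invmx U^T) d e))).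
Proof.
rewrite /coords.
elim/mtens_ind: z => [x y hx hy|c x hx|[w0 e0]|].
- rewrite mtactD mcoeffD hx hy -wsumD; apply: eq_wsum => w _.
  by rewrite -wsumD; apply: eq_wsum => e _; rewrite mcoeffD mulrDl.
- rewrite mtactZ mcoeffZ hx wsum_mull; apply: eq_wsum => w _.
  by rewrite wsum_mull; apply: eq_wsum => e _; rewrite mcoeffZ -mulrA.
- rewrite mtactU /act_word prod_vec_covec tensE.
  transitivity (wsum (size v) (fun w => if w == w0 then (if size e0 == size d then
     wcoef U v w * wcoef (invmx U^T) d e0 else 0) else 0)).
    by rewrite wsum_pick (eq_sym (size w0)) (eq_sym (size e0)); case: (_ == size w0); case: (_ == size e0).
  apply: eq_wsum => w _.
  transitivity (wsum (size d) (fun e => if e == e0 then (if w == w0 then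
     wcoef U v w * wcoef (invmx U^T) d e else 0) else 0)).
    by rewrite wsum_pick; case: (w == w0); case: (_ == size d).
  apply: eq_wsum => e _; rewrite mcoeffU1 mword_eqE (eq_sym w0) (eq_sym e0).
  by case: (e == e0); case: (w == w0); rewrite /= ?mul1r ?mul0r.
- rewrite mtact0 mcoeff0 -[LHS](wsum_zero n C (size v)); apply: eq_wsum => w _.
  by rewrite -[LHS](wsum_zero n C (size d)); apply: eq_wsum => e _; rewrite mcoeff0 mul0r.
Qed.

End ActionCoordinates.

Section LinSpan.
Variables (C : numClosedFieldType) (n : nat).
Local Notation T := (mtens C n).
Implicit Types (S : set T).

Lemma lin_spanD S x y : lin_span S x -> lin_span S y -> lin_span S (x + y).
Proof.
move=> [m [c [f [Sf ->]]]] [m' [c' [f' [Sf' ->]]]].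
exists (m + m')%N.
exists (fun i => match split i with inl j => c j | inr j => c' j end).
exists (fun i => match split i with inl j => f j | inr j => f' j end).
split; first by move=> i; case: split.
rewrite big_split_ord /=; congr (_ + _); apply: eq_bigr => i _.
  by have -> : split (lshift m' i) = inl i by exact: (unsplitK (inl i)).
by have -> : split (rshift m i) = inr i by exact: (unsplitK (inr i)).
Qed.

Lemma lin_span1 S x : S x -> lin_span S x.
Proof.
by move=> Sx; exists 1%N, (fun=> 1), (fun=> x); split=> //; rewrite big_ord1 scale1r.
Qed.

Lemma lin_span0 S : lin_span S 0.
Proof. by exists 0%N, (fun=> 0), (fun=> 0); split; [case|rewrite big_ord0]. Qed.

Lemma lin_spanZ S c x : lin_span S x -> lin_span S (c *: x).
Proof.
move=> [m [d [f [Sf ->]]]]; exists m, (fun i => c * d i), f; split=> //.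
by rewrite scaler_sumr; apply: eq_bigr => i _; rewrite scalerA.
Qed.

Lemma lin_span_wsum S k (F : seq 'I_n -> T) : (forall v, lin_span S (F v)) ->
  lin_span S (wsum k F).
Proof.
elim: k F => [|k IH] F SF /=; first exact: SF.
by elim/big_ind: _ => //; [exact: lin_span0|exact: lin_spanD|move=> x _; exact: IH].
Qed.

Lemma lin_span_sum S (J : Type) (r : seq J) (F : J -> T) : (forall v, lin_span S (F v)) ->
  lin_span S (\sum_(j <- r) F j).
Proof.
by move=> SF; elim/big_ind: _ => //; [exact: lin_span0|exact: lin_spanD].
Qed.

End LinSpan.

Section UnitInA.
Variables (C : numClosedFieldType) (n : nat) (A : set (mtens C n)).
Local Notation T := (mtens C n).
Local Notation word := (seq 'I_n).
Local Notation memA := (memA A).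
Implicit Types (F G : word -> word -> C).
Hypotheses (A_alg : subalgebra A) (A_gr : graded A).
Hypotheses (A_star : star_closed A) (A_con : contraction_closed A).
Import spectral.
Local Open Scope sesquilinear_scope.

Definition mxw (M : 'M[C]_n) (v d : word) : C :=
  if v is i :: _ then if d is j :: _ then M i j else 0 else 0.

(** The tensors of bidegree (1, 1) in [A], as matrices; contraction makes them a
    star-algebra. *)
Definition A11 : set 'M[C]_n := fun M => memA 1 1 (mxw M).

Lemma A11_lin c X Y : A11 X -> A11 Y -> A11 (c *: X + Y).
Proof.
move=> AX AY; apply: memA_eq (memA_lin A_alg c AX AY) => -[|i []] // [|j []] // _ _.
by rewrite /= !mxE.
Qed.

Lemma A11_0 : A11 0.
Proof. by apply: memA_eq (memA0 A_alg 1 1) => -[|i []] // [|j []] // _ _; rewrite /= mxE. Qed.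

Lemma A11_mul X Y : A11 X -> A11 Y -> A11 (X *m Y).
Proof.
move=> AX AY; have := memA_mul A_alg AX AY.
move/(memA_contract A_con (i := 1) (j := 0)) => /(_ isT isT).
apply: memA_eq => -[|i []] // [|j []] // _ _.
by rewrite /= mxE.
Qed.

Lemma A11_adj X : A11 X -> A11 (X^t*).
Proof.
move/(memA_star A_star); apply: memA_eq => -[|i []] // [|j []] // _ _.
by rewrite /= !mxE.
Qed.

(** [P] is the projection of the identity matrix on [A11]. For [Y] in [A11] the
    matrix [(1 - P) Y] is in [A11], and it is orthogonal to [A11] as [1 - P] is;
    so it vanishes. *)
Lemma A11_projector : exists P : 'M[C]_n,
  [/\ A11 P, P^t* = P, P *m P = P & forall Y, A11 Y -> P *m Y = Y].
Proof.
have [m [b /orthobasis_mxbasis bB]] := orthobasis_exists (mx_subspace A11_0 A11_lin).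
set e := fun k => _ in bB.
pose P := \sum_k hs 1%:M (e k) *: e k.
have AP : A11 P.
  rewrite /P; elim/big_ind: _ => //; first exact: A11_0.
    by move=> X Y AX AY; rewrite -[X]scale1r; exact: A11_lin.
  by move=> k _; rewrite -[_ *: _]addr0; apply: A11_lin; [exact: (mxbasis_mem bB)|exact: A11_0].
have perp Y : A11 Y -> hs (1%:M - P) Y = 0.
  move=> AY; rewrite (mxbasis_rep bB AY) hs_sumr big1 // => k _.
  rewrite hsZr hsDl hsNl hs_suml (bigD1 k) //= big1 => [|l lk].
    by rewrite hsZl (mxbasis_dot bB) eqxx mulr1 addr0 subrr mulr0.
  by rewrite hsZl (mxbasis_dot bB) (negbTE lk) mulr0.
have P1 Y : A11 Y -> P *m Y = Y.
  move=> AY; apply/esym/eqP; rewrite -subr_eq0; apply/eqP/hs_eq0.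
  have AZ : A11 (Y - P *m Y).
    by rewrite addrC -scaleN1r; apply: A11_lin => //; exact: A11_mul.
  have {1}-> : Y - P *m Y = (1%:M - P) *m Y by rewrite mulmxBl mul1mx.
  transitivity (hs (1%:M - P) ((Y - P *m Y) *m Y^t*)).
    by rewrite /hs adjM trmxCK mulmxA.
  by apply/perp/A11_mul => //; exact: A11_adj.
have PP := P1 _ (A11_adj AP).
exists P; split=> //; [|exact: P1].
by rewrite -{1}[P in RHS]trmxCK -[in RHS]PP adjM trmxCK PP.
Qed.


Lemma wsum_ge0_eq0 k (F : word -> C) : (forall v, 0 <= F v) -> wsum k F = 0 ->
  forall v, size v = k -> F v = 0.
Proof.
move=> F0; rewrite wsum_tuple => /eqP; rewrite psumr_eq0 // => /allP F00 v sv.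
by have /= /eqP := F00 (Tuple (introT eqP sv)) (mem_index_enum _).
Qed.

Lemma wsum_ge0 k (F : word -> C) : (forall v, 0 <= F v) -> 0 <= wsum k F.
Proof. by move=> F0; rewrite wsum_tuple sumr_ge0. Qed.

(** The Gram matrix of [F] seen as a linear map out of its [i]-th leg. *)
Definition leg_gram k l i F : 'M[C]_n := \matrix_(p, p')
  wsum k (fun v => wsum l (fun d => F (ins i p v) d * (F (ins i p' v) d)^* )).

(** The Gram matrix is the contraction of [F F^* ] along all legs but one: the
    dual legs, then the legs of [V] before and after the [i]-th one. *)
Lemma leg_gramP k l i F : (i <= k)%N -> memA k.+1 l F -> A11 (leg_gram k l i F).
Proof.
move=> ik AF.
have := memA_mul A_alg AF (memA_star A_star AF).
set G := fun v d => _ => AG.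
have AG1 : memA (k.+1 + l + 0) (0 + l + k.+1) G by rewrite addn0.
have := memA_block A_con AG1; rewrite addn0 add0n.
set G1 := fun v d => _ => AG2.
have AG2' : memA (0 + i + (1 + (k - i))) (((k - i) + 1) + i + 0) G1.
  by move: AG2; congr memA; lia.
have := memA_block A_con AG2'; rewrite add0n addn0.
set G2 := fun v d => _ => AG3.
have AG3' : memA (1 + (k - i) + 0) (0 + (k - i) + 1) G2 by rewrite addn0.
have := memA_block A_con AG3'; rewrite addn0 add0n.
set G3 := fun v d => _ => AG4.
apply: memA_eq AG4 => -[|p []] // [|q []] // _ _.
rewrite /G3 /= mxE -[in RHS](subnKC ik) wsum_cat [RHS]wsum_exchange.
apply: eq_wsum => v2 sv2; rewrite /G2 !take0 !drop0 /=; apply: eq_wsum => v1 sv1.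
have s1 : size (v1 ++ p :: v2) = k.+1 by rewrite size_cat /= sv1 sv2 addnS subnKC.
have s2 : size (rev v2 ++ [:: q]) = (k - i + 1)%N by rewrite size_cat size_rev sv2.
rewrite cats0 -s2 take_size drop_size cats0 /G1 [RHS]wsum_rev.
rewrite -[X in take X _]s1 -[X in drop X _]s1 take_size drop_size.
apply: eq_wsum => t st; rewrite take0 drop0 cats0 /=.
rewrite /G (take_size_cat _ s1) (drop_size_cat _ s1).
rewrite take_size_cat ?size_rev // drop_size_cat ?size_rev // -catA rev_cat revK rev_cat revK.
by rewrite /ins !(take_size_cat _ sv1) !(drop_size_cat _ sv1) -catA.
Qed.

(** If [N = 1 - P] kills the Gram matrix of a leg, then [N] kills the leg: the
    squared norm of its image is a diagonal entry of [N M N^* ]. *)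
Lemma leg_projected P k l i F : P^t* = P -> P *m P = P ->
  (forall Y, A11 Y -> P *m Y = Y) -> (i <= k)%N -> memA k.+1 l F ->
  forall p v d, size v = k -> size d = l ->
  F (ins i p v) d = \sum_q P p q * F (ins i q v) d.
Proof.
move=> Pa PP P1 ik AF p v d sv sd.
pose N := 1%:M - P; pose R v d := \sum_q N p q * F (ins i q v) d.
suff : R v d = 0.
  have -> : R v d = F (ins i p v) d - \sum_q P p q * F (ins i q v) d.
    rewrite /R; under eq_bigr => q _ do rewrite !mxE mulrBl.
    rewrite sumrB; congr (_ - _); rewrite (bigD1 p) //= eqxx mul1r big1 ?addr0 // => q qp.
    by rewrite eq_sym (negbTE qp) mul0r.
  by move/eqP; rewrite subr_eq0 => /eqP.
have NM : N *m leg_gram k l i F = 0.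
  by rewrite mulmxBl mul1mx P1 ?subrr //; exact: leg_gramP.
have sq0 : wsum k (fun v => wsum l (fun d => R v d * (R v d)^* )) = 0.
  transitivity (\sum_q' (N *m leg_gram k l i F) p q' * (N p q')^* ); last first.
    by rewrite NM big1 // => q' _; rewrite mxE mul0r.
  under [RHS]eq_bigr => q' _.
    rewrite mxE mulr_suml.
    under eq_bigr => q _.
      rewrite [leg_gram _ _ _ _ _ _]mxE -mulrA wsum_mulr wsum_mull.
      under eq_wsum => u _ do rewrite wsum_mulr wsum_mull.
      over.
    rewrite -wsum_sum; under eq_wsum => u _ do rewrite -wsum_sum.
    over.
  rewrite /=.
  rewrite -wsum_sum; apply: eq_wsum => u _; rewrite -wsum_sum; apply: eq_wsum => e _.
  rewrite /R rmorph_sum mulr_sumr; apply: eq_bigr => q' _.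
  rewrite mulr_suml; apply: eq_bigr => q _.
  by rewrite rmorphM /=; ring.
have := wsum_ge0_eq0 (fun u => wsum_ge0 _ (fun e => mul_conjC_ge0 _)) sq0 sv.
move/(wsum_ge0_eq0 (fun e => mul_conjC_ge0 _)) => /(_ _ sd) /eqP.
by rewrite mul_conjC_eq0 => /eqP.
Qed.

Lemma legs_projected (P : 'M[C]_n) k (F : word -> C) :
  (forall i p v, (i < k)%N -> (size v).+1 = k -> F (ins i p v) = \sum_q P p q * F (ins i q v)) ->
  forall v, size v = k -> F v = wsum k (fun w => wcoef P v w * F w).
Proof.
elim: k F => [|k IH] F HF v sv.
  by move/size0nil: sv => ->; rewrite /= /wcoef big_nil mul1r.
case: v sv => // x v [sv].
have e0 y u : F (y :: u) = F (ins 0 y u) by rewrite /ins take0 drop0.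
rewrite e0 HF ?sv //=; apply: eq_bigr => y _.
rewrite -e0 (IH (fun u => F (y :: u))) // => [|i p u ik su].
  by rewrite wsum_mull; apply: eq_wsum => w _; rewrite wcoef_cons mulrA.
have := HF i.+1 p (y :: u) ik; rewrite /= su => /(_ erefl).
by rewrite /ins.
Qed.

Lemma rev_ins i p (v : word) : (i <= size v)%N ->
  rev (ins i p v) = ins (size v - i) p (rev v).
Proof.
by move=> iv; rewrite /ins rev_cat rev_cons cat_rcons take_rev drop_rev subKn.
Qed.

Lemma tens_projected P k l F : P^t* = P -> P *m P = P ->
  (forall Y, A11 Y -> P *m Y = Y) -> memA k l F ->
  tens k l F = wsum k (fun w => wsum l (fun e => F w e *:
    ((\prod_(i <- w) vec (col i P)) * (\prod_(j <- e) covec (col j (map_mx Num.conj P)))))).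
Proof.
move=> Pa PP P1 AF.
have FV v d : size v = k -> size d = l -> F v d = wsum k (fun w => wcoef P v w * F w d).
  move=> sv sd; apply: (@legs_projected P k (fun v => F v d)) => // i p u ik su.
  case: k su ik AF {sv} => // k [su] ik AF.
  exact: (leg_projected Pa PP P1 (ik : i <= k)%N AF p su sd).
have FD v d : size v = k -> size d = l ->
    F v d = wsum l (fun e => wcoef (map_mx Num.conj P) d e * F v e).
  move=> sv sd; apply: (@legs_projected (map_mx Num.conj P) l (F v)) => // i p u il su.
  have AF' := memA_star A_star AF.
  case: l su il AF' {sd AF FV} => // l [su] il AF'.
  have := leg_projected Pa PP P1 (leq_subr i l) AF' p (v := rev u) (d := rev v).
  rewrite !size_rev su => /(_ erefl sv) /(congr1 Num.conj).
  rewrite conjCK revK rev_ins ?size_rev ?su ?leq_subr // subKn // revK => ->.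
  rewrite rmorph_sum; apply: eq_bigr => q _.
  rewrite rmorphM /= conjCK ?revK rev_ins ?size_rev ?su ?leq_subr // subKn // ?revK.
  by rewrite mxE.
transitivity (tens k l (fun v d => wsum k (fun w => wsum l (fun e =>
   F w e * (wcoef P v w * wcoef (map_mx Num.conj P) d e))))).
  apply: eq_tens => v d sv sd; rewrite FV //; apply: eq_wsum => w sw.
  rewrite (FD w) // wsum_mull; apply: eq_wsum => e _; ring.
rewrite /tens; under [LHS]eq_wsum => v _.
  under eq_wsum => d _.
    rewrite (wsum_morph (f := fun c => c *: _)); [|by move=> x y; rewrite scalerDl|by rewrite scale0r].
    under eq_wsum => w _.
      rewrite (wsum_morph (f := fun c => c *: _)); [|by move=> x y; rewrite scalerDl|by rewrite scale0r].
      over.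
    over.
  rewrite wsum_exchange; under eq_wsum => w _ do rewrite wsum_exchange.
  over.
rewrite wsum_exchange; apply: eq_wsum => w sw; rewrite wsum_exchange; apply: eq_wsum => e se.
rewrite prod_vec_covec sw se /tens.
have sc m (G : word -> T) : F w e *: wsum m G = wsum m (fun v => F w e *: G v).
  by apply: wsum_morph => [x y|]; rewrite ?scalerDr ?scaler0.
rewrite sc; apply: eq_wsum => v _; rewrite sc; apply: eq_wsum => d _.
by rewrite scalerA.
Qed.

(** As the projector [P] fixes all legs of the tensors of [A], these are mixed
    tensors over the range of [P], which by nondegeneracy is the whole space. *)
Lemma delta_mem : nondegenerate_subset A -> memA 1 1 (delta C (n := n)).
Proof.
move=> ndA; have [P [AP Pa PP P1]] := A11_projector.
have [P_id|P_n1] := eqVneq P 1%:M.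
  have AP' : memA 1 1 (mxw P) := AP.
  apply: memA_eq AP' => -[|i []] // [|j []] // _ _.
  by rewrite P_id /= /delta mxE eqseq_cons andbT.
case: ndA; pose f : {linear 'cV[C]_n -> 'cV[C]_n} := mulmx (1%:M - P).
pose W := lker (linfun f).
have WP v : (v \in W) = (P *m v == v).
  by rewrite memv_ker lfunE /= mulmxBl mul1mx subr_eq0 eq_sym.
exists W; split.
  apply: contraNneq P_n1 => Wf; apply/eqP/matrixP => i j.
  have : delta_mx j 0 \in W by rewrite Wf memvf.
  rewrite WP => /eqP /(congr1 (fun M : 'cV_n => M i 0)).
  by rewrite -colE !mxE ?eqxx ?andbT => ->; rewrite ?andbT ?mulr1n.
move=> a Aa; rewrite (sum_components (ltnSn (word_bound a))).
apply: lin_span_sum => k; apply: lin_span_sum => l.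
rewrite (tens_projected Pa PP P1 (memA_coords A_alg A_gr k l Aa)).
apply: lin_span_wsum => w; apply: lin_span_wsum => e.
apply/lin_spanZ/lin_span1.
have PW i : col i P \in W by rewrite WP colE mulmxA PP.
exists (\prod_(i <- w) vec (col i P)), (\prod_(j <- e) covec (col j (map_mx Num.conj P))); split=> //.
  apply: lin_span1; exists [seq vec (col i P) | i <- w]; last by rewrite big_map.
  by move=> x /mapP[i _ ->]; exists (col i P) => //; exact: PW.
apply: lin_span1; exists [seq covec (col j (map_mx Num.conj P)) | j <- e]; last by rewrite big_map.
move=> x /mapP[j _ ->]; exists (vec (col j P)); first by exists (col j P) => //; exact: PW.
rewrite /vec /covec (big_morph _ (@mtstarD C n) (@mtstar0 C n)).
by apply: eq_bigr => i _; rewrite mtstarZ mtstar_ebasis !mxE.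
Qed.

End UnitInA.

(** * The coordinate ring of the unitary group and its state *)

Lemma mul_scalarsA (R : comNzRingType) (a b c d : R) : a * b * (c * d) = a * (c * (b * d)).
Proof. by ring. Qed.

Lemma mul_scalarsC (R : comNzRingType) (a b c d : R) : a * b * (c * d) = c * a * (b * d).
Proof. by ring. Qed.

Section CommutativeMonomials.
Variable I : choiceType.

Definition mon (s : seq I) : cmonom I := \big[mmul/mone]_(i <- s) ucm i.

Lemma monE s i : mon s i = count_mem i s.
Proof.
elim: s => [|j s IH]; first by rewrite /mon big_nil cm1.
by rewrite /mon big_cons cmM cmU -/(mon s) IH.
Qed.

Definition letters (m : cmonom I) : seq I :=
  flatten [seq nseq (m i) i | i <- finsupp m].

Lemma count_letters m i : count_mem i (letters m) = m i.
Proof.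
rewrite /letters count_flatten -map_comp sumnE big_map.
have [im|im] := boolP (i \in finsupp m); last first.
  rewrite big_seq big1 => [|j jm]; first by move: im; rewrite -cmE_eq0 => /eqP.
  by rewrite /= count_nseq /=; case: eqP jm im => // -> ->.
rewrite (bigD1_seq i) //= ?fset_uniq // count_nseq /= eqxx mul1n big1 ?addn0 // => j ji.
by rewrite count_nseq /= (negbTE ji).
Qed.

Lemma lettersK m : mon (letters m) = m.
Proof. by apply/eqP/cmP => i; rewrite monE count_letters. Qed.

Lemma perm_letters s : perm_eq (letters (mon s)) s.
Proof. by apply/allP => i _ /=; rewrite count_letters monE. Qed.

Lemma mon_cat s t : mon (s ++ t) = mmul (mon s) (mon t).
Proof. by rewrite /mon big_cat. Qed.

Lemma perm_lettersM m m' : perm_eq (letters (mmul m m')) (letters m ++ letters m').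
Proof. by rewrite -{1}(lettersK m) -{1}(lettersK m') -mon_cat perm_letters. Qed.

Lemma letters1 : letters mone = [::].
Proof. by rewrite /letters mdom1. Qed.
End CommutativeMonomials.

Section CoordinateRing.
Variables (C : numClosedFieldType) (n : nat).

(** Coordinates of a unitary matrix: [(false, (i, j))] stands for its entry at
    [(i, j)] and [(true, (i, j))] for the conjugate of that entry. *)
Definition letter := (bool * ('I_n * 'I_n))%type.
HB.instance Definition _ := Choice.on letter.

Definition bar (x : letter) : letter := (~~ x.1, x.2).

Lemma barK : involutive bar.
Proof. by case=> b p; rewrite /bar /= negbK. Qed.

Definition coord_ring := {malg C[cmonom letter]}.
HB.instance Definition _ := GRing.ComNzRing.on coord_ring.
Local Notation O := coord_ring.
Implicit Types (p q : O) (m : cmonom letter) (s t : seq letter).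

(* The constants, monomials and involution of the coordinate ring are locked:
   unification would otherwise unfold them down to finitely supported maps. *)
Definition coord_iota : {rmorphism C -> O} :=
  locked (@malgC (cmonom letter) C : {rmorphism C -> O}).
Local Notation iota := coord_iota.

Definition coord_mon s : O := locked << mon s >>.

Lemma coord_monE s : coord_mon s = << mon s >>.
Proof. by rewrite /coord_mon -lock. Qed.

Definition bar_mon m : O := coord_mon [seq bar x | x <- letters m].

Lemma mon_perm s t : perm_eq s t -> mon s = mon t.
Proof. by move=> /seq.permP st; apply/eqP/cmP => i; rewrite !monE st. Qed.

Lemma coord_mon_perm s t : perm_eq s t -> coord_mon s = coord_mon t.
Proof. by move=> st; rewrite !coord_monE (mon_perm st). Qed.

Lemma coord_mon_nil : coord_mon [::] = 1.
Proof. by rewrite coord_monE /mon big_nil. Qed.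

Lemma mulU m m' : << m >> * << m' >> = << mmul m m' >> :> O.
Proof. by rewrite malgM_def fgmulUU mulr1. Qed.

Lemma coord_mon_cat s t : coord_mon (s ++ t) = coord_mon s * coord_mon t.
Proof. by rewrite !coord_monE mon_cat mulU. Qed.

Lemma bar_mon_mmorphism : mmorphism bar_mon.
Proof.
split=> [m m'|]; last by rewrite /bar_mon letters1 coord_mon_nil.
rewrite /bar_mon -coord_mon_cat -map_cat.
by apply: coord_mon_perm; apply: perm_map; exact: perm_lettersM.
Qed.
HB.instance Definition _ :=
  monalg.isMultiplicative.Build (cmonom letter) O bar_mon bar_mon_mmorphism.

Definition coord_star : {rmorphism O -> O} :=
  locked (mmap (iota \o Num.conj) bar_mon : {rmorphism O -> O}).
Local Notation sg := coord_star.

Lemma coord_iotaM c p : iota c * p = c *: p.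
Proof. by rewrite /coord_iota -lock; exact: mul_malgC. Qed.

Lemma coord_sum p : p = \sum_(m <- msupp p) iota p@_m * coord_mon (letters m).
Proof.
rewrite {1}[p]monalgE; apply: eq_bigr => m _.
rewrite coord_iotaM coord_monE lettersK; apply/malgP => k.
by rewrite mcoeffU mcoeffZ mcoeffU mulr_natr.
Qed.

Lemma coord_star_iota c : sg (iota c) = iota c^*.
Proof.
rewrite /coord_star -lock /=; have {1}-> : iota c = c%:MP by rewrite /coord_iota -lock.
by rewrite mmapC.
Qed.

Lemma coord_star_mon s : sg (coord_mon s) = coord_mon [seq bar x | x <- s].
Proof.
rewrite /coord_star -lock /= {1}coord_monE mmapU /= !rmorph1 mul1r.
by apply/coord_mon_perm/perm_map/perm_letters.
Qed.

Lemma coord_star_scale c p : sg (iota c * p) = iota c^* * sg p.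
Proof. by rewrite (rmorphM sg) coord_star_iota. Qed.

Lemma coord_starK : involutive sg.
Proof.
move=> p; transitivity (\sum_(m <- msupp p) iota p@_m * coord_mon (letters m)); last first.
  exact/esym/coord_sum.
rewrite {1}(coord_sum p) !rmorph_sum; apply: eq_bigr => m _.
rewrite !coord_star_scale conjCK !coord_star_mon -map_comp map_id_in // => x _.
exact: barK.
Qed.

Definition coord_var (x : letter) : O := coord_mon [:: x].

Lemma coord_mon_prod s : coord_mon s = \prod_(x <- s) coord_var x.
Proof.
elim: s => [|x s IH]; first by rewrite big_nil coord_mon_nil.
by rewrite big_cons -IH /coord_var -coord_mon_cat.
Qed.

Lemma coord_star_var x : sg (coord_var x) = coord_var (bar x).
Proof. exact: coord_star_mon. Qed.

Section Functional.
Variable f : seq letter -> C.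
Hypothesis f_perm : forall s t, perm_eq s t -> f s = f t.

Definition functional p : C := mmap idfun (fun m => f (letters m)) p.

Lemma functionalD p q : functional (p + q) = functional p + functional q.
Proof. exact: mmapD. Qed.

Lemma functionalZ c p : functional (iota c * p) = c * functional p.
Proof.
rewrite coord_iotaM /functional (mmapEw (msuppZ_le c p)) mmapE mulr_sumr.
by apply: eq_bigr => m _; rewrite mcoeffZ /= mulrA.
Qed.

Lemma functional_mon s : functional (coord_mon s) = f s.
Proof.
rewrite /functional coord_monE mmapU /= mul1r; exact/f_perm/perm_letters.
Qed.

Lemma functional_sum (J : Type) (r : seq J) (F : J -> O) :
  functional (\sum_(j <- r) F j) = \sum_(j <- r) functional (F j).
Proof. by apply: (big_morph functional functionalD); exact: mmap0. Qed.

Lemma functional_star_mul p : functional (sg p * p) =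
  \sum_(m <- msupp p) \sum_(m' <- msupp p) (p@_m)^* * p@_m' *
     f ([seq bar x | x <- letters m] ++ letters m').
Proof.
rewrite [X in sg X * X]coord_sum.
rewrite rmorph_sum mulr_suml functional_sum; apply: eq_bigr => m _.
rewrite mulr_sumr functional_sum; apply: eq_bigr => m' _.
rewrite coord_star_scale coord_star_mon mul_scalarsA -coord_mon_cat.
by rewrite !functionalZ functional_mon mulrA.
Qed.

End Functional.
End CoordinateRing.

Section TannakaState.
Import spectral.
Local Open Scope sesquilinear_scope.
Variables (C : numClosedFieldType) (n : nat) (A : set (mtens C n)).
Local Notation T := (mtens C n).
Local Notation word := (seq 'I_n).
Local Notation memA := (memA A).
Implicit Types (F G : word -> word -> C).
Hypotheses (A_alg : subalgebra A) (A_gr : graded A).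
Hypotheses (A_star : star_closed A) (A_con : contraction_closed A).
Hypothesis A_delta : memA 1 1 (delta C (n := n)).
Local Notation K := (ker_words A_alg).
Local Notation O := (coord_ring C n).
Local Notation iota := (@coord_iota C n).
Local Notation sg := (@coord_star C n).
Local Notation letter := (letter n).

Definition plain (s : seq letter) := [seq x.2 | x <- s & ~~ x.1].
Definition barred (s : seq letter) := [seq x.2 | x <- s & x.1].

Definition ker_letters (s : seq letter) : C := ker_pairs A_alg (plain s) (barred s).

Lemma ker_letters_perm s t : perm_eq s t -> ker_letters s = ker_letters t.
Proof.
by move=> st; apply: ker_pairs_perm => //; apply: perm_map; exact: perm_filter.
Qed.

(** The state integrating over the group to be constructed: on matrix
    coefficients it is the orthogonal projection on [A]. *)
Definition state : O -> C := functional ker_letters.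

Lemma stateD p q : state (p + q) = state p + state q.
Proof. exact: functionalD. Qed.

Lemma stateZ c p : state (iota c * p) = c * state p.
Proof. exact: functionalZ. Qed.

Lemma state_mon s : state (@coord_mon C n s) = ker_letters s.
Proof. by apply: functional_mon; exact: ker_letters_perm. Qed.

Lemma state1 : state 1 = 1.
Proof.
have -> : (1 : O) = @coord_mon C n [::] by rewrite coord_mon_nil.
rewrite state_mon.
have A1 : memA 0 0 (fun _ _ => 1).
  have -> : memA 0 0 (fun _ _ => 1) = A (1 *: 1) by [].
  by apply: A_scale => //; exact: A_one.
have := wkernel_rep (ker_wordsP A_alg 0 0) A1 (v := [::]) (d := [::]) erefl erefl.
by rewrite /= mul1r.
Qed.

Lemma ker_letters_bar s t : ker_letters ([seq bar x | x <- s] ++ t) =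
  K (unzip2 (plain t) ++ rev (unzip2 (barred s))) (unzip2 (barred t) ++ rev (unzip2 (plain s)))
    (unzip1 (plain t) ++ rev (unzip1 (barred s))) (unzip1 (barred t) ++ rev (unzip1 (plain s))).
Proof.
have pl : plain ([seq bar x | x <- s] ++ t) = barred s ++ plain t.
  rewrite /plain filter_cat map_cat filter_map -map_comp; congr (_ ++ _).
  by congr map; apply: eq_filter => x /=; rewrite negbK.
have br : barred ([seq bar x | x <- s] ++ t) = plain s ++ barred t.
  by rewrite /barred filter_cat map_cat filter_map -map_comp.
rewrite /ker_letters pl br.
have cr (X : eqType) (u v : seq X) : perm_eq (u ++ v) (v ++ rev u).
  by rewrite perm_catC perm_cat2l perm_sym perm_rev.
rewrite (ker_pairs_perm A_alg A_star A_con A_delta (cr _ _ _) (cr _ _ _)).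
by rewrite /ker_pairs /unzip1 /unzip2 !map_cat !map_rev.
Qed.

Lemma state_ge0 p : 0 <= state (sg p * p).
Proof.
rewrite /state functional_star_mul; last exact: ker_letters_perm.
under eq_bigr do under eq_bigr do rewrite ker_letters_bar.
pose t := in_tuple (msupp p : seq (cmonom letter)).
pose D := \max_(i < size t) size (letters (tnth t i)).
rewrite big_tnth; under eq_bigr do rewrite big_tnth.
have szD i : (size (letters (tnth t i)) <= D)%N by exact: leq_bigmax.
apply: (ker_words_positive A_alg A_star A_con (D := D) _ (fun i => p@_(tnth t i))
  (va := fun i => unzip2 (plain (letters (tnth t i))))
  (da := fun i => unzip2 (barred (letters (tnth t i))))
  (vb := fun i => unzip1 (plain (letters (tnth t i))))
  (db := fun i => unzip1 (barred (letters (tnth t i))))) => i.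
- by rewrite !size_map.
- by rewrite !size_map.
- rewrite !size_map; apply: leq_trans (szD i); rewrite size_filter; exact: count_size.
- rewrite !size_map; apply: leq_trans (szD i); rewrite size_filter; exact: count_size.
Qed.

Definition coef_letters (v d w e : word) : seq letter :=
  [seq (false, (p.2, p.1)) | p <- zip v w] ++ [seq (true, (p.2, p.1)) | p <- zip d e].

Lemma plain_cat s t : plain (s ++ t) = plain s ++ plain t.
Proof. by rewrite /plain filter_cat map_cat. Qed.

Lemma barred_cat s t : barred (s ++ t) = barred s ++ barred t.
Proof. by rewrite /barred filter_cat map_cat. Qed.

Lemma plain_map b (X : Type) (f : X -> 'I_n * 'I_n) s :
  plain [seq (b, f x) | x <- s] = if b then [::] else map f s.
Proof. by rewrite /plain; case: b; elim: s => //= x s ->. Qed.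

Lemma barred_map b (X : Type) (f : X -> 'I_n * 'I_n) s :
  barred [seq (b, f x) | x <- s] = if b then map f s else [::].
Proof. by rewrite /barred; case: b; elim: s => //= x s ->. Qed.

Lemma plain_coef v d w e : plain (coef_letters v d w e) = [seq (p.2, p.1) | p <- zip v w].
Proof. by rewrite plain_cat !plain_map cats0. Qed.

Lemma barred_coef v d w e : barred (coef_letters v d w e) = [seq (p.2, p.1) | p <- zip d e].
Proof. by rewrite barred_cat !barred_map. Qed.

Lemma unzip2_flip (v w : word) : size v = size w ->
  unzip2 [seq (p.2, p.1) | p <- zip v w] = v.
Proof. by move=> vw; rewrite /unzip2 -map_comp; apply: unzip1_zip; rewrite vw. Qed.

Lemma unzip1_flip (v w : word) : size v = size w ->
  unzip1 [seq (p.2, p.1) | p <- zip v w] = w.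
Proof. by move=> vw; rewrite /unzip1 -map_comp; apply: unzip2_zip; rewrite vw. Qed.

(** The coefficient at the word [(w, e)] of the image of the tensor [F] under the
    generic unitary matrix. *)
Definition matrix_coef k l F w e : O :=
  wsum k (fun v => wsum l (fun d => iota (F v d) * @coord_mon C n (coef_letters v d w e))).

Lemma state_wsum k (F : word -> O) : state (wsum k F) = wsum k (fun v => state (F v)).
Proof. by apply: wsum_morph; [exact: stateD|exact: mmap0]. Qed.

Lemma state_coef k l F w e : size w = k -> size e = l ->
  state (matrix_coef k l F w e) = wsum k (fun v => wsum l (fun d => F v d * K v d w e)).
Proof.
move=> sw se; rewrite state_wsum; apply: eq_wsum => v sv.
rewrite state_wsum; apply: eq_wsum => d sd.
rewrite stateZ state_mon /ker_letters plain_coef barred_coef /ker_pairs.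
by rewrite !unzip2_flip ?unzip1_flip ?sv ?sd.
Qed.

Lemma state_coef_mem k l F w e : size w = k -> size e = l -> memA k l F ->
  state (matrix_coef k l F w e) = F w e.
Proof. by move=> sw se AF; rewrite state_coef // (wkernel_rep (ker_wordsP A_alg k l)). Qed.

Lemma sg_wsum k (F : word -> O) : sg (wsum k F) = wsum k (fun v => sg (F v)).
Proof. by apply: wsum_morph; [exact: rmorphD|exact: rmorph0]. Qed.

(** The product is a matrix coefficient of the tensor [F F^* ], which is in [A] and
    so is fixed by the projection. *)
Lemma state_coef_sq k l F w e : size w = k -> size e = l -> memA k l F ->
  state (sg (matrix_coef k l F w e) * matrix_coef k l F w e) = (F w e)^* * F w e.
Proof.
move=> sw se AF.
have AFF := memA_mul A_alg AF (memA_star A_star AF).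
have := wkernel_rep (ker_wordsP A_alg (k + l) (l + k)) AFF (v := w ++ rev e) (d := e ++ rev w).
rewrite !size_cat !size_rev sw se => /(_ erefl erefl).
rewrite !take_size_cat // !drop_size_cat // !revK mulrC => <-.
rewrite [RHS]wsum_cat {2}/matrix_coef wsum_mull state_wsum; apply: eq_wsum => v sv.
rewrite [RHS]wsum_exchange [RHS]wsum_cat wsum_mull state_wsum; apply: eq_wsum => d sd.
rewrite /matrix_coef sg_wsum wsum_mulr state_wsum [RHS]wsum_rev; apply: eq_wsum => v' sv'.
rewrite sg_wsum wsum_mulr state_wsum [RHS]wsum_rev; apply: eq_wsum => d' sd'.
rewrite !take_size_cat // !drop_size_cat // !revK.
rewrite coord_star_scale coord_star_mon mul_scalarsC -coord_mon_cat -(rmorphM iota).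
rewrite stateZ state_mon ker_letters_bar !plain_coef !barred_coef.
by rewrite !unzip2_flip ?unzip1_flip ?sv ?sd ?sv' ?sd'.
Qed.

Lemma coef_delta i : matrix_coef 1 1 (delta C (n := n)) [:: i] [:: i] =
  \sum_x sg (coord_var C (false, (i, x))) * coord_var C (false, (i, x)) :> O.
Proof.
rewrite /matrix_coef /=; apply: eq_bigr => x _.
rewrite (bigD1 x) //= big1 ?addr0 => [|y yx].
  rewrite /delta eqxx (rmorph1 iota) mul1r coord_mon_prod big_cons big_seq1.
  by rewrite coord_star_var; exact: mulrC.
by rewrite /delta eqseq_cons eq_sym (negbTE yx) (rmorph0 iota) mul0r.
Qed.

Section Character.
Variable phi : O -> C.
Hypothesis phiD : forall x y, phi (x + y) = phi x + phi y.
Hypothesis phiM : forall x y, phi (x * y) = phi x * phi y.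
Hypothesis phi_iota : forall c, phi (iota c) = c.
Hypothesis phi_sg : forall x, phi (sg x) = (phi x)^*.

Definition char_matrix : 'M[C]_n := \matrix_(i, j) phi (coord_var C (false, (i, j))).
Local Notation U := char_matrix.

Lemma wcoef_flip (V : 'M[C]_n) (v w : word) :
  \prod_(p <- zip v w) V p.2 p.1 = wcoef V w v.
Proof.
rewrite /wcoef; elim: v w => [|x v IH] [|y w]; rewrite ?big_nil //.
by rewrite /= !big_cons IH.
Qed.

Lemma phi_coef k l F w e : phi (matrix_coef k l F w e) =
  wsum k (fun v => wsum l (fun d =>
     F v d * (wcoef U w v * wcoef (map_mx Num.conj U) e d))).
Proof.
have phi1 : phi 1 = 1 by rewrite -(rmorph1 iota) phi_iota.
have phi0 : phi 0 = 0 by rewrite -(rmorph0 iota) phi_iota.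
rewrite /matrix_coef (wsum_morph (f := phi)) //; apply: eq_wsum => v _.
rewrite (wsum_morph (f := phi)) //; apply: eq_wsum => d _.
rewrite phiM phi_iota; congr (_ * _).
rewrite coord_mon_prod (big_morph phi phiM phi1) /coef_letters big_cat !big_map /=.
congr (_ * _); rewrite -wcoef_flip; apply: eq_bigr => -[i j] _ /=; rewrite !mxE //.
by rewrite -(coord_star_var C (false, (j, i))) phi_sg.
Qed.

Hypothesis phi_coef_mem : forall k l F w e, size w = k -> size e = l -> memA k l F ->
  phi (matrix_coef k l F w e) = F w e.

Lemma char_matrix_unitary : U \is unitarymx.
Proof.
apply/unitarymxP/matrixP => i k.
have := phi_coef_mem (w := [:: i]) (e := [:: k]) erefl erefl A_delta.
have -> : delta C [:: i] [:: k] = (i == k)%:R by rewrite /delta eqseq_cons andbT.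
rewrite phi_coef /= => H; rewrite [RHS]mxE -H mxE; apply: eq_bigr => x _.
rewrite (bigD1 x) //= big1 ?addr0 => [|y yx].
  by rewrite /delta eqxx mul1r !wcoef_cons /wcoef !big_nil !mulr1 !mxE.
by rewrite /delta eqseq_cons eq_sym (negbTE yx) mul0r.
Qed.

Lemma unitary_contragredient : invmx U^T = map_mx Num.conj U.
Proof.
rewrite invmx_unitary ?trmx_unitary ?char_matrix_unitary //.
by rewrite trmxK.
Qed.

Lemma coords_mtact_char z v d : coords (mtact U z) v d =
  phi (matrix_coef (size v) (size d) (coords z) v d).
Proof. by rewrite mtact_coords phi_coef unitary_contragredient. Qed.

Lemma char_matrix_fixes a : A a -> mtact U a = a.
Proof.
move=> Aa; apply/malgP => -[v d].
rewrite -/(coords (mtact U a) v d) coords_mtact_char.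
by rewrite phi_coef_mem //; exact: memA_coords.
Qed.

End Character.

End TannakaState.

(** * Tensors fixed by the stabilizer *)

Section Group.
Variables (R : realType) (n : nat).
Local Notation C := R[i].
Variable A : set (mtens C n).
Local Notation T := (mtens C n).
Local Notation word := (seq 'I_n).
Local Notation memA := (memA A).
Implicit Types (F G : word -> word -> C).
Hypotheses (A_alg : subalgebra A) (A_gr : graded A).
Hypotheses (A_star : star_closed A) (A_con : contraction_closed A).
Hypothesis A_delta : memA 1 1 (delta C (n := n)).
Local Notation K := (ker_words A_alg).
Local Notation O := (coord_ring C n).
Local Notation iota := (@coord_iota C n).
Local Notation sg := (@coord_star C n).
Local Notation st := (state A_alg).
Import spectral.
Local Open Scope sesquilinear_scope.

Let sgK := @coord_starK C n.
Let sg_iota c : sg (iota c) = iota (conjc c) := coord_star_iota n c.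
Let stD := stateD A_alg.
Let stZ := stateZ A_alg.
Let st1 := state1 A_alg A_star A_con A_delta.
Let st_ge0 := state_ge0 A_alg A_star A_con A_delta.

Lemma coef_null k l F w e : size w = k -> size e = l -> memA k l F ->
  null sg st (matrix_coef k l F w e - iota (F w e)).
Proof.
move=> sw se AF; apply: (null_scalar sg_iota stD stZ st1 st_ge0).
  exact: state_coef_mem.
exact: state_coef_sq.
Qed.

Lemma coord_bounded x : bounded_elt iota sg st x.
Proof.
have bvar i j : bounded_elt iota sg st (coord_var C (false, (i, j))).
  apply: (bounded_summand (iota := iota) sgK sg_iota stD stZ st_ge0
     (y := fun j => coord_var C (false, (i, j))) j).
  have := coef_null (w := [:: i]) (e := [:: i]) erefl erefl A_delta.
  have -> : delta C [:: i] [:: i] = 1 by rewrite /delta eqxx.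
  rewrite (rmorph1 iota) coef_delta.
  exact.
have bvar' y : bounded_elt iota sg st (coord_var C y).
  case: y => -[] [i j]; last exact: bvar.
  by rewrite -(coord_star_var C (false, (i, j))); exact: (bounded_sg sgK).
rewrite (coord_sum x); elim/big_ind: _.
- by rewrite -(rmorph0 iota); exact: (bounded_iota sgK sg_iota stD stZ st_ge0).
- by move=> y z; exact: (bounded_add sgK sg_iota stD stZ st_ge0).
move=> m _; apply: (bounded_mul sgK sg_iota stD stZ st_ge0).
  exact: (bounded_iota sgK sg_iota stD stZ st_ge0).
elim: (letters m) => [|y s IH].
  rewrite coord_mon_nil -(rmorph1 iota).
  exact: (bounded_iota sgK sg_iota stD stZ st_ge0).
rewrite (coord_mon_cat C [:: y] s).
by apply: (bounded_mul sgK sg_iota stD stZ st_ge0); [exact: bvar'|exact: IH].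
Qed.

(** If the coordinate of [b] at some word differed from that of its projection on
    [A], then [g] below would not be null, and a character not vanishing at [g]
    would be a unitary matrix that fixes [A] and moves [b]. *)
Lemma fixed_mem b :
  (forall U, U \is unitarymx -> (forall a, A a -> mtact U a = a) -> mtact U b = b) -> A b.
Proof.
move=> bfix; apply: (coords_memA A_alg) => k l.
suff coefK w e : size w = k -> size e = l ->
    wsum k (fun v => wsum l (fun d => coords b v d * K v d w e)) = coords b w e.
  apply: (memA_eq (F := fun w e => wsum k (fun v => wsum l (fun d => coords b v d * K v d w e)))).
    exact: coefK.
  have memA_wsum k' (F : word -> word -> word -> C) :
      (forall v, size v = k' -> memA k l (F v)) -> memA k l (fun w e => wsum k' (fun v => F v w e)).
    elim: k' F => [|k' IH] F AF /=; first exact: AF.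
    apply: memA_sum => // x _; apply: (IH (fun v => F (x :: v))) => v sv.
    by apply: AF; rewrite /= sv.
  apply: (memA_wsum k (fun v w e => wsum l (fun d => coords b v d * K v d w e))) => v sv.
  apply: (memA_wsum l (fun d w e => coords b v d * K v d w e)) => d sd.
  have := memA_lin A_alg (coords b v d) (wkernel_row (ker_wordsP A_alg k l) sv sd) (memA0 A_alg k l).
  by apply: memA_eq => w' e' _ _; rewrite addr0.
move=> sw se; pose g := matrix_coef k l (coords b) w e - iota (coords b w e).
have [g0|gn0] := eqVneq (st (sg g * g)) 0.
  have := null_state sg_iota stD stZ st_ge0 g0.
  rewrite stD -rmorphN -[iota _]mulr1 stZ st1 mulr1 state_coef //.
  by move/eqP; rewrite subr_eq0 => /eqP.
have [phi [phiD phiM phi_iota phi_sg [phi_null /negP[]]]] :=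
  state_character sgK sg_iota stD stZ st1 st_ge0 coord_bounded gn0.
have phi_coef_mem k' l' F w' e' : size w' = k' -> size e' = l' -> memA k' l' F ->
    phi (matrix_coef k' l' F w' e') = F w' e'.
  move=> sw' se' AF; have := phi_null _ (coef_null sw' se' AF).
  by rewrite -rmorphN phiD phi_iota => /eqP; rewrite subr_eq0 => /eqP.
have Uu := char_matrix_unitary A_delta phiD phiM phi_iota phi_sg phi_coef_mem.
have := bfix _ Uu (fun a => char_matrix_fixes A_alg A_gr A_delta phiD phiM phi_iota phi_sg phi_coef_mem (a := a)).
move=> /(congr1 (fun z => coords z w e)).
rewrite (coords_mtact_char A_delta phiD phiM phi_iota phi_sg phi_coef_mem) sw se /g -rmorphN phiD phi_iota => ->.
by rewrite subrr.
Qed.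

End Group.

(** * Invariants of unitary groups *)

Section GroupAction.
Variables (C : numClosedFieldType) (n : nat).
Local Notation T := (mtens C n).
Local Notation word := (seq 'I_n).
Implicit Types (z : T) (U : 'M[C]_n).
Import spectral.
Local Open Scope sesquilinear_scope.

Lemma wcoef1 (v w : word) : size v = size w -> wcoef 1%:M v w = (v == w)%:R :> C.
Proof.
elim: v w => [|x v IH] [|y w] //= => [_|[/IH e]]; first by rewrite /wcoef big_nil.
by rewrite wcoef_cons e mxE eqseq_cons; case: (x == y); rewrite ?mul1r ?mul0r.
Qed.

Lemma act_word1 a : act_word 1%:M a = << a >> :> T.
Proof.
case: a => w e; rewrite /act_word trmx1 invmx1 prod_vec_covec; apply/malgP => -[v d].
rewrite tensE mcoeffU1 mword_eqE (eq_sym w) (eq_sym e).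
case: ifP => [/andP[/eqP sv /eqP sd]|].
  by rewrite !wcoef1 //; case: (v == w); rewrite ?mul1r ?mul0r.
move=> ne; case: (boolP ((v == w) && (d == e))) => // /andP[/eqP ev /eqP ed].
by move: ne; rewrite ev ed !eqxx.
Qed.

Lemma mtact_id z : mtact 1%:M z = z.
Proof.
elim/mtens_ind: z => [x y|c x|a|]; rewrite ?mtactD ?mtactZ ?mtact0 //; first by move=> -> ->.
  by move=> ->.
by rewrite mtactU act_word1.
Qed.

Lemma mtact_word_comp U U' a : U \in unitmx -> U' \in unitmx ->
  mtact U (mtact U' (<< a >> : T)) = mtact (U *m U') << a >>.
Proof.
move=> hU hU'.
rewrite !mtactU /act_word mtactM !(big_morph _ (mtactM U) (mtact1 U)).
congr (_ * _); apply: eq_bigr => i _.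
  by rewrite mtact_vec !colE mulmxA.
rewrite mtact_covec; congr covec; rewrite !colE mulmxA; congr (_ *m _).
have hUU : U'^T *m U^T \in unitmx by rewrite unitmx_mul !unitmx_tr hU'.
rewrite trmx_mul -[LHS](mulKmx hUU) -[RHS]mulmx1; congr (_ *m _).
rewrite -mulmxA (mulmxA U^T) mulmxV ?unitmx_tr // mul1mx.
by rewrite mulmxV ?unitmx_tr.
Qed.

Lemma mtact_comp U U' z : U \in unitmx -> U' \in unitmx ->
  mtact U (mtact U' z) = mtact (U *m U') z.
Proof.
move=> hU hU'; elim/mtens_ind: z => [x y hx hy|c x hx|a|].
- by rewrite (mtactD U') (mtactD U) (mtactD (U *m U')) hx hy.
- by rewrite (mtactZ U') (mtactZ U) (mtactZ (U *m U')) hx.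
- exact: mtact_word_comp.
- by rewrite !mtact0.
Qed.
Lemma mtact_tens U z k l :
  mtact U (tens k l (coords z)) = tens k l (coords (mtact U z)).
Proof.
apply/malgP => -[v d]; rewrite -/(coords _ v d) mtact_coords tensE mtact_coords.
case: ifP => [/andP[/eqP sv /eqP sd]|ne].
  apply: eq_wsum => w sw; apply: eq_wsum => e se.
  by rewrite [X in X * _]/coords tensE sw se sv sd !eqxx.
rewrite -[RHS](wsum_zero n C (size v)); apply: eq_wsum => w sw.
rewrite -[RHS](wsum_zero n C (size d)); apply: eq_wsum => e se.
by rewrite [X in X * _]/coords tensE sw se ne mul0r.
Qed.

Section Unitary.
Variable U : 'M[C]_n.
Hypothesis U_unitary : U \is unitarymx.

Lemma invmx_tr_unitary : invmx U^T = map_mx Num.conj U.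
Proof. by rewrite invmx_unitary ?trmx_unitary // trmxK. Qed.

Lemma mtstar_vec (x : 'cV[C]_n) : mtstar (vec x) = covec (map_mx Num.conj x).
Proof.
rewrite /vec /covec (big_morph _ (@mtstarD C n) (@mtstar0 C n)).
by apply: eq_bigr => i _; rewrite mtstarZ mtstar_ebasis mxE.
Qed.

Lemma mtstar_covec (x : 'cV[C]_n) : mtstar (covec x) = vec (map_mx Num.conj x).
Proof.
rewrite -[RHS]mtstarK mtstar_vec; congr (mtstar (covec _)).
by apply/matrixP => i j; rewrite !mxE conjCK.
Qed.

Lemma mtstar_prod (J : Type) (r : seq J) (F : J -> T) :
  mtstar (\prod_(i <- r) F i) = \prod_(i <- rev r) mtstar (F i).
Proof.
elim: r => [|x r IH]; first by rewrite !big_nil mtstarU.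
by rewrite rev_cons -cats1 big_cat big_seq1 big_cons mtstarM IH.
Qed.

Lemma mtact_mtstar z : mtact U (mtstar z) = mtstar (mtact U z).
Proof.
elim/mtens_ind: z => [x y|c x|[w e]|].
- by rewrite !(mtstarD, mtactD) => -> ->.
- by rewrite !(mtstarZ, mtactZ) => ->.
- rewrite mtstarU !mtactU /act_word /= mtstarM !mtstar_prod invmx_tr_unitary.
  congr (_ * _); apply: eq_bigr => i _.
    by rewrite mtstar_covec; congr vec; apply/matrixP => a b; rewrite !mxE conjCK.
  by rewrite mtstar_vec; congr covec; apply/matrixP => a b; rewrite !mxE.
- by rewrite mtstar0 mtact0 mtstar0.
Qed.

Lemma wcoef_ins (V : 'M[C]_n) i p q (v w : word) : size v = size w -> (i <= size v)%N ->
  wcoef V (ins i p v) (ins i q w) = V p q * wcoef V v w.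
Proof.
move=> vw iv; rewrite -{2}(cat_take_drop i v) -{2}(cat_take_drop i w) /wcoef /ins.
have s : size (take i v) = size (take i w) by rewrite !size_takel -?vw.
by rewrite !zip_cat // !big_cat /= big_cons mulrCA.
Qed.

Lemma unitary_col q q' : \sum_p U p q * (U p q')^* = (q == q')%:R.
Proof.
have /mulmx1C /matrixP/(_ q' q) := unitarymxP U_unitary.
rewrite [in X in X -> _]mxE [in X in X -> _]mxE eq_sym => <-.
by apply: eq_bigr => p _; rewrite !mxE mulrC.
Qed.

Lemma unitary_row i k : \sum_x U i x * (U k x)^* = (i == k)%:R.
Proof.
have /matrixP/(_ i k) := unitarymxP U_unitary; rewrite !mxE => <-.
by apply: eq_bigr => x _; rewrite !mxE.
Qed.

Lemma mtact_delta : mtact U (tens 1 1 (delta C (n := n))) = tens 1 1 (delta C (n := n)).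
Proof.
apply/malgP => -[v d]; rewrite -/(coords _ v d) mtact_coords invmx_tr_unitary tensE.
case: ifP => [|ne]; last first.
  rewrite -[RHS](wsum_zero n C (size v)); apply: eq_wsum => w sw.
  rewrite -[RHS](wsum_zero n C (size d)); apply: eq_wsum => e se.
  by rewrite [X in X * _]/coords tensE sw se ne mul0r.
case: v => [|i []] //; case: d => [|k []] // _ /=.
rewrite /delta eqseq_cons andbT -unitary_row; apply: eq_bigr => x _.
rewrite (bigD1 x) //= big1 ?addr0 => [|y yx].
  by rewrite /coords tensE /= /delta eqxx mul1r !wcoef_cons /wcoef !big_nil !mulr1 mxE.
by rewrite /coords tensE /= /delta eqseq_cons eq_sym (negbTE yx) mul0r.
Qed.

(** Contracting two legs of [z^U] brings together a row of [U] and a row of its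
    conjugate, summed over the row index: the result is the identity. *)
Lemma mtact_contract k l i j z : (i < k)%N -> (j < l)%N -> bidegree k l z ->
  mtact U z = z -> mtact U (mtcontract i j z) = mtcontract i j z.
Proof.
case: k => // k ik; case: l => // l jl zb zU.
rewrite (bidegree_tens zb) mtcontract_tens //.
set G := fun v d => _.
apply/malgP => -[v d]; rewrite -/(coords _ v d) mtact_coords invmx_tr_unitary tensE.
case: ifP => [/andP[/eqP sv /eqP sd]|ne]; last first.
  rewrite -[RHS](wsum_zero n C (size v)); apply: eq_wsum => w sw.
  rewrite -[RHS](wsum_zero n C (size d)); apply: eq_wsum => e se.
  by rewrite [X in X * _]/coords tensE sw se ne mul0r.
rewrite sv sd {2}/G.
have e1 p : coords z (ins i p v) (ins j p d) = \sum_q \sum_q' (U p q * (U p q')^* ) *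
   wsum k (fun w => wsum l (fun e => coords z (ins i q w) (ins j q' e) *
      (wcoef U v w * wcoef (map_mx Num.conj U) d e))).
  rewrite -{1}zU mtact_coords invmx_tr_unitary !size_ins ?sv ?sd //.
  rewrite (wsum_ins _ (ik : i <= k)%N); apply: eq_bigr => q _.
  under eq_wsum => w sw do rewrite (wsum_ins _ (jl : j <= l)%N).
  rewrite wsum_sum; apply: eq_bigr => q' _.
  rewrite wsum_mull; apply: eq_wsum => w sw; rewrite wsum_mull; apply: eq_wsum => e se.
  by rewrite !wcoef_ins ?sv ?sd ?sw ?se // mxE; ring.
under [RHS]eq_bigr => p _ do rewrite e1.
rewrite exchange_big /=.
transitivity (\sum_q wsum k (fun w => wsum l (fun e => coords z (ins i q w) (ins j q e) *
      (wcoef U v w * wcoef (map_mx Num.conj U) d e)))).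
  rewrite -wsum_sum; apply: eq_wsum => w sw; rewrite -wsum_sum; apply: eq_wsum => e se.
  by rewrite {1}/coords tensE sw se !eqxx /= /G mulr_suml.
apply: eq_bigr => q _; rewrite exchange_big /=.
under [RHS]eq_bigr => q' _ do rewrite -mulr_suml unitary_col.
rewrite (bigD1 q) //= eqxx mul1r big1 ?addr0 // => q' qq'.
by rewrite eq_sym (negbTE qq') mul0r.
Qed.

End Unitary.

Lemma bidegree_mul k l k' l' x y : bidegree k l x -> bidegree k' l' y ->
  bidegree (k + k') (l + l') (x * y : T).
Proof.
move=> /bidegree_tens -> /bidegree_tens ->; rewrite tensM; exact: tens_bidegree.
Qed.

Lemma vec_tens (x : 'cV[C]_n) :
  vec x = tens 1 0 (fun v _ => if v is i :: _ then x i 0 else 0).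
Proof. by []. Qed.

Lemma covec_tens (x : 'cV[C]_n) :
  covec x = tens 0 1 (fun _ d => if d is i :: _ then x i 0 else 0).
Proof. by []. Qed.

(** Only the products of one vector and one covector reach bidegree (1, 1), and [f]
    kills the vector. *)
Lemma mixed_tensors_annihilated (W : {vspace 'cV[C]_n}) (f : 'I_n -> C) :
  (forall w : 'cV[C]_n, w \in W -> \sum_i f i * w i 0 = 0) ->
  forall z, mixed_tensors_over W z -> forall j, \sum_i f i * coords z [:: i] [:: j] = 0.
Proof.
move=> fW z [m [c [t [tS ->]]]] j.
pose L (x : T) := \sum_i f i * coords x [:: i] [:: j].
have LD x y : L (x + y) = L x + L y.
  by rewrite /L -big_split; apply: eq_bigr => i _; rewrite /coords mcoeffD mulrDr.
have LZ a x : L (a *: x) = a * L x.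
  by rewrite /L mulr_sumr; apply: eq_bigr => i _; rewrite /coords mcoeffZ mulrCA.
have L0 : L 0 = 0 by rewrite /L big1 // => i _; rewrite /coords mcoeff0 mulr0.
rewrite -/(L _) (big_morph L LD L0) big1 // => i _; rewrite LZ.
have [x [y [[mx [cx [xs [xsS ->]]]] [my [cy [ys [ysS ->]]]] ->]]] := tS i.
rewrite mulr_suml (big_morph L LD L0) big1 ?mulr0 // => ix _.
rewrite mulr_sumr (big_morph L LD L0) big1 // => iy _.
rewrite mtens_mulZr LZ -(scalerAl (cx ix)) LZ.
have [s sS ->] := xsS ix; have [s' s'S ->] := ysS iy.
suff -> : L ((\prod_(x <- s) x) * \prod_(x <- s') x) = 0 by rewrite !mulr0.
have bs : bidegree (size s) 0 (\prod_(x <- s) x).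
  elim: s sS => [|a s IH] sS; first by rewrite big_nil => a; rewrite msuppU1 inE => /eqP ->.
  rewrite big_cons -[size _]add1n -[0%N]addn0; apply: bidegree_mul; last first.
    by apply: IH => y' ys'; apply: sS; rewrite inE ys' orbT.
  have [w _ <-] : (@vec C n @` [set w | w \in W])%classic a by apply: sS; rewrite mem_head.
  by rewrite vec_tens; exact: tens_bidegree.
have bs' : bidegree 0 (size s') (\prod_(x <- s') x).
  elim: s' s'S => [|a s' IH] sS'; first by rewrite big_nil => a; rewrite msuppU1 inE => /eqP ->.
  rewrite big_cons -[size _]add1n -[0%N]addn0; apply: bidegree_mul; last first.
    by apply: IH => y' ys'; apply: sS'; rewrite inE ys' orbT.
  have [_ [w _ <-] <-] : (@mtstar C n @` (@vec C n @` [set w | w \in W]))%classic a.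
    by apply: sS'; rewrite mem_head.
  by rewrite mtstar_vec covec_tens; exact: tens_bidegree.
rewrite (bidegree_tens bs) (bidegree_tens bs') tensM addn0 add0n.
rewrite /L.
have [/eqP s1|ns] := boolP (size s == 1)%N; last first.
  by apply: big1 => p _; rewrite [coords _ _ _]tensE /= eq_sym (negbTE ns) mulr0.
case: s s1 sS bs => // a [] // _ sS bs.
have [w wW wa] : (@vec C n @` [set w | w \in W])%classic a by apply: sS; rewrite mem_head.
have [s'1|ns'] := boolP (size s' == 1)%N; last first.
  by apply: big1 => p _; rewrite [coords _ _ _]tensE /= eq_sym (negbTE ns') mulr0.
rewrite (eq_bigr (fun p => f p * w p 0 * coords (\prod_(x <- s') x) [::] [:: j])); last first.
  move=> p _; rewrite [X in _ * X]tensE /= (eq_sym 1%N) s'1 -mulrA; congr (_ * (_ * _)).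
  by rewrite /coords big_seq1 -wa vec_tens tensE.
by rewrite -mulr_suml fW ?mul0r.
Qed.

Lemma nonfull_annihilator (W : {vspace 'cV[C]_n}) : W != fullv ->
  exists2 f : 'I_n -> C, (forall w : 'cV[C]_n, w \in W -> \sum_i f i * w i 0 = 0) &
    exists j, f j != 0.
Proof.
move=> Wn.
have [v vW] : exists v : 'cV[C]_n, v \notin W.
  apply: contrapT => H; move/negP: Wn; apply; rewrite eqEsubv subvf /=.
  by apply/subvP => v _; apply: contrapT => /negP nv; apply: H; exists v.
pose g : 'cV[C]_n -> 'cV[C]_n := fun x => x - projv W x.
have [i gi] : exists i, g v i 0 != 0.
  apply: contrapT => H; move/negP: vW; apply.
  have -> : v = projv W v.
    apply/eqP; rewrite -subr_eq0; apply/eqP/matrixP => i k; rewrite ord1 [RHS]mxE.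
    by apply: contrapT => /eqP ne; apply: H; exists i.
  exact: memv_proj.
have gsum x : g x i 0 = \sum_k g (delta_mx k 0) i 0 * x k 0.
  have {1}-> : x = \sum_k x k 0 *: delta_mx k 0.
    apply/matrixP => a b; rewrite ord1 summxE (bigD1 a) //= !mxE !eqxx mulr1.
    by rewrite big1 ?addr0 // => k ka; rewrite !mxE eq_sym (negbTE ka) mulr0.
  rewrite /g linear_sum -sumrB summxE; apply: eq_bigr => k _.
  by rewrite linearZ -scalerBr mxE mulrC.
exists (fun k => g (delta_mx k 0) i 0).
  by move=> w wW; rewrite -gsum /g projv_id // subrr mxE.
apply: contrapT => H; move: gi; rewrite gsum big1 ?eqxx // => k _.
have [->|ne] := eqVneq (g (delta_mx k 0) i 0) 0; first by rewrite mul0r.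
by case: H; exists k.
Qed.

Section Invariants.
Variable G : set 'M[C]_n.
Hypothesis G_unitary : forall U, G U -> U \is unitarymx.
Local Notation A := (invariants G).

Lemma invariants_subalgebra : subalgebra A.
Proof.
split=> [U _|x y Ax Ay U GU|c x Ax U GU|x y Ax Ay U GU].
- exact: mtact1.
- by rewrite mtactD Ax ?Ay.
- by rewrite mtactZ Ax.
- by rewrite mtactM Ax ?Ay.
Qed.

Lemma invariants_graded : graded A.
Proof.
apply/seteqP; split=> [z Az|z [N [x [Ax ->]]]].
  exists (word_bound z).+1, (fun k l => tens k l (coords z)); split; last exact: sum_components.
  move=> k l; split; last exact: tens_bidegree.
  by move=> U GU; rewrite mtact_tens Az.
by do 2!apply: (A_sum invariants_subalgebra) => ?; exact: (Ax _ _).1.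
Qed.

Lemma invariants_star_closed : star_closed A.
Proof.
have A_star z : A z -> A (mtstar z).
  by move=> Az U GU; rewrite mtact_mtstar ?Az //; exact: G_unitary.
apply/seteqP; split=> [_ [z Az <-]|z Az]; first exact: A_star.
by exists (mtstar z); [exact: A_star|exact: mtstarK].
Qed.

Lemma invariants_contraction_closed : contraction_closed A.
Proof.
move=> k l i j ik jl z [Az zb] U GU.
exact: (mtact_contract (G_unitary GU) ik jl zb (Az U GU)).
Qed.

Lemma invariants_nondegenerate : nondegenerate_subset A.
Proof.
move=> [W [/nonfull_annihilator[f fW [j fj]] AW]].
have Ad : A (tens 1 1 (delta C (n := n))) by move=> U GU; exact/mtact_delta/G_unitary.
have := mixed_tensors_annihilated fW (AW _ Ad) j.
rewrite (bigD1 j) //= big1 ?addr0 => [|i ij].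
  by rewrite /coords tensE /= /delta eqxx mulr1 => /eqP; rewrite (negbTE fj).
by rewrite /coords tensE /= /delta eqseq_cons (negbTE ij) mulr0.
Qed.

End Invariants.

Lemma fixer_subgroup (A : set T) :
  unitary_subgroup [set U | U \is unitarymx /\ forall a, A a -> mtact U a = a]%classic.
Proof.
split=> [U []//||U U' [Uu Ua] [U'u U'a]|U [Uu Ua]].
- split; first by apply/unitarymxP; rewrite trmx1 map_mx1 mulmx1.
  by move=> a _; exact: mtact_id.
- split; first exact: mul_unitarymx.
  by move=> a Aa; rewrite -mtact_comp ?unitarymx_unit // U'a ?Ua.
- split; first by rewrite invmx_unitary // trmxC_unitary.
  move=> a Aa; rewrite -{1}(Ua a Aa) mtact_comp ?unitmx_inv ?unitarymx_unit //.
  by rewrite mulVmx ?unitarymx_unit // mtact_id.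
Qed.

End GroupAction.

Theorem theorem1 (R : realType) (n : nat) (n_ge1 : (1 <= n)%N)
    (A : set (mtens (complex R) n)) :
  (exists G : set 'M[complex R]_n, unitary_subgroup G /\ A = invariants G)
  <->
  [/\ nondegenerate_subset A, contraction_closed A, graded A, star_closed A
    & subalgebra A].
Proof.
split=> [[G [[Gu _ _ _] ->]]|[ndA A_con A_gr A_star A_alg]].
  split.
  - exact: invariants_nondegenerate.
  - exact: invariants_contraction_closed.
  - exact: invariants_graded.
  - exact: invariants_star_closed.
  - exact: invariants_subalgebra.
exists [set U | U \is unitarymx /\ forall a, A a -> mtact U a = a]%classic.
split; first exact: fixer_subgroup.
have A_delta := delta_mem A_alg A_gr A_star A_con ndA.
apply/seteqP; split=> [a Aa U [_ Ua]|b bG]; first exact: Ua.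
by apply: (fixed_mem A_alg A_gr A_star A_con A_delta) => U Uu Ua; exact: bG.
Qed.
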